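(* Let $a$ be a symmetric, sub-gaussian random variable with $\mathbb{E}a^2=1$ and sub-gaussian norm $\kappa$, and suppose $\|a-g\|_{TV}\le\varepsilon$ where $g\sim N(0,1)$. Let $\mathbf{a}_1,\dots,\mathbf{a}_m$ be independent random vectors in $\mathbb{R}^n$ whose coordinates are i.i.d. copies of $a$. Let $K\subseteq B_2^n$ and fix $\mathbf{x}\in K$ with $\|\mathbf{x}\|_2=1$. Let $p\in[0,1/2)$, let $\varepsilon_1,\dots,\varepsilon_m$ be i.i.d., independent of the $\mathbf{a}_i$, with $P(\varepsilon_i=1)=1-p$, $P(\varepsilon_i=-1)=p$, and let $y_i=\varepsilon_i\,\mathrm{sign}(\langle\mathbf{a}_i,\mathbf{x}\rangle)$. Then for each $\beta>0$, with probability at least $1-4e^{-\beta^2}$, the solution $\widehat{\mathbf{x}}$ of $\max\sum_{i=1}^m y_i\langle\mathbf{a}_i,\mathbf{x}'\rangle$ subject to $\mathbf{x}'\in K$ satisfies $$\|\mathbf{x}-\widehat{\mathbf{x}}\|_2^2\le C\sqrt{\kappa}\,\varepsilon^{1/8}+\frac{C\kappa}{(1-2p)\sqrt m}\big(w(K)+\beta\big),$$ where $C>0$ is an absolute constant.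
   Context: $\|a-g\|_{TV}=\sup_A|P(a\in A)-P(g\in A)|$ over Borel sets $A$. $\mathrm{sign}(t)=1$ if $t\ge0$ and $-1$ otherwise. The sub-gaussian norm is $\kappa=\sup_{q\ge1}q^{-1/2}(\mathbb{E}|a|^q)^{1/q}<\infty$. $w(K)=\mathbb{E}\sup_{\mathbf{u}\in K-K}\langle\mathbf{g},\mathbf{u}\rangle$ with $\mathbf{g}$ standard Gaussian in $\mathbb{R}^n$; $B_2^n$ is the Euclidean unit ball. *)

(* Defs.v *)
From HB Require Import structures.
From mathcomp Require Import all_boot all_order all_algebra.
From mathcomp Require Import all_classical all_reals all_analysis.
Set Implicit Arguments. Unset Strict Implicit. Unset Printing Implicit Defensive.
Import Order.TTheory GRing.Theory Num.Def Num.Theory.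
Import numFieldNormedType.Exports.
Local Open Scope classical_set_scope.
Local Open Scope ring_scope.

Definition dotp {R : realType} {n : nat} (u v : 'rV[R]_n) : R :=
  \sum_(j < n) u ord0 j * v ord0 j.
Definition norm2 {R : realType} {n : nat} (u : 'rV[R]_n) : R :=
  Num.sqrt (dotp u u).

Definition sgn {R : realType} (t : R) : R := if 0 <= t then 1 else -1.

Definition mutually_independent {d} {T : measurableType d} {R : realType}
  (P : probability T R) {I : finType} (X : I -> T -> R) : Prop :=
  forall (J : {set I}) (B : I -> set R), (forall i, measurable (B i)) ->
    P (\bigcap_(i in [set i | i \in J]) (X i @^-1` B i)) =
    (\prod_(i in J) P (X i @^-1` B i))%E.

Definition tv_dist {R : realType} (mu nu : set R -> \bar R) : \bar R :=
  ereal_sup [set (`| mu A - nu A |)%E | A in [set A : set R | measurable A]].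

Definition subg_norm {R : realType} (mu : set R -> \bar R) : \bar R :=
  ereal_sup [set ((q `^ (- (1/2)))%:E *
                  poweR (\int[mu]_x ((`|x| `^ q)%:E)) (1 / q))%E
            | q in [set q : R | 1 <= q]].

Definition diffset {R : realType} {n : nat} (K : set 'rV[R]_n) : set 'rV[R]_n :=
  [set u - v | u in K & v in K].

(* Gaussian width E sup_{u in K-K} <g,u>, computed with a standard Gaussian
   vector g = (G_0, ..., G_{n-1}) living on a probability space Q. *)
Definition gaussian_width_wrt {R : realType} {d} {W : measurableType d}
  (Q : probability W R) {n : nat} (G : 'I_n -> W -> R) (K : set 'rV[R]_n)
  : \bar R :=
  (\int[Q]_w ereal_sup [set (dotp (\row_j G j w) u)%:E | u in diffset K])%E.

(* Main.v *)
(* Write <a, u> for the linear form of a measurement a and let lam = E|g|. The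
   mean of y_i <a_i, u> is (1 - 2p) E sign<a, x> <a, u>, and E sign<a, x> <a, u>
   is a subgradient at x, applied to u, of the convex function N(u) = E|<a, u>|.
   A Lindeberg replacement of a smoothed absolute value, using the total
   variation distance on bounded test functions and fourth moments beyond, shows
   that N is uniformly close to lam times the Euclidean norm, so that this mean
   is at most lam <x, u> + O(sqrt kappa eps^(1/8)).

   For the deviations from the mean, a symmetric sub-gaussian variable is dominated
   by C kappa g on convex test functions. Exponentials of maxima of linear
   forms are convex, so the signed sums may be replaced one measurement at a time
   by independent Gaussian vectors, whose sum is sqrt m times a single Gaussian
   vector. Rotation invariance of Gaussian pairs bounds the moment generating
   function of the supremum in terms of its mean w(K), and Markov's inequality
   concludes, first for finitely many points and then for a dense sequence in K.

   Optimality of the solution makes the empirical sum of y_i <a_i, u> nonnegative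
   at u = xhat - x, while ||u||^2 <= - 2 <x, u> since ||xhat|| <= 1 = ||x||. *)

Require Import Defs.
From HB Require Import structures.
From mathcomp Require Import all_boot all_order all_algebra.
From mathcomp Require Import all_classical all_reals all_analysis.
From mathcomp Require Import measurable_realfun ring lra.
Import Order.TTheory GRing.Theory Num.Def Num.Theory.
Import numFieldNormedType.Exports.
Local Open Scope classical_set_scope.
Local Open Scope ring_scope.
Set Implicit Arguments. Unset Strict Implicit. Unset Printing Implicit Defensive.

(** * Iterated products and replacement of independent summands *)

(** The exponent 1/8 comes from three balancings. Total variation controls only bounded functions,
    so quadratic test functions are cut at a level governed by [T], and [T * eps + kappa ^ 4 / T] is
    at best of order kappa^2 eps^(1/2). Smoothing the absolute value at scale [delta] divides this
    by [delta] and adds [delta]: order kappa eps^(1/4). A function known up to eta determines its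
    subgradients only up to eta / s + s for a step s: order sqrt kappa eps^(1/8). The error must not
    grow with n: symmetry cancels first-order terms, so replacing coordinate j costs a multiple of
    u_j^2, and these costs add up to a squared norm. For the deviations, the obstacle is that y_i
    depends on a_i, so that y_i a_i need not be symmetric nor have independent coordinates.
    Convexity removes the label: after a centering that costs a factor 2, the bound is an average
    over both signs of <a_i, u>, which does not see y_i. Only the symmetric vector a_i is then
    compared with a Gaussian one. *)

Section nested_power.
Context {R : realType}.

Fixpoint powd (d : measure_display) (n : nat) : measure_display :=
  match n with
  | 0%N => default_measure_display
  | S k => measure_prod_display (d, powd d k)
  end.

(* Vectors are nested pairs, so that integrals over [pow B n] are computed by
   induction on [n] with Fubini's theorem. *)
Fixpoint pow {d : measure_display} (B : measurableType d) (n : nat) :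
    measurableType (powd d n) :=
  match n return measurableType (powd d n) with
  | 0%N => (unit : measurableType default_measure_display)
  | S k => ((B * pow B k)%type :
              measurableType (measure_prod_display (d, powd d k)))
  end.

Fixpoint pprod {d : measure_display} {B : measurableType d}
    (nu : nat -> probability B R) (n : nat) : probability (pow B n) R :=
  match n return probability (pow B n) R with
  | 0%N => (\d_tt : probability unit R)
  | S k => ((nu 0%N \x pprod (fun j => nu j.+1) k)%E :
              probability (B * pow B k)%type R)
  end.

(** The index [i : I] stands for a point at which the random sum is evaluated; keeping the whole
    family lets a functional such as a maximum over [i] see all values at once. *)
Fixpoint psum {d : measure_display} {B : measurableType d} {I : Type}
    (X : nat -> I -> B -> R) {n : nat} : pow B n -> I -> R :=
  match n return pow B n -> I -> R with
  | 0%N => fun _ _ => 0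
  | S k => fun (v : B * pow B k) i => X 0%N i v.1 + psum (fun j => X j.+1) (v.2 : pow B k) i
  end.

Lemma measurable_psum (d : measure_display) (B : measurableType d) (I : Type)
    (X : nat -> I -> B -> R) (n : nat) (i : I) :
  (forall j, measurable_fun setT (X j i)) ->
  measurable_fun setT (fun v : pow B n => psum X v i).
Proof.
elim: n X => [|n IH] X mX /=; first exact: measurable_cst.
apply: measurable_funD.
  by apply: measurableT_comp (mX 0%N) _; exact: measurable_fst.
by apply: measurableT_comp (IH _ (fun j => mX j.+1)) _; exact: measurable_snd.
Qed.

(* Measurability of [Psi] is asked along measurable families only, so that no
   sigma-algebra on [I -> R] is needed. *)
Definition measurable_functional (I : Type) (Psi : (I -> R) -> R) : Prop :=
  forall (d : measure_display) (D : measurableType d) (Z : I -> D -> R),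
    (forall i, measurable_fun setT (Z i)) ->
    measurable_fun setT (fun w => Psi (fun i => Z i w)).

Lemma integral_prob_cst (d : measure_display) (D : measurableType d)
    (mu : probability D R) (c : \bar R) : (\int[mu]_x c = c)%E.
Proof.
transitivity (c * mu setT)%E; first exact: (integral_cst mu measurableT c).
by rewrite probability_setT mule1.
Qed.

Lemma integralD_cst (d : measure_display) (D : measurableType d)
    (mu : probability D R) (f : D -> \bar R) (c : R) :
  measurable_fun setT f -> (forall x, 0 <= f x)%E -> 0 <= c ->
  (\int[mu]_x (f x + c%:E) = \int[mu]_x f x + c%:E)%E.
Proof.
move=> mf f0 c0; rewrite ge0_integralD//=.
  by rewrite integral_prob_cst.
Qed.

End nested_power.

Section hybrid.
Context {R : realType} {d d' : measure_display}.
Context {B : measurableType d} {B' : measurableType d'} {I : Type}.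
Variable Psi : (I -> R) -> R.
Hypothesis mPsi : measurable_functional Psi.
Hypothesis Psi0 : forall c, 0 <= Psi c.

(** Replacement principle behind both the Lindeberg argument ([e] positive) and the convex
    domination ([e = 0]). The arbitrary shift [c] absorbs the summands that are frozen while another
    one is replaced; since all measures are probabilities, the errors simply add. *)
Lemma psum_le (n : nat) (nu : nat -> probability B R)
    (nu' : nat -> probability B' R) (X : nat -> I -> B -> R)
    (Y : nat -> I -> B' -> R) (e : nat -> R) (c : I -> R) :
  (forall j i, measurable_fun setT (X j i)) ->
  (forall j i, measurable_fun setT (Y j i)) ->
  (forall j, 0 <= e j) ->
  (forall j c, \int[nu j]_b (Psi (fun i => c i + X j i b))%:E <=
    \int[nu' j]_b (Psi (fun i => c i + Y j i b))%:E + (e j)%:E)%E ->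
  (\int[pprod nu n]_v (Psi (fun i => c i + psum X v i))%:E <=
   \int[pprod nu' n]_v (Psi (fun i => c i + psum Y v i))%:E +
    (\sum_(j < n) e j)%:E)%E.
Proof.
elim: n nu nu' X Y e c => [|n IH] nu nu' X Y e c mX mY e0 H.
  rewrite big_ord0 adde0 /=.
  by rewrite !integral_dirac// !diracT.
have mX' j i := mX j.+1 i.
have mY' j i := mY j.+1 i.
pose nuS j := nu j.+1; pose nuS' j := nu' j.+1.
pose XS j := X j.+1; pose YS j := Y j.+1.
have mpsum_fst : forall i, measurable_fun setT
    (fun z : B * pow B' n => c i + X 0%N i z.1 + psum YS z.2 i).
  move=> i; apply: measurable_funD; first apply: measurable_funD => //.
    by apply: measurableT_comp (mX 0%N i) _; exact: measurable_fst.
  exact: (measurableT_comp (measurable_psum (X := YS) (mY'^~ i)) measurable_snd).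
have mpsum_fstX : forall i, measurable_fun setT
    (fun z : B * pow B n => c i + X 0%N i z.1 + psum XS z.2 i).
  move=> i; apply: measurable_funD; first apply: measurable_funD => //.
    by apply: measurableT_comp (mX 0%N i) _; exact: measurable_fst.
  exact: (measurableT_comp (measurable_psum (X := XS) (mX'^~ i)) measurable_snd).
have mpsum_fstY : forall i, measurable_fun setT
    (fun z : B' * pow B' n => c i + Y 0%N i z.1 + psum YS z.2 i).
  move=> i; apply: measurable_funD; first apply: measurable_funD => //.
    by apply: measurableT_comp (mY 0%N i) _; exact: measurable_fst.
  exact: (measurableT_comp (measurable_psum (X := YS) (mY'^~ i)) measurable_snd).
(* Three hybrids: [f] has no summand replaced, [g] all but the first, [h] all of them. The induction
   hypothesis compares [f] with [g] at a fixed head; after exchanging the integrals, the one-summand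
   hypothesis compares [g] with [h] at a fixed tail. *)
pose f z := (Psi (fun i => c i + X 0%N i z.1 + psum XS (z.2 : pow B n) i))%:E.
pose g z := (Psi (fun i => c i + X 0%N i z.1 + psum YS (z.2 : pow B' n) i))%:E.
pose h z := (Psi (fun i => c i + Y 0%N i z.1 + psum YS (z.2 : pow B' n) i))%:E.
have mf : measurable_fun setT f by apply/measurable_EFinP; exact: mPsi mpsum_fstX.
have mg : measurable_fun setT g by apply/measurable_EFinP; exact: mPsi mpsum_fst.
have mh : measurable_fun setT h by apply/measurable_EFinP; exact: mPsi mpsum_fstY.
have f0 z : (0 <= f z)%E by rewrite lee_fin.
have g0 z : (0 <= g z)%E by rewrite lee_fin.
have h0 z : (0 <= h z)%E by rewrite lee_fin.
have -> : (\int[pprod nu n.+1]_v (Psi (fun i => c i + psum X v i))%:E =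
    \int[nu 0%N \x pprod nuS n]_z f z)%E.
  by apply: eq_integral => v _ /=; rewrite /f; congr (Psi _)%:E; apply/funext => i; rewrite addrA.
have -> : (\int[pprod nu' n.+1]_v (Psi (fun i => c i + psum Y v i))%:E =
    \int[nu' 0%N \x pprod nuS' n]_z h z)%E.
  by apply: eq_integral => v _ /=; rewrite /h; congr (Psi _)%:E; apply/funext => i; rewrite addrA.
pose s := (\sum_(j < n) e j.+1).
have s0 : 0 <= s by apply: sumr_ge0.
rewrite fubini_tonelli1//.
apply: (@le_trans _ _ (\int[nu 0%N]_b (\int[pprod nuS' n]_v g (b, v) + s%:E))%E).
  apply: ge0_le_integral => //.
  - by move=> x _; apply: integral_ge0.
  - exact: measurable_fun_fubini_tonelli_F.
  - by apply: emeasurable_funD => //; exact: measurable_fun_fubini_tonelli_F.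
  - by move=> b _; apply: (IH nuS nuS' XS YS (fun j => e j.+1)
      (fun i => c i + X 0%N i b) mX' mY') => // j c'; exact: H.
rewrite integralD_cst//; last 2 first.
- exact: measurable_fun_fubini_tonelli_F.
- by move=> b; exact: integral_ge0.
rewrite big_ord_recl EFinD addeA leeD2r//.
rewrite fubini_tonelli//.
rewrite fubini_tonelli2//.
rewrite -integralD_cst//; last 2 first.
- exact: measurable_fun_fubini_tonelli_G.
- by move=> b; exact: integral_ge0.
apply: ge0_le_integral => //.
- by move=> x _; apply: integral_ge0.
- exact: measurable_fun_fubini_tonelli_G.
- by apply: emeasurable_funD => //; exact: measurable_fun_fubini_tonelli_G.
- move=> v _.
  rewrite /g /h /fubini_G /=.
  have := H 0%N (fun i => c i + psum YS v i).
  under eq_integral do under eq_fun do rewrite addrAC.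
  under [in X in (_ <= X + _)%E -> _]eq_integral do under eq_fun do rewrite addrAC.
  by [].
Qed.

End hybrid.

(** * Laws of independent families *)

(** The factor [k] is there because [m] will be a probability restricted to an event. It is absorbed
    into the first factor, so that uniqueness of product measures still applies. *)
Lemma preimage_rect_unique {R : realType} d d1 d2 (T : measurableType d)
    (T1 : measurableType d1) (T2 : measurableType d2) (P1 : probability T1 R)
    (P2 : probability T2 R) (m : {measure set T -> \bar R}) (Z : T -> T1 * T2)
    (k : {nonneg R}) :
  measurable_fun setT Z ->
  (forall A B, measurable A -> measurable B ->
    m (Z @^-1` (A `*` B)) = k%:num%:E * (P1 A * P2 B))%E ->
  forall C, measurable C -> (m (Z @^-1` C) = k%:num%:E * (P1 \x P2) C)%E.
Proof.
move=> mZ H C mC.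
pose mm := measure_function_pushforward__canonical__measure_function_Measure m mZ.
transitivity ((mscale k P1 \x P2)%E C).
  apply/esym; apply: (@product_measure_unique _ _ _ _ _ _ _ mm) => // A B mA mB.
  by rewrite /mm /= /pushforward H// /mscale/= muleA.
rewrite /product_measure1 ge0_integral_mscale//=.
exact: measurable_fun_xsection.
Qed.

Lemma measurable_preimage d d' (T : measurableType d) (T' : measurableType d')
    (f : T -> T') (C : set T') :
  measurable_fun setT f -> measurable C -> measurable (f @^-1` C).
Proof. by move=> mf mC; rewrite -[X in measurable X]setTI; exact: mf. Qed.

Fixpoint tup d d' (T : measurableType d) (B : measurableType d')
    (X : nat -> T -> B) (n : nat) : T -> pow B n :=
  match n return T -> pow B n with
  | 0%N => fun=> tt
  | S k => fun w => (X 0%N w, tup (fun j => X j.+1) k w)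
  end.

Lemma measurable_tup d d' (T : measurableType d) (B : measurableType d')
    (X : nat -> T -> B) (n : nat) :
  (forall j, measurable_fun setT (X j)) -> measurable_fun setT (tup X n).
Proof.
elim: n X => [|n IH] X mX /=; first exact: measurable_cst.
by apply: measurable_fun_pair => //; apply: IH => j; exact: mX.
Qed.

Section independence.
Context {R : realType} {d : measure_display} {T : measurableType d}.
Variables (P : probability T R) (I : finType) (X : I -> T -> R).
Variable nu : I -> probability R R.
Hypothesis mX : forall i, measurable_fun setT (X i).

(* Conditionally on [D], of probability [c], the [X i] for [i \in J] are still
   independent with laws [nu i]. *)
Definition indep_given (D : set T) (J : {set I}) (c : \bar R) : Prop :=
  forall B : I -> set R, (forall i, measurable (B i)) ->
    P (D `&` \bigcap_(i in [set i | i \in J]) (X i @^-1` B i)) =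
    (c * \prod_(i in J) nu i (B i))%E.

Lemma measurable_rect (J : {set I}) (B : I -> set R) :
  (forall i, measurable (B i)) ->
  measurable (\bigcap_(i in [set i | i \in J]) (X i @^-1` B i)).
Proof.
move=> mB; apply: fin_bigcap_measurable; first exact: finite_finset.
by move=> i _; exact: measurable_preimage.
Qed.

Lemma indep_given_set1 (D : set T) (J : {set I}) (c : \bar R) (k : I) (A : set R) :
  indep_given D J c -> k \in J -> measurable A ->
  indep_given (D `&` X k @^-1` A) (J :\ k) (c * nu k A).
Proof.
move=> H kJ mA B mB.
pose B' i := if i == k then A else B i.
have mB' i : measurable (B' i) by rewrite /B'; case: ifP.
rewrite -setIA (_ : X k @^-1` A `&` _ =
    \bigcap_(i in [set i | i \in J]) (X i @^-1` B' i)); last first.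
  apply/seteqP; split => [w [wA wB] i iJ|w wB'].
    rewrite /B'/=; case: eqP => [->//|ik]; apply: (wB i).
    by rewrite /= in_setD1 iJ andbT; exact/eqP.
  split; first by have /= := wB' k kJ; rewrite /B' eqxx.
  move=> i /=; rewrite in_setD1 => /andP[ik iJ].
  by have /= := wB' i iJ; rewrite /B' (negbTE ik).
rewrite H// (big_setD1 k)//= {1}/B' eqxx muleA; congr (_ * _)%E.
by apply: eq_bigr => i; rewrite in_setD1 => /andP[/negbTE ik _]; rewrite /B' ik.
Qed.

(** Distinctness of the first [n] indices, phrased as drawing without replacement from [J] so that
    it unfolds along the recursion of [tup]. *)
Fixpoint draws (ks : nat -> I) (n : nat) (J : {set I}) : Prop :=
  match n with
  | 0%N => True
  | S n => ks 0%N \in J /\ draws (fun j => ks j.+1) n (J :\ ks 0%N)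
  end.

Fixpoint undrawn (ks : nat -> I) (n : nat) (J : {set I}) : {set I} :=
  match n with
  | 0%N => J
  | S n => undrawn (fun j => ks j.+1) n (J :\ ks 0%N)
  end.

(** Conditioning on the first drawn variable changes the event and its mass, so the induction needs
    [D] and [c] arbitrary. The conclusion keeps the independence of the undrawn variables, so that
    further blocks can be drawn afterwards. *)
Lemma indep_given_tup (n : nat) (ks : nat -> I) (D : set T) (J : {set I})
    (c : \bar R) :
  measurable D -> indep_given D J c -> draws ks n J ->
  forall C, measurable C ->
  indep_given (D `&` tup (fun j => X (ks j)) n @^-1` C) (undrawn ks n J)
    (c * pprod (fun j => nu (ks j)) n C).
Proof.
elim: n ks D J c => [|n IH] ks D J c mD H.
  move=> _ C mC B mB /=.
  rewrite /dirac indicE.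
  have [CT|CT] := boolP (tt \in C).
    rewrite mule1 (_ : _ @^-1` C = setT) ?setIT ?H//.
    by apply/seteqP; split => // w _ /=; rewrite inE in CT.
  rewrite mule0 mul0e (_ : _ @^-1` C = set0) ?setI0 ?set0I ?measure0//.
  by apply/seteqP; split => // w /= Ctt; rewrite notin_setE in CT.
move=> [kJ kdraws] C mC B mB /=.
set Y := tup (fun j => X (ks j.+1)) n.
have mY : measurable_fun setT Y by apply: measurable_tup.
pose Z := fun w => (X (ks 0%N) w, Y w).
have mZ : measurable_fun setT Z by apply: measurable_fun_pair.
set J' := undrawn _ _ _.
pose G := \bigcap_(i in [set i | i \in J']) (X i @^-1` B i).
have mG : measurable G by exact: measurable_rect.
have mDG : measurable (D `&` G) by exact: measurableI.
have key A C' : measurable A -> measurable C' ->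
    (mrestr P mDG (Z @^-1` (A `*` C')) = c * (\prod_(i in J') nu i (B i)) *
      (nu (ks 0%N) A * pprod (fun j => nu (ks j.+1)) n C'))%E.
  move=> mA mC'.
  rewrite /mrestr /=.
  rewrite (_ : _ `&` _ = (D `&` X (ks 0%N) @^-1` A) `&` Y @^-1` C' `&` G); last first.
    by apply/seteqP; split => w /=; tauto.
  have mDA : measurable (D `&` X (ks 0%N) @^-1` A).
    by apply: measurableI => //; exact: measurable_preimage.
  rewrite (IH _ _ _ _ mDA (indep_given_set1 H kJ mA) kdraws C' mC' B mB).
  by rewrite -!muleA; congr (_ * _)%E; rewrite muleA muleC.
(* The full rectangle identifies the normalizing constant as a finite nonnegative mass, which is
   what the scaling of a measure requires. *)
have E : (c * \prod_(i in J') nu i (B i) = P (D `&` G))%E.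
  have := key setT setT measurableT measurableT.
  rewrite !probability_setT !mule1 => <-.
  by rewrite /mrestr /= setXTT preimage_setT setTI.
have E0 : 0 <= fine (P (D `&` G)) by exact: fine_ge0.
have EE : (fine (P (D `&` G)))%:E = P (D `&` G).
  by rewrite fineK//; apply: fin_num_measure.
have := @preimage_rect_unique R _ _ _ _ _ _ (nu (ks 0%N))
  (pprod (fun j => nu (ks j.+1)) n) (mrestr P mDG) Z (NngNum E0) mZ.
rewrite /= EE -E => /(_ key C mC).
rewrite /mrestr /= muleAC => <-; congr (P _).
by apply/seteqP; split => w /=; tauto.
Qed.

Fixpoint draws_blocks (N : nat) (KS : nat -> nat -> I) (m : nat) (J : {set I}) : Prop :=
  match m with
  | 0%N => True
  | S m => draws (KS 0%N) N J /\
           draws_blocks N (fun i => KS i.+1) m (undrawn (KS 0%N) N J)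
  end.

Definition block (N : nat) (KS : nat -> nat -> I) (i : nat) : T -> pow R N :=
  tup (fun j => X (KS i j)) N.
Definition block_law (N : nat) (KS : nat -> nat -> I) (i : nat) :
  probability (pow R N) R := pprod (fun j => nu (KS i j)) N.

Lemma measurable_block N KS i : measurable_fun setT (block N KS i).
Proof. by apply: measurable_tup. Qed.

(** The same peeling one level up: whole blocks are removed, and [indep_given_tup] now plays the
    part that [indep_given_set1] played for single variables. *)
Lemma blocks_law_given (N : nat) (m : nat) (KS : nat -> nat -> I) (D : set T)
    (J : {set I}) (c : \bar R) :
  measurable D -> indep_given D J c -> draws_blocks N KS m J ->
  forall C, measurable C ->
  (P (D `&` tup (block N KS) m @^-1` C) = c * pprod (block_law N KS) m C)%E.
Proof.
elim: m KS D J c => [|m IH] KS D J c mD H.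
  move=> _ C mC /=.
  have Dc : P D = c.
    have := H (fun=> setT) (fun=> measurableT).
    rewrite big1 ?mule1 => [|i _]; last by rewrite probability_setT.
    by rewrite bigcapT ?setIT//; move=> ?; rewrite preimage_setT.
  rewrite /dirac indicE.
  have [CT|CT] := boolP (tt \in C).
    rewrite mule1 (_ : _ @^-1` C = setT) ?setIT//.
    by apply/seteqP; split => // w _ /=; rewrite inE in CT.
  rewrite mule0 (_ : _ @^-1` C = set0) ?setI0 ?measure0//.
  by apply/seteqP; split => // w /= Ctt; rewrite notin_setE in CT.
move=> [bJ bdraws] C mC /=.
set Y := tup (block N (fun i => KS i.+1)) m.
have mY : measurable_fun setT Y by apply: measurable_tup => i; exact: measurable_block.
pose Z := fun w => (block N KS 0%N w, Y w).
have mZ : measurable_fun setT Z.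
  by apply: measurable_fun_pair => //; exact: measurable_block.
have key A C' : measurable A -> measurable C' ->
    (mrestr P mD (Z @^-1` (A `*` C')) = c *
      (block_law N KS 0 A * pprod (block_law N (fun i => KS i.+1)) m C'))%E.
  move=> mA mC'.
  rewrite /mrestr /=.
  rewrite (_ : _ `&` _ = (D `&` block N KS 0 @^-1` A) `&` Y @^-1` C'); last first.
    by apply/seteqP; split => w /=; tauto.
  have mDA : measurable (D `&` block N KS 0 @^-1` A).
    by apply: measurableI => //; apply: measurable_preimage => //; exact: measurable_block.
  by rewrite (IH _ _ _ _ mDA (indep_given_tup mD H bJ mA) bdraws C' mC') muleA.
have E : (c = P D)%E.
  have := key setT setT measurableT measurableT.
  rewrite !probability_setT !mule1 => <-.
  by rewrite /mrestr /= setXTT preimage_setT setTI.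
have E0 : 0 <= fine (P D) by exact: fine_ge0.
have EE : (fine (P D))%:E = P D by rewrite fineK//; apply: fin_num_measure.
have := @preimage_rect_unique R _ _ _ _ _ _ (block_law N KS 0)
  (pprod (block_law N (fun i => KS i.+1)) m) (mrestr P mD) Z (NngNum E0) mZ.
rewrite /= EE -E => /(_ key C mC).
by rewrite /mrestr /= setIC.
Qed.

Lemma ge0_integral_blocks (N : nat) (m : nat) (KS : nat -> nat -> I)
    (F : pow (pow R N) m -> \bar R) :
  indep_given setT [set: I]%SET 1 -> draws_blocks N KS m [set: I]%SET ->
  measurable_fun setT F -> (forall v, 0 <= F v)%E ->
  (\int[P]_w F (tup (block N KS) m w) =
   \int[pprod (block_law N KS) m]_v F v)%E.
Proof.
move=> H dr mF F0.
have mt : measurable_fun setT (tup (block N KS) m).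
  by apply: measurable_tup => i; exact: measurable_block.
rewrite -[LHS](@ge0_integral_pushforward _ _ _ _ R _ mt P setT F)//.
apply: eq_measure_integral => C mC _.
by have := blocks_law_given measurableT H dr mC; rewrite setTI mul1e.
Qed.

Lemma ge0_integral_tup (n : nat) (ks : nat -> I) (F : pow R n -> \bar R) :
  indep_given setT [set: I]%SET 1 -> draws ks n [set: I]%SET ->
  measurable_fun setT F -> (forall v, 0 <= F v)%E ->
  (\int[P]_w F (tup (fun j => X (ks j)) n w) =
   \int[pprod (fun j => nu (ks j)) n]_v F v)%E.
Proof.
move=> H dr mF F0.
have mt : measurable_fun setT (tup (fun j => X (ks j)) n) by apply: measurable_tup.
rewrite -[LHS](@ge0_integral_pushforward _ _ _ _ R _ mt P setT F)//.
apply: eq_measure_integral => C mC _.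
have := indep_given_tup measurableT H dr mC (fun=> measurableT).
rewrite big1 ?mule1 ?mul1e => [|i _]; last by rewrite probability_setT.
rewrite bigcapT ?setIT ?setTI//.
Qed.

End independence.

(** * The standard Gaussian measure *)

Section density.
Context {R : realType} {d : measure_display} {T : measurableType d}.
Variables (mu nu : {measure set T -> \bar R}) (g : T -> R).
Hypothesis mg : measurable_fun setT g.
Hypothesis g0 : forall x, 0 <= g x.
Hypothesis nuE : forall A, measurable A -> (nu A = \int[mu]_(x in A) (g x)%:E)%E.

Import HBNNSimple.

Let mgE : measurable_fun setT (fun x => (g x)%:E).
Proof. exact/measurable_EFinP. Qed.

Let integral_density_indic A : measurable A ->
  (\int[nu]_x (\1_A x)%:E = \int[mu]_x ((\1_A x)%:E * (g x)%:E))%E.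
Proof.
move=> mA; rewrite integral_indic// setIT nuE// integral_mkcond.
apply: eq_integral => x _; rewrite patchE indicE.
by case: ifPn => _; rewrite ?mul1e ?mul0e.
Qed.

Let integral_density_nnsfun (f : {nnsfun T >-> R}) :
  (\int[nu]_x (f x)%:E = \int[mu]_x ((f x)%:E * (g x)%:E))%E.
Proof.
under [LHS]eq_integral do rewrite fimfunE -fsumEFin//.
rewrite [LHS]ge0_integral_fsum//; last 2 first.
  - by move=> r; exact/measurable_EFinP/measurableT_comp.
  - by move=> n x _; rewrite EFinM nnfun_muleindic_ge0.
under [RHS]eq_integral.
  move=> x xD; rewrite fimfunE -fsumEFin// ge0_mule_fsuml; last first.
    by move=> r; rewrite EFinM nnfun_muleindic_ge0.
  over.
rewrite [RHS]ge0_integral_fsum//; last 2 first.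
  - move=> r; apply: emeasurable_funM => //.
    by apply/measurable_EFinP; apply/measurableT_comp.
  - move=> n x _; apply: mule_ge0; last by rewrite lee_fin.
    by rewrite EFinM nnfun_muleindic_ge0.
apply: eq_fsbigr => r rf.
have [/= r0|r0] := leP 0 r; last first.
  have fr : f @^-1` [set r] = set0.
    apply/seteqP; split => // x /= fxr; have : 0 <= f x by [].
    by rewrite fxr leNgt r0.
  by rewrite fr !integral0_eq// => x _; rewrite indic0 mulr0 ?mul0e.
under eq_integral do rewrite EFinM.
rewrite ge0_integralZl//; last first.
  exact/measurable_EFinP/measurable_indic.
rewrite integral_density_indic// -ge0_integralZl//.
- by apply: eq_integral => x _; rewrite EFinM muleA.
- apply: emeasurable_funM => //; exact/measurable_EFinP/measurable_indic.
- by move=> x _; rewrite mule_ge0// lee_fin.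
Qed.

Lemma ge0_integral_density (f : T -> \bar R) :
  measurable_fun setT f -> (forall x, 0 <= f x)%E ->
  (\int[nu]_x f x = \int[mu]_x (f x * (g x)%:E))%E.
Proof.
move=> mf f0.
pose f_ := nnsfun_approx measurableT mf.
have cvf x : (f_ n x)%:E @[n --> \oo] --> f x by exact: cvg_nnsfun_approx.
transitivity (lim (\int[nu]_x (f_ n x)%:E @[n --> \oo])%E).
  rewrite -monotone_convergence//=.
  - by apply: eq_integral => x _; apply/esym/cvg_lim => //; exact: cvf.
  - by move=> n; exact/measurable_EFinP/measurable_funTS.
  - by move=> n ? _; rewrite lee_fin.
  - by move=> ? _ ? ? mn; rewrite lee_fin; exact/lefP/nd_nnsfun_approx.
under eq_fun do rewrite integral_density_nnsfun.
rewrite -monotone_convergence//=.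
- apply: eq_integral => x _; apply/cvg_lim => //.
  by apply: cvgeZr => //; exact: cvf.
- move=> n; apply: emeasurable_funM => //.
  exact/measurable_EFinP/measurable_funTS.
- by move=> n ? _; rewrite mule_ge0 ?lee_fin.
- move=> x _ a b ab; rewrite lee_wpmul2r// ?lee_fin//.
  exact/lefP/nd_nnsfun_approx.
Qed.

End density.

Section lebesgue_affine.
Context {R : realType}.
Notation leb := (@lebesgue_measure R).

Lemma measurable_affine (a b : R) : measurable_fun setT (fun x : R => a * x + b).
Proof. by apply: measurable_funD => //; exact: measurable_funM. Qed.

(** Positive slopes come first because a decreasing map would turn []c, e]] into an interval closed
    at the other end; negative slopes then follow by reflection. *)
Let lebesgue_affine_gt0 (a b : R) (A : set R) : 0 < a -> measurable A ->
  (a%:E * leb ((fun x : R => (a * x + b)%R) @^-1` A) = leb A)%E.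
Proof.
move=> a0 mA.
have mf : measurable_fun setT
    ((fun x : R => a * x + b) : measurableTypeR R -> measurableTypeR R).
  exact: measurable_affine.
pose k := NngNum (ltW a0).
pose m : {measure set (measurableTypeR R) -> \bar R} :=
  mscale k (measure_function_pushforward__canonical__measure_function_Measure
    (@lebesgue_measure R) mf).
rewrite -[LHS]/(m A); apply/esym/lebesgue_measure_unique => //.
move=> _ [[c e] _ <-].
rewrite -[RHS]/(a%:E * leb ((fun x : R => (a * x + b)%R) @^-1` `]c, e]))%E; apply/esym.
rewrite (_ : _ @^-1` _ = `]((c - b) / a), ((e - b) / a)]%classic); last first.
  apply/seteqP; split => x /=; rewrite !in_itv/= ltr_pdivrMr// ler_pdivlMr//;
  by rewrite ltrBlDr lerBrDr mulrC.
rewrite !lebesgue_measure_itv/= !lte_fin ltr_pM2r ?invr_gt0// ltrD2r.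
case: ifPn => _; last by rewrite mule0.
rewrite -!EFinD -EFinM -mulrBl mulrCA mulfV ?gt_eqF// mulr1.
by congr (_%:E); ring.
Qed.

Lemma lebesgue_measure_affine (a b : R) (A : set R) : a != 0 -> measurable A ->
  (`|a|%:E * leb ((fun x : R => (a * x + b)%R) @^-1` A) = leb A)%E.
Proof.
move=> an0 mA; have [a0|a0] := ltP 0 a.
  by rewrite gtr0_norm// lebesgue_affine_gt0.
have {a0}a0 : 0 < - a by rewrite oppr_gt0 lt_neqAle an0.
rewrite -normrN gtr0_norm// -[RHS](@lebesgue_affine_gt0 (- a) b A)//.
congr (_ * _)%E.
rewrite -[RHS]lebesgue_measureN; last first.
  rewrite -[X in measurable X]setTI; exact: (measurable_affine (- a) b).
by rewrite /pushforward; congr (leb _); apply/seteqP; split => x /=; rewrite mulrNN.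
Qed.

Lemma ge0_integral_affine (a b : R) (f : R -> \bar R) : a != 0 ->
  measurable_fun setT f -> (forall x, 0 <= f x)%E ->
  (`|a|%:E * \int[leb]_x f (a * x + b)%R = \int[leb]_x f x)%E.
Proof.
move=> an0 mf f0.
have mF : measurable_fun setT
    ((fun x : R => a * x + b) : measurableTypeR R -> measurableTypeR R).
  exact: measurable_affine.
have a0 : 0 <= `|a| by [].
pose k := NngNum a0.
pose m : {measure set (measurableTypeR R) -> \bar R} :=
  mscale k (measure_function_pushforward__canonical__measure_function_Measure
    (@lebesgue_measure R) mF).
transitivity (\int[m]_x f x)%E.
  rewrite ge0_integral_mscale//=; congr (_ * _)%E.
  by rewrite (ge0_integral_pushforward mF).
apply: eq_measure_integral => A mA _.
exact: lebesgue_measure_affine.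
Qed.

End lebesgue_affine.

Lemma mule_EFin_inj {R : realFieldType} (k : R) (x y : \bar R) :
  k != 0 -> (k%:E * x = k%:E * y)%E -> x = y.
Proof.
move=> k0 /(congr1 (fun z => (k^-1%:E * z)%E)).
by rewrite !muleA -EFinM mulVf// !mul1e.
Qed.

Section gauss.
Context {R : realType}.
Notation leb := (@lebesgue_measure R).

(* [normal_prob] lives on the sigma-algebra generated by the half-open
   intervals, whose display differs from that of [R]. *)
Definition gauss (A : set R) : \bar R := normal_prob 0 1 A.

Let gauss0 : gauss set0 = 0%E.
Proof. exact: (measure0 (normal_prob (0 : R) 1)). Qed.
Let gauss_ge0 A : (0 <= gauss A)%E.
Proof. exact: (measure_ge0 (normal_prob (0 : R) 1)). Qed.
Let gauss_sigma_additive : semi_sigma_additive gauss.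
Proof. exact: (@measure_semi_sigma_additive _ _ _ (normal_prob (0 : R) 1)). Qed.

HB.instance Definition _ := isMeasure.Build _ R R gauss
  gauss0 gauss_ge0 gauss_sigma_additive.

Let gaussT : gauss setT = 1%E.
Proof. exact: (@probability_setT _ _ _ (normal_prob (0 : R) 1)). Qed.

HB.instance Definition _ := Measure_isProbability.Build _ R R gauss gaussT.

Definition phi (x : R) : R := normal_pdf 0 1 x.

Lemma phiE x : phi x = normal_peak 1 * expR (- (x ^+ 2 / 2)).
Proof.
rewrite /phi normal_pdfE ?oner_neq0// /normal_fun subr0 expr1n mulNr.
by rewrite mulr2n.
Qed.

Lemma phi_ge0 x : 0 <= phi x. Proof. exact: normal_pdf_ge0. Qed.
Lemma measurable_phi : measurable_fun setT phi.
Proof. exact: measurable_normal_pdf. Qed.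

Lemma ge0_integral_gauss (f : R -> \bar R) :
  measurable_fun setT f -> (forall x, 0 <= f x)%E ->
  (\int[gauss]_x f x = \int[leb]_x (f x * (phi x)%:E))%E.
Proof.
move=> mf f0.
transitivity (\int[normal_prob (0 : R) 1]_x f x)%E.
  have mid : measurable_fun setT (idfun : measurableTypeR R -> R).
    by move=> _ Y mY; rewrite setTI.
  pose m := measure_function_pushforward__canonical__measure_function_Measure
    (normal_prob (0 : R) 1) mid.
  transitivity (\int[m]_x f x)%E; first exact: eq_measure_integral.
  by rewrite (ge0_integral_pushforward mid).
exact: (@ge0_integral_density R _ _ leb (normal_prob 0 1) phi measurable_phi phi_ge0).
Qed.

Lemma integral_phi : (\int[leb]_x (phi x)%:E = 1)%E.
Proof. exact: integral_normal_pdf. Qed.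

Lemma phi_rotation (a b u w : R) : a ^+ 2 + b ^+ 2 = 1 ->
  phi (a * u + b * w) * phi (b * u - a * w) = phi u * phi w.
Proof.
move=> ab; rewrite 4!phiE.
move: (normal_peak 1) => k.
rewrite mulrACA.
rewrite [RHS]mulrACA.
congr (_ * _).
rewrite -[LHS]expRD.
rewrite -[RHS]expRD.
congr expR.
transitivity (- ((a ^+ 2 + b ^+ 2) * (u ^+ 2 + w ^+ 2) / 2)); first by field.
by rewrite ab; field.
Qed.

Lemma measurable_lin2 (a b : R) :
  measurable_fun setT (fun z : R * R => a * z.1 + b * z.2).
Proof.
by apply: measurable_funD; apply: measurable_funM => //.
Qed.

(** The orthogonal map used is a reflection, hence its own inverse. The planar change of variables
    is split into two affine changes on the line, each contributing a factor [|a|]; this is where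
    [a != 0] enters. *)
Lemma gauss_rotation (a b : R) (f : R * R -> \bar R) : a != 0 ->
  a ^+ 2 + b ^+ 2 = 1 -> measurable_fun setT f -> (forall z, 0 <= f z)%E ->
  (\int[(gauss \x gauss)%E]_z f (a * z.1 + b * z.2, b * z.1 - a * z.2)%R =
   \int[(gauss \x gauss)%E]_z f z)%E.
Proof.
move=> an0 ab mf f0.
have mrot : measurable_fun setT
    (fun z : R * R => (a * z.1 + b * z.2, b * z.1 - a * z.2)).
  apply: measurable_fun_pair; first exact: measurable_lin2.
  by under eq_fun do rewrite -mulNr; exact: measurable_lin2.
have mfrot := measurableT_comp mf mrot.
rewrite fubini_tonelli2; [|exact: mfrot|by move=> z; exact: f0].
rewrite fubini_tonelli1; [|exact: mf|by []].
rewrite /fubini_F /fubini_G /=.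
(* The integrand in mixed coordinates: [z.1] is the first coordinate after the map and [z.2] the
   second one before it. Both sides of the claim reduce to the Lebesgue integral of [K]. *)
pose K (z : R * R) : \bar R :=
  (f (z.1, (b * z.1 - z.2) / a)%R * (phi ((z.1 - b * z.2) / a) * phi z.2)%:E)%E.
have mb : measurable_fun setT (fun z : R * R => (b * z.1 - z.2) / a).
  under eq_fun do rewrite -[X in _ - X]mul1r -mulNr.
  by apply: measurable_funM => //; exact: measurable_lin2.
have mb' : measurable_fun setT (fun z : R * R => (z.1 - b * z.2) / a).
  under eq_fun do rewrite -[X in X - _]mul1r -mulNr.
  by apply: measurable_funM => //; exact: measurable_lin2.
have mK : measurable_fun setT K.
  apply: emeasurable_funM.
    apply: measurableT_comp mf _.
    by apply: measurable_fun_pair => //; exact: measurable_fst.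
  apply/measurable_EFinP; apply: measurable_funM.
    exact: (measurableT_comp measurable_phi mb').
  exact: (measurableT_comp measurable_phi measurable_snd).
have K0 z : (0 <= K z)%E by rewrite mule_ge0// lee_fin mulr_ge0 ?phi_ge0.
have mK1 t : measurable_fun setT (fun u => K (u, t)).
  by apply: measurableT_comp mK _; exact: measurable_fun_pair.
have mK2 u : measurable_fun setT (fun t => K (u, t)).
  by apply: measurableT_comp mK _; exact: measurable_fun_pair.
have phi2 u w := phi_rotation u w ab.
have mphi' : measurable_fun setT (fun x : R => (phi x)%:E).
  by apply/measurable_EFinP; exact: measurable_phi.
have mfu t : measurable_fun setT (fun u : R => f (a * u + b * t, b * u - a * t)).
  exact: (measurableT_comp mfrot (pair2_measurable t)).
have mft u : measurable_fun setT (fun t : R => f (u, t)).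
  exact: (measurableT_comp mf (pair1_measurable u)).
have E1 t : (`|a|%:E * (\int[gauss]_u f (a * u + b * t, b * u - a * t)%R * (phi t)%:E)
    = \int[leb]_u K (u, t))%E.
  rewrite ge0_integral_gauss//.
  rewrite -ge0_integralZr//; last 3 first.
  - exact: (emeasurable_funM (mfu t) mphi').
  - by move=> u _; rewrite mule_ge0// lee_fin phi_ge0.
  - by rewrite lee_fin phi_ge0.
  rewrite -(@ge0_integral_affine _ a (b * t) (fun u => K (u, t)))//.
  congr (_ * _)%E; apply: eq_integral => u _.
  rewrite /K /= -muleA -EFinM; congr (f (_, _) * (phi _ * _)%:E)%E.
    have -> : b * (a * u + b * t) - t = b * (a * u + b * t) - (a ^+ 2 + b ^+ 2) * t.
      by rewrite ab mul1r.
    by field.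
  by field.
have E2 u : (`|a|%:E * ((\int[gauss]_t f (u, t)) * (phi u)%:E)
    = \int[leb]_t K (u, t))%E.
  rewrite ge0_integral_gauss//.
  rewrite -ge0_integralZr//; last 3 first.
  - exact: (emeasurable_funM (mft u) mphi').
  - by move=> t _; rewrite mule_ge0// lee_fin phi_ge0.
  - by rewrite lee_fin phi_ge0.
  rewrite -(@ge0_integral_affine _ (- a) (b * u) (fun t => K (u, t))) ?oppr_eq0//.
  rewrite normrN; congr (_ * _)%E; apply: eq_integral => t _.
  rewrite /K /= -muleA -EFinM [in LHS]mulrC -[in LHS]phi2 (_ : - a * t + b * u = b * u - a * t)//; last by ring.
  congr (f (_, _) * (phi _ * _)%:E)%E.
    by field.
  transitivity (((a ^+ 2 + b ^+ 2) * u - b * (b * u - a * t)) / a).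
    by field.
  by congr (_ / a); rewrite ab mul1r.
have mKl : measurable_fun
    [set: (measurableTypeR R * measurableTypeR R)%type] K by exact: mK.
have a0 : `|a| != 0 by rewrite normr_eq0.
suff H : (`|a|%:E * \int[gauss]_t \int[gauss]_u f (a * u + b * t, b * u - a * t)%R
    = `|a|%:E * \int[gauss]_u \int[gauss]_t f (u, t))%E.
  exact: mule_EFin_inj a0 H.
have mG1 : measurable_fun setT
    (fun t : R => \int[gauss]_u f (a * u + b * t, b * u - a * t)%R)%E.
  have := measurable_fun_fubini_tonelli_G (m1 := gauss) _ mfrot (fun z => f0 _).
  by apply: eq_measurable_fun.
have mG2 : measurable_fun setT (fun u : R => \int[gauss]_t f (u, t))%E.
  have := measurable_fun_fubini_tonelli_F (m2 := gauss) _ mf f0.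
  by apply: eq_measurable_fun.
rewrite ge0_integral_gauss; [|exact: mG1|by move=> t; exact: integral_ge0].
rewrite [in RHS]ge0_integral_gauss; [|exact: mG2|by move=> t; exact: integral_ge0].
rewrite -ge0_integralZl; [|by []|by apply: emeasurable_funM|
  by move=> t _; rewrite mule_ge0 ?integral_ge0// lee_fin phi_ge0|by rewrite lee_fin].
rewrite -[in RHS]ge0_integralZl; [|by []|by apply: emeasurable_funM|
  by move=> t _; rewrite mule_ge0 ?integral_ge0// lee_fin phi_ge0|by rewrite lee_fin].
under eq_integral do rewrite E1.
under [RHS]eq_integral do rewrite E2.
exact/esym/fubini_tonelli.
Qed.
End gauss.

Section gauss_vec.
Context {R : realType}.
Notation leb := (@lebesgue_measure R).
Notation gauss := (@gauss R).

Lemma ge0_integral_gaussN (f : R -> \bar R) :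
  measurable_fun setT f -> (forall x, 0 <= f x)%E ->
  (\int[gauss]_t f (- t)%R = \int[gauss]_t f t)%E.
Proof.
move=> mf f0.
have mphi' : measurable_fun setT (fun x : R => (phi x)%:E).
  by apply/measurable_EFinP; exact: measurable_phi.
have mfN : measurable_fun setT (fun t : R => f (- t)).
  by apply: (measurableT_comp mf); exact: measurable_funN.
rewrite (ge0_integral_gauss mfN)// (ge0_integral_gauss mf)//.
rewrite -[RHS](@ge0_integral_affine R (-1) 0)//; last 2 first.
- exact: emeasurable_funM.
- by move=> x; rewrite mule_ge0// lee_fin phi_ge0.
rewrite normrN1 mul1e; apply: eq_integral => t _.
by rewrite addr0 mulN1r !phiE sqrrN.
Qed.

Lemma gauss_stable (a b : R) (f : R -> \bar R) :
  measurable_fun setT f -> (forall x, 0 <= f x)%E ->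
  (\int[(gauss \x gauss)%E]_z f (a * z.1 + b * z.2)%R =
   \int[gauss]_t f (Num.sqrt (a ^+ 2 + b ^+ 2) * t)%R)%E.
Proof.
move=> mf f0.
have mfl c d : measurable_fun setT (fun z : R * R => f (c * z.1 + d * z.2)).
  exact: (measurableT_comp mf (measurable_lin2 c d)).
(* [gauss_rotation] excludes [a = 0]; in that case only the sign of [b] has to be absorbed. *)
have [->|an0] := eqVneq a 0.
  rewrite expr0n add0r sqrtr_sqr.
  rewrite fubini_tonelli2; [|exact: (mfl 0 b)|by []].
  transitivity (\int[gauss]_t f (b * t)%R)%E.
    apply: eq_integral => t _; rewrite /fubini_G /=.
    under eq_integral do rewrite mul0r add0r.
    by rewrite integral_prob_cst.
  have [b0|b0] := leP 0 b; first by rewrite ger0_norm.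
  rewrite ltr0_norm// -ge0_integral_gaussN//; last first.
    by apply: (measurableT_comp mf); exact: measurable_funM.
  by under eq_integral do rewrite mulrN -mulNr.
set c := Num.sqrt _.
have c2 : c ^+ 2 = a ^+ 2 + b ^+ 2 by rewrite sqr_sqrtr// addr_ge0// sqr_ge0.
have cn0 : c != 0.
  rewrite -sqrf_eq0 c2 gt_eqF//.
  by rewrite ltr_pwDl ?sqr_ge0// exprn_even_gt0.
have mF : measurable_fun setT (fun z : R * R => f (c * z.1)).
  apply: (measurableT_comp mf).
  exact: (measurable_funM (measurable_cst c) measurable_fst).
have := @gauss_rotation R (a / c) (b / c) (fun z => f (c * z.1)) _ _ mF (fun=> f0 _).
rewrite mulf_neq0 ?invr_eq0// => /(_ isT).
have -> : (a / c) ^+ 2 + (b / c) ^+ 2 = 1.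
  by rewrite !expr_div_n -mulrDl -c2 divff// sqrf_eq0.
move=> /(_ erefl) /=.
under eq_integral => z _.
  have -> : c * (a / c * z.1 + b / c * z.2) = a * z.1 + b * z.2 by field.
  over.
move=> ->; rewrite fubini_tonelli1; [|exact: mF|by []].
apply: eq_integral => t _; rewrite /fubini_F /=.
by rewrite integral_prob_cst.
Qed.

Definition lin n (u : nat -> R) (v : pow R n) : R :=
  psum (fun j (_ : unit) t => u j * t) v tt.

Lemma psum_lin n (I : Type) (U : I -> nat -> R) (v : pow R n) (i : I) :
  psum (fun j i t => U i j * t) v i = lin (U i) v.
Proof.
elim: n U v => [//|n IH] U v; rewrite /lin /=.
by rewrite (IH (fun i j => U i j.+1)).
Qed.

Lemma measurable_lin n (u : nat -> R) : measurable_fun setT (@lin n u).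
Proof. by apply: measurable_psum => j _; exact: measurable_funM. Qed.

Definition gaussn n : probability (pow R n) R :=
  pprod (fun=> [the probability R R of gauss]) n.

Definition nrm n (u : nat -> R) : R := Num.sqrt (\sum_(j < n) u j ^+ 2).

Lemma gauss_lin n (u : nat -> R) (c : R) (f : R -> \bar R) :
  measurable_fun setT f -> (forall x, 0 <= f x)%E ->
  (\int[gaussn n]_v f (c + lin u v)%R = \int[gauss]_t f (c + nrm n u * t)%R)%E.
Proof.
move=> mf f0; elim: n u c => [|n IH] u c.
  rewrite /nrm big_ord0 sqrtr0 integral_dirac// diracT mul1e addr0.
  under [RHS]eq_integral do rewrite mul0r addr0.
  by rewrite integral_prob_cst.
pose u' j := u j.+1.
have mf' : measurable_fun setT
    (fun z : R * pow R n => f (c + (u 0%N * z.1 + lin u' z.2))).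
  apply: (measurableT_comp mf); apply: measurable_funD => //.
  apply: measurable_funD.
    exact: (measurable_funM (measurable_cst _) measurable_fst).
  exact: (measurableT_comp (measurable_lin u') measurable_snd).
transitivity (\int[gauss]_t \int[gaussn n]_v f (c + (u 0%N * t + lin u' v))%R)%E.
  by rewrite -[LHS]/(\int[gauss \x gaussn n]_z _)%E fubini_tonelli1.
under eq_integral do under eq_integral do rewrite addrA.
under eq_integral do rewrite IH.
have mfc : measurable_fun setT (fun x => f (c + x)).
  by apply: (measurableT_comp mf); exact: measurable_funD.
rewrite -(@fubini_tonelli1 _ _ _ _ _ gauss gauss
  (fun z : R * R => f (c + u 0%N * z.1 + nrm n u' * z.2)))//; last first.
  apply: (measurableT_comp mf); under eq_fun do rewrite -addrA.
  by apply: measurable_funD => //; exact: measurable_lin2.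
under eq_integral do rewrite -addrA.
rewrite (@gauss_stable _ _ (fun x => f (c + x)))//.
apply: eq_integral => t _; congr (f (c + _ * t)).
rewrite /nrm big_ord_recl sqr_sqrtr//.
by apply: sumr_ge0 => j _; exact: sqr_ge0.
Qed.

Lemma gauss_mgf (s : R) :
  (\int[gauss]_t (expR (s * t))%:E = (expR (s ^+ 2 / 2))%:E)%E.
Proof.
have me : measurable_fun setT (fun t : R => (expR (s * t))%:E).
  apply/measurable_EFinP; apply: (measurableT_comp (@measurable_expR R)).
  exact: measurable_funM.
rewrite ge0_integral_gauss//.
have mphi' : measurable_fun setT (fun x : R => (phi x)%:E).
  by apply/measurable_EFinP; exact: measurable_phi.
have mphiS : measurable_fun setT (fun t : R => (phi (1 * t + (- s)))%:E).
  exact: (measurableT_comp mphi' (measurable_affine 1 (- s))).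
have phi0 x : (0 <= (phi x)%:E :> \bar R)%E by rewrite lee_fin phi_ge0.
have E t : ((expR (s * t))%:E * (phi t)%:E =
    (expR (s ^+ 2 / 2))%:E * (phi (1 * t + (- s)))%:E)%E.
  rewrite -!EFinM !phiE mulrCA [in RHS]mulrCA -!expRD; congr (_ * expR _)%:E.
  by field.
under eq_integral do rewrite E.
rewrite ge0_integralZl//.
have := @ge0_integral_affine R 1 (- s) _ (oner_neq0 _) mphi' phi0.
by rewrite normr1 mul1e => ->; rewrite integral_phi mule1.
Qed.

(** The interval [[s, s + 1]] alone has mass at least [phi (s + 1)], and (s + 1)^2 / 2 <= s^2 + 1
    because (s - 1)^2 >= 0. The weaker rate s^2 in place of s^2 / 2 only affects constants later. *)
Lemma gauss_tail : exists2 c : R, 0 < c &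
  forall s, 0 <= s -> ((c * expR (- s ^+ 2))%:E <= gauss [set t : R | (s <= `|t|)%R])%E.
Proof.
exists (normal_peak (1 : R) * expR (-1)).
  by rewrite mulr_gt0 ?expR_gt0// normal_peak_gt0// oner_eq0.
move=> s s0.
pose J : set R := `[s, s + 1]%classic.
apply: (@le_trans _ _ (gauss J)); last first.
  have mS : measurable [set t : R | (s <= `|t|)%R].
    rewrite (_ : [set t | _] = Num.norm @^-1` `[s, +oo[).
      by rewrite -[X in measurable X]setTI; exact: normr_measurable.
    by apply/seteqP; split => x /=; rewrite in_itv/= andbT.
  have mJ : measurable J by exact: measurable_itv.
  apply: le_measure; [by rewrite inE|by rewrite inE|].
  move=> x; rewrite /J /= in_itv/= => /andP[sx _].
  by rewrite (le_trans sx)// ler_norm.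
rewrite -[leRHS]/(\int[leb]_(x in J) (phi x)%:E)%E.
apply: (@le_trans _ _ (\int[leb]_(x in J) (phi (s + 1))%:E)%E).
  rewrite /J integral_cst//= lebesgue_measure_itv/= lte_fin ltrDl ltr01.
  rewrite -EFinB addrAC subrr add0r mule1 lee_fin phiE -mulrA.
  rewrite ler_pM2l ?normal_peak_gt0 ?oner_eq0// -expRD ler_expR.
  have : 0 <= (s - 1) ^+ 2 by exact: sqr_ge0.
  by nra.
apply: ge0_le_integral => //; first exact: measurable_itv.
- by move=> x _; rewrite lee_fin phi_ge0.
- by apply/measurable_EFinP; apply: measurable_funTS; exact: measurable_phi.
- move=> x; rewrite /J /= in_itv/= => /andP[sx xs].
  rewrite lee_fin !phiE.
  rewrite ler_pM2l ?normal_peak_gt0 ?oner_eq0// ler_expR.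
  by nra.
Qed.

Lemma measurable_ge0_integral d d1 (D : measurableType d) (X : measurableType d1)
    (m : probability X R) (F : D -> X -> \bar R) :
  measurable_fun setT (fun w : D * X => F w.1 w.2) ->
  (forall z x, 0 <= F z x)%E ->
  measurable_fun setT (fun z => \int[m]_x F z x)%E.
Proof.
move=> mF F0.
have := measurable_fun_fubini_tonelli_F (m2 := m) _ mF (fun w => F0 w.1 w.2).
by apply: eq_measurable_fun.
Qed.

Section vector_rotation.
Context {I : Type}.
Variables (Psi : (I + I -> R) -> R).
Hypothesis mPsi : measurable_functional Psi.
Hypothesis Psi0 : forall c, 0 <= Psi c.

(** Indexing by [I + I] makes a functional of two Gaussian vectors an instance of
    [measurable_functional]. *)
Definition pairing n (U : I -> nat -> R) (g h : pow R n) (k : I + I) : R :=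
  match k with inl i => lin (U i) g | inr i => lin (U i) h end.

Definition rot_pairing n (a b : R) (U : I -> nat -> R) (g h : pow R n)
    (k : I + I) : R :=
  match k with
  | inl i => a * lin (U i) g + b * lin (U i) h
  | inr i => b * lin (U i) g - a * lin (U i) h
  end.

Lemma measurable_pairing d (D : measurableType d) n (U : I -> nat -> R)
    (g h : D -> pow R n) k : measurable_fun setT g -> measurable_fun setT h ->
  measurable_fun setT (fun w => pairing U (g w) (h w) k).
Proof.
move=> mg mh; case: k => i /=.
  exact: (measurableT_comp (measurable_lin (U i)) mg).
exact: (measurableT_comp (measurable_lin (U i)) mh).
Qed.

Lemma measurable_rot_pairing d (D : measurableType d) n (a b : R)
    (U : I -> nat -> R) (g h : D -> pow R n) k :
  measurable_fun setT g -> measurable_fun setT h ->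
  measurable_fun setT (fun w => rot_pairing a b U (g w) (h w) k).
Proof.
move=> mg mh.
have mG i := measurableT_comp (measurable_lin (U i)) mg.
have mH i := measurableT_comp (measurable_lin (U i)) mh.
case: k => i /=.
  by apply: measurable_funD; apply: measurable_funM => //; [exact: mG|exact: mH].
by apply: measurable_funB; apply: measurable_funM => //; [exact: mG|exact: mH].
Qed.

(** Brings the first coordinates of the two vectors next to each other, where the planar rotation
    can act on them. *)
Lemma gaussn_swap n (F : pow R n.+1 -> pow R n.+1 -> \bar R) :
  measurable_fun setT (fun z : pow R n.+1 * pow R n.+1 => F z.1 z.2) ->
  (forall g h, 0 <= F g h)%E ->
  (\int[gaussn n.+1]_g \int[gaussn n.+1]_h F g h =
   \int[(gauss \x gauss)%E]_z \int[gaussn n]_g \int[gaussn n]_h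
     F (z.1, g) (z.2, h))%E.
Proof.
move=> mF F0.
have mF2 g : measurable_fun setT (F g).
  exact: (measurableT_comp mF (pair1_measurable g)).
have msplit : measurable_fun setT (fun w : ((R * pow R n) * R) * pow R n =>
    F (w.1.1.1, w.1.1.2) (w.1.2, w.2)).
  have m1 : measurable_fun setT (fun w : ((R * pow R n) * R) * pow R n =>
      (((w.1.1.1, w.1.1.2), (w.1.2, w.2)) : pow R n.+1 * pow R n.+1)).
    apply: measurable_fun_pair; apply: measurable_fun_pair => //.
    - by apply: measurableT_comp => //; apply: measurableT_comp.
    - by apply: measurableT_comp => //; apply: measurableT_comp.
    - by apply: measurableT_comp.
  exact: (measurableT_comp mF m1).
have mI : measurable_fun setT (fun w : (R * pow R n) * R =>
    \int[gaussn n]_h F (w.1.1, w.1.2) (w.2, h))%E.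
  exact: (measurable_ge0_integral (F := fun w h => F (w.1.1, w.1.2) (w.2, h)) _ msplit).
have E1 (g : pow R n.+1) : (\int[gaussn n.+1]_h F g h =
    \int[gauss]_t \int[gaussn n]_h F g (t, h))%E.
  by rewrite -[LHS]/(\int[gauss \x gaussn n]_z _)%E fubini_tonelli1.
under eq_integral do rewrite E1.
have mJ : measurable_fun setT
    (fun g : R * pow R n => \int[gauss]_t \int[gaussn n]_h F g (t, h))%E.
  apply: measurable_ge0_integral; last by move=> *; exact: integral_ge0.
  by apply: eq_measurable_fun mI => -[[t g] s] _.
rewrite -[LHS]/(\int[gauss \x gaussn n]_g _)%E fubini_tonelli1//; last first.
  by move=> g; apply: integral_ge0 => t _; exact: integral_ge0.
have mz : measurable_fun setT (fun z : R * R =>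
    \int[gaussn n]_g \int[gaussn n]_h F (z.1, g) (z.2, h))%E.
  apply: measurable_ge0_integral; last by move=> *; exact: integral_ge0.
  have m1 : measurable_fun setT (fun w : (R * R) * pow R n =>
      (((w.1.1, w.2), w.1.2) : (R * pow R n) * R)).
    apply: measurable_fun_pair; first apply: measurable_fun_pair => //.
      by apply: measurableT_comp.
    by apply: measurableT_comp.
  exact: (measurableT_comp mI m1).
rewrite fubini_tonelli1//; last first.
  by move=> g; apply: integral_ge0 => t _; exact: integral_ge0.
apply: eq_integral => t _; rewrite /fubini_F /=.
apply: (@fubini_tonelli _ _ _ _ _ (gaussn n) gauss
  (fun w => \int[gaussn n]_h F (t, w.1) (w.2, h))%E).
  have m1 : measurable_fun setT (fun w : pow R n * R =>
      (((t, w.1), w.2) : (R * pow R n) * R)).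
    by apply: measurable_fun_pair => //; apply: measurable_fun_pair.
  exact: (measurableT_comp mI m1).
by move=> w; exact: integral_ge0.
Qed.

(** By induction, the tails are rotated while the first coordinates sit in the shift [c1]; those
    coordinates then enter only through their planar rotation, which [gauss_rotation] removes. *)
Lemma gauss_vec_rotation n (a b : R) (U : I -> nat -> R) (c : I + I -> R) :
  a != 0 -> a ^+ 2 + b ^+ 2 = 1 ->
  (\int[gaussn n]_g \int[gaussn n]_h
     (Psi (fun k => c k + rot_pairing a b U g h k))%:E =
   \int[gaussn n]_g \int[gaussn n]_h
     (Psi (fun k => c k + pairing U g h k))%:E)%E.
Proof.
move=> an0 ab; elim: n U c => [|n IH] U c.
  rewrite !integral_dirac// !diracT !mul1e; congr (Psi _)%:E.
  by apply/funext => -[i|i] /=; rewrite /lin /= !mulr0 ?subr0 !addr0.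
pose U' i j := U i j.+1.
pose c1 (z : R * R) (k : I + I) : R := c k +
  match k with inl i => U i 0%N * z.1 | inr i => U i 0%N * z.2 end.
have mid1 := @measurable_fst _ _ (pow R n.+1) (pow R n.+1).
have mid2 := @measurable_snd _ _ (pow R n.+1) (pow R n.+1).
rewrite !gaussn_swap; last 4 first.
- apply/measurable_EFinP; apply: mPsi => k; apply: measurable_funD => //.
  exact: (measurable_pairing _ _ mid1 mid2).
- by move=> g h; rewrite lee_fin.
- apply/measurable_EFinP; apply: mPsi => k; apply: measurable_funD => //.
  exact: (measurable_rot_pairing _ _ _ _ mid1 mid2).
- by move=> g h; rewrite lee_fin.
pose f z := (\int[gaussn n]_g \int[gaussn n]_h
     (Psi (fun k => c1 z k + pairing U' g h k))%:E)%E.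
transitivity (\int[(gauss \x gauss)%E]_z f (a * z.1 + b * z.2, b * z.1 - a * z.2)%R)%E.
  apply: eq_integral => z _; rewrite /f -IH.
  apply: eq_integral => g _; apply: eq_integral => h _; congr (Psi _)%:E.
  apply/funext => -[i|i]; rewrite /c1 /rot_pairing /lin /= -/(lin _ _).
    by rewrite -!addrA; congr (_ + _); rewrite /lin; ring.
  by rewrite -!addrA; congr (_ + _); rewrite /lin; ring.
have mf : measurable_fun setT f.
  apply: measurable_ge0_integral; last first.
    by move=> z g; apply: integral_ge0 => h _; rewrite lee_fin.
  apply: measurable_ge0_integral; last by move=> w h; rewrite lee_fin.
  apply/measurable_EFinP; apply: mPsi => k; apply: measurable_funD => /=.
    apply: measurable_funD => //; case: k => i; apply: measurable_funM => //.
      by apply: measurableT_comp => //; apply: measurableT_comp.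
    by apply: measurableT_comp => //; apply: measurableT_comp.
  apply: measurable_pairing => //.
  by apply: measurableT_comp.
have f0 z : (0 <= f z)%E.
  by apply: integral_ge0 => g _; apply: integral_ge0 => h _; rewrite lee_fin.
apply: (etrans (gauss_rotation an0 ab mf f0)).
apply: eq_integral => z _; rewrite /f.
apply: eq_integral => g _; apply: eq_integral => h _; congr (Psi _)%:E.
by apply/funext => -[i|i]; rewrite /c1 /lin /= addrA.
Qed.
End vector_rotation.

End gauss_vec.

(** * Concentration of Gaussian maxima *)

Section vmax.
Context {R : realType} {I : finType}.
Variable i0 : I.
Implicit Types c : I -> R.

(** Starting from [c i0] instead of a fixed number keeps the maximum an attained value of the
    family. *)
Definition vmax c : R := \big[Num.max/c i0]_i c i.

Lemma le_vmax c i : c i <= vmax c.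
Proof. exact: le_bigmax. Qed.

Lemma vmax_attained c : exists i, vmax c = c i.
Proof.
rewrite /vmax; elim/big_ind: _ => [|x y [i ->] [j ->]|i _]; first by exists i0.
  by case: (leP (c i) (c j)) => _; [exists j|exists i].
by exists i.
Qed.

Lemma vmax_le c x : (forall i, c i <= x) -> vmax c <= x.
Proof. by move=> H; have [i ->] := vmax_attained c. Qed.

Lemma measurable_vmax : measurable_functional vmax.
Proof.
move=> d D Z mZ; rewrite /vmax.
elim: (index_enum I) => [|i s IH].
  by under eq_fun do rewrite big_nil; exact: (mZ i0).
by under eq_fun do rewrite big_cons; exact: measurable_maxr.
Qed.

Lemma measurable_expR_vmax (s : R) : measurable_functional (fun c => expR (s * vmax c)).
Proof.
move=> d D Z mZ; apply: (measurableT_comp (@measurable_expR R)).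
by apply: measurable_funM => //; exact: measurable_vmax.
Qed.

End vmax.

Section gauss_sum.
Context {R : realType} {I : Type}.
Variables (Psi : (I -> R) -> R).
Hypothesis mPsi : measurable_functional Psi.
Hypothesis Psi0 : forall c, 0 <= Psi c.

(** Rotation invariance with the unit vector (a / k, b / k), applied to a functional that reads only
    the left components; the second vector then integrates out. *)
Lemma gauss_sum2 n (a b : R) (U : I -> nat -> R) (c : I -> R) : 0 < a -> 0 <= b ->
  (\int[gaussn n]_g \int[gaussn n]_h
     (Psi (fun i => c i + a * lin (U i) g + b * lin (U i) h))%:E =
   \int[gaussn n]_g (Psi (fun i => c i + Num.sqrt (a ^+ 2 + b ^+ 2) * lin (U i) g))%:E)%E.
Proof.
move=> a0 b0; set k := Num.sqrt _.
have k2 : k ^+ 2 = a ^+ 2 + b ^+ 2 by rewrite sqr_sqrtr// addr_ge0// sqr_ge0.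
have kn0 : k != 0.
  by rewrite -sqrf_eq0 k2 gt_eqF// ltr_pwDl ?sqr_ge0// exprn_gt0.
pose Psi2 (e : I + I -> R) := Psi (fun i => c i + k * e (inl i)).
have mPsi2 : measurable_functional Psi2.
  move=> d D Z mZ; apply: mPsi => i; apply: measurable_funD => //.
  exact: measurable_funM.
have ak0 : a / k != 0 by rewrite mulf_eq0 invr_eq0 negb_or kn0 (gt_eqF a0).
have abk : (a / k) ^+ 2 + (b / k) ^+ 2 = 1.
  by rewrite !expr_div_n -mulrDl -k2 divff// sqrf_eq0.
have H := @gauss_vec_rotation R I Psi2 mPsi2 (fun=> Psi0 _) n (a / k) (b / k) U
  (fun=> 0) ak0 abk.
rewrite /Psi2 /= in H.
transitivity (\int[gaussn n]_g \int[gaussn n]_h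
   (Psi (fun i => c i + k * (0 + (a / k * lin (U i) g + b / k * lin (U i) h))))%:E)%E.
  apply: eq_integral => g _; apply: eq_integral => h _; congr (Psi _)%:E.
  by apply/funext => i; field.
rewrite H; apply: eq_integral => g _.
by under eq_integral do under eq_fun do rewrite add0r; rewrite integral_prob_cst.
Qed.

Lemma gauss_msum n m (k : R) (U : I -> nat -> R) (c : I -> R) : 0 < k ->
  (\int[pprod (fun=> gaussn n) m]_v
     (Psi (fun i => c i + psum (fun _ i g => k * lin (U i) g) v i))%:E =
   \int[gaussn n]_g
     (Psi (fun i => c i + k * Num.sqrt m%:R * lin (U i) g))%:E)%E.
Proof.
move=> k0; elim: m c => [|m IH] c.
  rewrite integral_dirac// diracT mul1e sqrtr0.
  under [RHS]eq_integral do under eq_fun do rewrite mulr0 mul0r.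
  by rewrite integral_prob_cst.
rewrite -[LHS]/(\int[gaussn n \x pprod (fun=> gaussn n) m]_v _)%E.
have mF : measurable_fun setT (fun v : pow R n * pow (pow R n) m => (Psi (fun i =>
    c i + psum (fun _ i g => k * lin (U i) g) (v : pow (pow R n) m.+1) i))%:E).
  apply/measurable_EFinP; apply: mPsi => i; apply: measurable_funD => //.
  apply: (@measurable_psum _ _ _ _ (fun _ i g => k * lin (U i) g) m.+1 i) => j.
  by apply: measurable_funM => //; exact: measurable_lin.
rewrite fubini_tonelli1; [|exact: mF|by move=> v; rewrite lee_fin].
rewrite /fubini_F /=.
under eq_integral do under eq_integral do under eq_fun do rewrite addrA.
under eq_integral do rewrite IH.
rewrite gauss_sum2//; last by rewrite mulr_ge0// ltW.
apply: eq_integral => g _; congr (Psi _)%:E; apply/funext => i; congr (_ + _ * _).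
rewrite exprMn sqr_sqrtr// -{1}(mulr1 (k ^+ 2)) -mulrDr addrC natr1.
by rewrite sqrtrM ?sqr_ge0// sqrtr_sqr gtr0_norm.
Qed.

End gauss_sum.

Lemma le_integral_half {R : realType} d (D : measurableType d)
    (mu : probability D R) (f a b : D -> \bar R) :
  measurable_fun setT f -> measurable_fun setT a -> measurable_fun setT b ->
  (forall x, 0 <= f x)%E -> (forall x, 0 <= a x)%E -> (forall x, 0 <= b x)%E ->
  (forall x, f x <= (2^-1)%:E * a x + (2^-1)%:E * b x)%E ->
  (\int[mu]_x f x <= (2^-1)%:E * \int[mu]_x a x + (2^-1)%:E * \int[mu]_x b x)%E.
Proof.
move=> mf ma mb f0 a0 b0 H.
have h0 : (0 <= (2^-1)%:E :> \bar R)%E by rewrite lee_fin invr_ge0.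
rewrite -(ge0_integralZl _ measurableT ma (fun x _ => a0 x) h0).
rewrite -(ge0_integralZl _ measurableT mb (fun x _ => b0 x) h0).
rewrite -ge0_integralD; first last.
- exact: measurable_funeM.
- by move=> x _; rewrite mule_ge0.
- exact: measurable_funeM.
- by move=> x _; rewrite mule_ge0.
- exact: measurableT.
apply: ge0_le_integral; first exact: measurableT.
- by move=> x _.
- exact: mf.
- by apply: emeasurable_funD; exact: measurable_funeM.
- by move=> x _.
Qed.

Section concentration.
Context {R : realType} {I : finType}.
Variables (i0 : I) (n : nat) (U : I -> nat -> R) (sigma : R).
Hypothesis Usigma : forall i, nrm n (U i) <= sigma.

Notation M := (vmax i0).
Notation L g := (fun i => lin (U i) g).
Let al : R := (Num.sqrt 2)^-1.

Let al_gt0 : 0 < al. Proof. by rewrite invr_gt0 sqrtr_gt0. Qed.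
Let al2 : al * al = 2^-1.
Proof. by rewrite -expr2 exprVn sqr_sqrtr. Qed.

Let mL : forall i, measurable_fun setT (fun g : pow R n => lin (U i) g).
Proof. by move=> i; exact: measurable_lin. Qed.

(** At an index [i] maximizing [L g], the mixed maximum is at least
    [al * (lin (U i) g + e * lin (U i) h)]. So the increment is at most [- al * e * lin (U i) h], a
    centered Gaussian of variance at most sigma^2 / 2, although the maximum itself is not linear. *)
Lemma gauss_increment (s e : R) (g : pow R n) : 0 <= s -> e ^+ 2 = 1 ->
  (\int[gaussn n]_h (expR (s * (al * M (L g) -
     M (fun i => al * (lin (U i) g + e * lin (U i) h))%R)))%:E <=
   (expR (s ^+ 2 * sigma ^+ 2 / 4))%:E)%E.
Proof.
move=> s0 e2; have [i Mi] := vmax_attained i0 (L g).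
pose k := - (s * al * e).
have mk : measurable_fun setT (fun x : R => (expR (k * x))%:E).
  apply/measurable_EFinP; apply: (measurableT_comp (@measurable_expR R)).
  exact: measurable_funM.
apply: (@le_trans _ _ (\int[gaussn n]_h (expR (k * (0 + lin (U i) h)))%:E)%E).
  apply: ge0_le_integral; first exact: measurableT.
  - by move=> h _; rewrite lee_fin expR_ge0.
  - apply/measurable_EFinP; apply: (measurableT_comp (@measurable_expR R)).
    apply: measurable_funM => //; apply: measurable_funB => //.
    apply: measurable_vmax => j; apply: measurable_funM => //.
    by apply: measurable_funD => //; exact: measurable_funM.
  - have m0 : measurable_fun setT (fun h : pow R n => 0 + lin (U i) h).
      exact: measurable_funD.
    exact: (measurableT_comp mk m0).
  - move=> h _; rewrite lee_fin ler_expR add0r /k.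
    have := le_vmax i0 (fun i => al * (lin (U i) g + e * lin (U i) h)) i.
    rewrite Mi -mulrA -mulrN => H; rewrite -mulrA -mulrN.
    by apply: ler_wpM2l => //; lra.
have ek0 x : (0 <= (expR (k * x))%:E)%E by rewrite lee_fin expR_ge0.
rewrite (@gauss_lin R n (U i) 0 _ mk ek0).
under eq_integral do rewrite add0r mulrA.
rewrite gauss_mgf lee_fin ler_expR.
rewrite exprMn /k sqrrN !exprMn e2 mulr1 [al ^+ 2]expr2 al2.
have : nrm n (U i) ^+ 2 <= sigma ^+ 2.
  by rewrite ler_sqr ?nnegrE ?sqrtr_ge0// (le_trans (sqrtr_ge0 _) (Usigma i)).
by have := sqr_ge0 s; nra.
Qed.

Lemma measurable_increment (t : R) :
  measurable_functional (fun c : I + I -> R => expR (t * (al * M (fun i => c (inl i)) -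
     M (fun i => al * (c (inl i) + c (inr i)))))).
Proof.
move=> d D Z mZ; apply: (measurableT_comp (@measurable_expR R)).
apply: measurable_funM => //; apply: measurable_funB => //.
  by apply: measurable_funM => //; exact: measurable_vmax.
apply: measurable_vmax => i; apply: measurable_funM => //.
exact: measurable_funD.
Qed.

Let inc (t : R) (c : I + I -> R) : R :=
  expR (t * (al * M (fun i => c (inl i)) -
     M (fun i => al * (c (inl i) + c (inr i))))).

Let minc t : measurable_functional (inc t).
Proof. exact: measurable_increment. Qed.

Let minc2 (t : R) (c : pow R n -> pow R n -> I + I -> R) :
  (forall k, measurable_fun setT (fun z : pow R n * pow R n => c z.1 z.2 k)) ->
  measurable_fun setT (fun z : pow R n * pow R n => (inc t (c z.1 z.2))%:E).
Proof. by move=> mc; apply/measurable_EFinP; exact: (minc t mc). Qed.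

(* With [g' = (g + h) / sqrt 2] and [h' = (g - h) / sqrt 2], the difference
   [M g / 2 - M h] is the sum of the increments [(M g / sqrt 2 - M g') / sqrt 2]
   and [M g' / sqrt 2 - M h]. *)
Lemma gauss_decoupled (s : R) : 0 <= s ->
  (\int[gaussn n]_g \int[gaussn n]_h
     (expR (s * (M (L g) / 2 - M (L h))))%:E <=
   (expR (s ^+ 2 * sigma ^+ 2))%:E)%E.
Proof.
move=> s0.
pose c1 (g h : pow R n) := pairing U g h.
pose c2 (g h : pow R n) (k : I + I) := match k with
  inl i => al * (lin (U i) g + lin (U i) h)
  | inr i => - (al * (lin (U i) g - lin (U i) h)) end.
have id1 := @measurable_fst _ _ (pow R n) (pow R n).
have id2 := @measurable_snd _ _ (pow R n) (pow R n).
have mL1 i := measurableT_comp (mL i) id1.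
have mL2 i := measurableT_comp (mL i) id2.
have mc1 k : measurable_fun setT (fun z : pow R n * pow R n => c1 z.1 z.2 k).
  exact: (measurable_pairing _ _ id1 id2).
have mc2 k : measurable_fun setT (fun z : pow R n * pow R n => c2 z.1 z.2 k).
  case: k => i /=.
    by apply: measurable_funM => //; apply: measurable_funD; [exact: mL1|exact: mL2].
  apply: measurable_funN; apply: measurable_funM => //.
  by apply: measurable_funB; [exact: mL1|exact: mL2].
have inc0 t c : (0 <= (inc t c)%:E)%E by rewrite lee_fin expR_ge0.
have hinc : forall e, e ^+ 2 = 1 -> forall t, 0 <= t ->
    (\int[gaussn n]_g \int[gaussn n]_h (inc t (fun k => match k with
       inl i => lin (U i) g | inr i => (e * lin (U i) h)%R end))%:E <=
     (expR (t ^+ 2 * sigma ^+ 2 / 4))%:E)%E.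
  move=> e e2 t t0.
  apply: (@le_trans _ _ (\int[gaussn n]_g (expR (t ^+ 2 * sigma ^+ 2 / 4))%:E)%E);
    last by rewrite integral_prob_cst.
  apply: ge0_le_integral; first exact: measurableT.
  - by move=> g _; exact: integral_ge0.
  - apply: measurable_ge0_integral => //.
    apply: (@minc2 t (fun g h k => match k with inl i => lin (U i) g | inr i => e * lin (U i) h end)).
    case=> i; first exact: mL1.
    by apply: measurable_funM => //; exact: mL2.
  - exact: measurable_cst.
  - by move=> g _; exact: gauss_increment.
(* [A] and [B] are exponentials of twice the two increments; exp (x + y) <= (exp (2 x) + exp (2 y))
   / 2 separates them although they are dependent. *)
pose A (z : pow R n * pow R n) := (inc (2 * s * al) (c1 z.1 z.2))%:E.
pose B (z : pow R n * pow R n) := (inc (2 * s) (c2 z.1 z.2))%:E.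
have mA : measurable_fun setT A by exact: minc2.
have mB : measurable_fun setT B by exact: minc2.
have mA2 g : measurable_fun setT (fun h => A (g, h)).
  exact: (measurableT_comp mA (pair1_measurable g)).
have mB2 g : measurable_fun setT (fun h => B (g, h)).
  exact: (measurableT_comp mB (pair1_measurable g)).
have h0 : (0 <= (2^-1)%:E :> \bar R)%E by rewrite lee_fin.
apply: (@le_trans _ _ ((2^-1)%:E * (\int[gaussn n]_g \int[gaussn n]_h A (g, h)) +
   (2^-1)%:E * (\int[gaussn n]_g \int[gaussn n]_h B (g, h)))%E).
  have mIA : measurable_fun setT (fun g => \int[gaussn n]_h A (g, h))%E.
    exact: (@measurable_ge0_integral R _ _ _ _ (gaussn n) (fun g h => A (g, h)) mA
      (fun _ _ => inc0 _ _)).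
  have mIB : measurable_fun setT (fun g => \int[gaussn n]_h B (g, h))%E.
    exact: (@measurable_ge0_integral R _ _ _ _ (gaussn n) (fun g h => B (g, h)) mB
      (fun _ _ => inc0 _ _)).
  have mF : measurable_fun setT (fun z : pow R n * pow R n =>
      (expR (s * (M (L z.1) / 2 - M (L z.2))))%:E).
    apply/measurable_EFinP; apply: (measurableT_comp (@measurable_expR R)).
    apply: measurable_funM => //; apply: measurable_funB.
      by apply: measurable_funM => //; apply: measurable_vmax => i; exact: mL1.
    by apply: measurable_vmax => i; exact: mL2.
  have e0 x : (0 <= (expR x)%:E :> \bar R)%E by rewrite lee_fin expR_ge0.
  apply: le_integral_half.
  - exact: (@measurable_ge0_integral R _ _ _ _ (gaussn n)
      (fun g h => (expR (s * (M (L g) / 2 - M (L h))))%:E) mF (fun _ _ => e0 _)).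
  - exact: mIA.
  - exact: mIB.
  - by move=> g; apply: integral_ge0 => h _; exact: e0.
  - by move=> g; apply: integral_ge0 => h _; exact: inc0.
  - by move=> g; apply: integral_ge0 => h _; exact: inc0.
  move=> g; apply: le_integral_half.
  - exact: (measurableT_comp mF (pair1_measurable g)).
  - exact: mA2.
  - exact: mB2.
  - by move=> h; exact: e0.
  - by move=> h; exact: inc0.
  - by move=> h; exact: inc0.
  move=> h; rewrite /A /B /inc -!EFinM -EFinD lee_fin /=.
  set x := M (L g). set y := M (fun i => al * (lin (U i) g + lin (U i) h)).
  have -> : M (fun i => al * (al * (lin (U i) g + lin (U i) h) +
      - (al * (lin (U i) g - lin (U i) h)))) = M (L h).
    congr vmax; apply/funext => i.
    transitivity (al * al * 2 * lin (U i) h); first by ring.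
    by rewrite al2 mulVf// mul1r.
  set z := M (L h).
  have -> : s * (x / 2 - z) = s * al * (al * x - y) + s * (al * y - z).
    transitivity (s * (x * (al * al) - z)); first by rewrite al2.
    by ring.
  have -> : 2 * s * al * (al * x - y) = s * al * (al * x - y) + s * al * (al * x - y) by ring.
  have -> : 2 * s * (al * y - z) = s * (al * y - z) + s * (al * y - z) by ring.
  rewrite !expRD; set a := expR _; set b := expR _.
  by have := sqr_ge0 (a - b); nra.
have HA : (\int[gaussn n]_g \int[gaussn n]_h A (g, h) <=
    (expR (s ^+ 2 * sigma ^+ 2))%:E)%E.
  have := hinc 1 (expr1n _ _) (2 * s * al).
  have sal : 0 <= 2 * s * al by rewrite !mulr_ge0// ltW.
  move=> /(_ sal) H; apply: le_trans.
    apply: le_trans H; rewrite le_eqVlt; apply/orP; left; apply/eqP.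
    apply: eq_integral => g _; apply: eq_integral => h _; rewrite /A /inc /c1 /=.
    congr (expR (_ * (_ - M _)))%:E.
    by apply/funext => i; rewrite mul1r.
  rewrite lee_fin ler_expR.
  have -> : (2 * s * al) ^+ 2 = 2 * s ^+ 2.
    transitivity (4 * s ^+ 2 * (al * al)); first by ring.
    by rewrite al2; field.
  by have := mulr_ge0 (sqr_ge0 s) (sqr_ge0 sigma); lra.
have HB : (\int[gaussn n]_g \int[gaussn n]_h B (g, h) <=
    (expR (s ^+ 2 * sigma ^+ 2))%:E)%E.
  (* The second increment is the first one taken at the rotated pair with [e = -1], so rotation
     invariance reduces it to [hinc]. *)
  have al1 : al ^+ 2 + al ^+ 2 = 1 by rewrite expr2 al2; field.
  have eN : (-1 : R) ^+ 2 = 1 by rewrite sqrrN expr1n.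
  have s2 : 0 <= 2 * s by rewrite mulr_ge0.
  pose Psi (c : I + I -> R) := inc (2 * s) (fun k => match k with
    inl i => c (inl i) | inr i => -1 * c (inr i) end).
  have mPsi : measurable_functional Psi.
    move=> d D Z mZ; apply: (minc _ (Z := fun k w => match k with
      inl i => Z (inl i) w | inr i => -1 * Z (inr i) w end)).
    by case=> i //; exact: measurable_funM.
  have Psi0 c : 0 <= Psi c by exact: expR_ge0.
  have aln0 : al != 0 by rewrite gt_eqF.
  have R1 := @gauss_vec_rotation R I Psi mPsi Psi0 n al al U (fun=> 0) aln0 al1.
  have H := hinc _ eN _ s2.
  apply: (@le_trans _ _ (expR ((2 * s) ^+ 2 * sigma ^+ 2 / 4))%:E).
    apply: le_trans H; rewrite le_eqVlt; apply/orP; left; apply/eqP.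
    transitivity (\int[gaussn n]_g \int[gaussn n]_h
        (Psi (fun k => 0 + pairing U g h k))%:E)%E; last first.
      apply: eq_integral => g _; apply: eq_integral => h _; rewrite /Psi.
      by congr (inc _ _)%:E; apply/funext => -[i|i] /=; rewrite add0r.
    apply: etrans R1.
    apply: eq_integral => g _; apply: eq_integral => h _; rewrite /Psi /B.
    by congr (inc _ _)%:E; apply/funext => -[i|i] /=; ring.
  by rewrite lee_fin ler_expR; lra.
apply: le_trans (leeD (lee_wpmul2l h0 HA) (lee_wpmul2l h0 HB)) _.
by rewrite -!EFinM -EFinD lee_fin; lra.
Qed.

Hypothesis U0 : forall j, U i0 j = 0.

(** The zero form belongs to the family. Hence [M] is nonnegative, and its mean can be handled
    without an integrability hypothesis. *)
Let M0 (g : pow R n) : 0 <= M (L g).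
Proof.
suff <- : lin (U i0) g = 0 by exact: (le_vmax i0 (L g) i0).
rewrite (_ : U i0 = fun=> 0); last exact/funext.
elim: n g => [//|k IH] g; rewrite /lin /= mul0r add0r.
exact: IH.
Qed.

(* Integrating [gauss_decoupled] in [h] costs the factor [E exp (- s M h)], which
   is at least [exp (- s w)] by Jensen's inequality. *)
Lemma gauss_sup_mgf (s w : R) : 0 <= s ->
  (\int[gaussn n]_g (M (L g))%:E <= w%:E)%E ->
  (\int[gaussn n]_g (expR (s * (M (L g) / 2)))%:E <=
   (expR (s * w + s ^+ 2 * sigma ^+ 2))%:E)%E.
Proof.
move=> s0 Mw.
have mM : measurable_fun setT (fun g : pow R n => M (L g)) by exact: measurable_vmax.
have mE t : measurable_fun setT (fun g : pow R n => (expR (t * M (L g)))%:E).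
  apply/measurable_EFinP; apply: (measurableT_comp (@measurable_expR R)).
  exact: measurable_funM.
have e0 x : (0 <= (expR x)%:E :> \bar R)%E by rewrite lee_fin expR_ge0.
set k := expR (- (s * w)).
have Jensen : (k%:E <= \int[gaussn n]_h (expR (- s * M (L h)))%:E)%E.
  have ks0 : (0 <= (k * s)%:E :> \bar R)%E by rewrite lee_fin mulr_ge0// expR_ge0.
  have mM' : measurable_fun setT (fun h : pow R n => (M (L h))%:E) by exact/measurable_EFinP.
  have M0' (h : pow R n) : setT h -> (0 <= (M (L h))%:E :> \bar R)%E by move=> _; rewrite lee_fin.
  (* The tangent line of exp (- s x) at [w], integrated. The linear term is moved across the
     inequality so that both integrands are nonnegative. *)
  have H : ((k * (1 + s * w))%:E <=
      \int[gaussn n]_h ((expR (- s * M (L h)))%:E + (k * s)%:E * (M (L h))%:E))%E.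
    rewrite -[leLHS](integral_prob_cst (gaussn n)).
    apply: ge0_le_integral; first exact: measurableT.
    - move=> h _; rewrite lee_fin mulr_ge0 ?expR_ge0//.
      have : (0 <= w%:E)%E by apply: le_trans Mw; apply: integral_ge0 => h' _; exact: M0'.
      by rewrite lee_fin => w0; rewrite addr_ge0// mulr_ge0.
    - exact: measurable_cst.
    - by apply: emeasurable_funD; [exact: mE|exact: measurable_funeM].
    - move=> h _; rewrite -EFinM -EFinD lee_fin.
      have -> : expR (- s * M (L h)) = k * expR (s * w - s * M (L h)).
        by rewrite /k -expRD; congr expR; ring.
      have := expR_ge1Dx (s * w - s * M (L h)).
      rewrite -[k * s * _]mulrA -mulrDr ler_pM2l ?expR_gt0//.
      by lra.
  rewrite ge0_integralD in H; first last.
  - exact: measurable_funeM.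
  - by move=> h _; rewrite mule_ge0// M0'.
  - exact: mE.
  - by move=> h _; exact: e0.
  - exact: measurableT.
  rewrite (ge0_integralZl _ measurableT mM' M0' ks0) in H.
  have := le_trans H (leeD2l _ (lee_wpmul2l ks0 Mw)).
  rewrite -EFinM -leeBlDr// -EFinB; congr (_%:E <= _)%E.
  by ring.
have := gauss_decoupled s0.
under eq_integral => g _.
  under eq_integral.
    move=> h _; rewrite mulrBr expRD EFinM -mulNr.
    over.
  rewrite (ge0_integralZl _ measurableT (mE (- s)) (fun _ _ => e0 _) (e0 _)).
  over.
move=> H.
have mH : measurable_fun setT (fun g : pow R n => (expR (s * (M (L g) / 2)))%:E).
  by under eq_fun do rewrite mulrCA mulrC; exact: mE.
rewrite (ge0_integralZr _ measurableT mH (fun _ _ => e0 _)) in H; last first.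
  by apply: integral_ge0 => h _; exact: e0.
have I0 : (0 <= \int[gaussn n]_g (expR (s * (M (L g) / 2)))%:E)%E.
  by apply: integral_ge0 => g _; exact: e0.
have := le_trans (lee_wpmul2l I0 Jensen) H.
move=> /(lee_wpmul2l (e0 (s * w))).
rewrite muleCA -EFinM /k -expRD subrr expR0 mule1 -EFinM -expRD.
by [].
Qed.

End concentration.

(** * Gaussian domination of symmetric sub-gaussian variables *)

Lemma expR_nneseries (R : realType) (x : R) : 0 <= x ->
  ((expR x)%:E = \sum_(k <oo) (x ^+ k / k`!%:R)%:E)%E.
Proof.
move=> x0; rewrite /expR -EFin_lim; last exact: is_cvg_series_exp_coeff.
apply: congr_lim; apply/funext => n /=.
rewrite -sumEFin; apply: eq_bigr => k _.
by rewrite exp_coeffE mulrC.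
Qed.

Lemma expR_ge_exprn_fact (R : realType) (x : R) (k : nat) : 0 <= x ->
  x ^+ k / k`!%:R <= expR x.
Proof.
case: k => [|k] x0; first by rewrite expr0 fact0 invr1 mulr1 -expR0 ler_expR.
by apply: le_trans (expR_ge1Dxn k x0); rewrite lerDr.
Qed.

Section subgaussian.
Context {R : realType}.
Variables (mu : probability R R) (kappa : R).
Hypothesis symmu : forall B : set R, measurable B -> mu [set - t | t in B] = mu B.
Hypothesis varmu : (\int[mu]_t (t ^+ 2)%:E = 1%:E)%E.
Hypothesis subgmu : subg_norm mu = kappa%:E.

Lemma subg_norm_bound (q : R) : 1 <= q ->
  ((q `^ (- (1 / 2)))%:E * poweR (\int[mu]_x (`|x| `^ q)%:E) (1 / q) <= kappa%:E)%E.
Proof. by move=> q1; rewrite -subgmu; apply: ereal_sup_ubound; exists q. Qed.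

Lemma subg_norm_ge0 : 0 <= kappa.
Proof.
rewrite -lee_fin; apply: le_trans (subg_norm_bound (lexx 1)).
by rewrite mule_ge0 ?lee_fin ?powR_ge0// poweR_ge0.
Qed.

Lemma subg_even_moment (k : nat) : (0 < k)%N ->
  (\int[mu]_x (x ^+ k.*2)%:E <= (kappa ^+ k.*2 * k.*2%:R ^+ k)%:E)%E.
Proof.
move=> k0; set q : R := k.*2%:R.
have q1 : 1 <= q by rewrite ler1n double_gt0.
have q0 : 0 < q by exact: lt_le_trans q1.
have := subg_norm_bound q1.
under eq_integral => x _ do rewrite powR_mulrn// -normrX ger0_norm ?exprn_even_ge0 ?odd_double//.
set J := (\int[mu]_x _)%E => H.
have J0 : (0 <= J)%E.
  by apply: integral_ge0 => x _; rewrite lee_fin exprn_even_ge0 ?odd_double.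
have H2 : (poweR J (1 / q) <= (kappa * q `^ (1 / 2))%:E)%E.
  have qp : (0 <= (q `^ (1 / 2))%:E :> \bar R)%E by rewrite lee_fin powR_ge0.
  have := lee_wpmul2l qp H.
  rewrite muleA -EFinM -powRD; last by rewrite (gt_eqF q0) implybT.
  by rewrite subrr powRr0 mul1e -EFinM (mulrC _ kappa).
have Jp0 : (0 <= poweR J (1 / q))%E by exact: poweR_ge0.
have kq0 : 0 <= kappa * q `^ (1 / 2) by rewrite mulr_ge0 ?powR_ge0// subg_norm_ge0.
have H3 : (J <= (poweR (kappa * q `^ (1 / 2))%:E q))%E.
  have Jq : J = poweR (poweR J (1 / q)) q.
    by rewrite -poweRrM div1r mulVf ?(lt0r_neq0 q0)// poweRe1.
  have Jin : poweR J (1 / q) \in `[0%E, +oo%E] by rewrite in_itv/= leey Jp0.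
  have kin : (kappa * q `^ (1 / 2))%:E \in `[0%E, +oo%E].
    by rewrite in_itv/= leey lee_fin kq0.
  have := gt0_ler_poweR (ltW q0) Jin kin H2.
  by rewrite -[X in (X <= _)%E]Jq.
apply: le_trans H3 _.
rewrite poweR_EFin powR_mulrn// exprMn lee_fin.
rewrite -[X in _ * X <= _]powR_mulrn ?powR_ge0// -powRrM.
have -> : 1 / 2 * k.*2%:R = k%:R :> R by rewrite -muln2 natrM; field.
by rewrite powR_mulrn //; exact: ltW.
Qed.

(** The case q = 2 of the sub-gaussian norm. This lower bound on [kappa] lets absolute constants,
    such as the Gaussian fourth moment, be absorbed into multiples of [kappa ^+ 4]. *)
Lemma subg_norm_sqr_ge : 1 <= 2 * kappa ^+ 2.
Proof.
have := @subg_even_moment 1 isT.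
by rewrite varmu expr1 lee_fin mulrC.
Qed.

Lemma subg_norm_gt0 : 0 < kappa.
Proof.
rewrite lt_neqAle subg_norm_ge0 andbT eq_sym.
apply/eqP => k0; have := subg_norm_sqr_ge; rewrite k0 expr0n mulr0.
by rewrite ler10.
Qed.

Lemma measurable_exprE k : measurable_fun setT (fun x : R => (x ^+ k)%:E).
Proof. by apply/measurable_EFinP; exact: exprn_measurable. Qed.

(** In the power series of the exponential, the moment bound makes the k-th term at most (k^k / (k!
    e^k)) 2^(-k), hence at most 2^(-k) since k^k / k! <= e^k. The factor 4 e in the scale is chosen
    for this, and the geometric series sums to 2. *)
Lemma subg_exp_sqr :
  (\int[mu]_x (expR (x ^+ 2 / (4 * expR 1 * kappa ^+ 2)))%:E <= 2%:E)%E.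
Proof.
have [L LE] : {L | L = 4 * expR 1 * kappa ^+ 2} by exists (4 * expR 1 * kappa ^+ 2).
rewrite -LE.
have L0 : 0 < L by rewrite LE !mulr_gt0 ?expR_gt0 ?subg_norm_gt0.
have mk (k : nat) : measurable_fun setT (fun x : R => ((x ^+ 2 / L) ^+ k / k`!%:R)%:E).
  apply/measurable_EFinP; apply: measurable_funM => //.
  apply: measurable_funX; apply: measurable_funM => //; exact: exprn_measurable.
have pk (k : nat) (x : R) : 0 <= (x ^+ 2 / L) ^+ k / k`!%:R.
  by rewrite mulr_ge0// exprn_ge0// mulr_ge0 ?sqr_ge0// invr_ge0 ltW.
under eq_integral => x _.
  rewrite expR_nneseries; last by rewrite mulr_ge0 ?sqr_ge0// invr_ge0 ltW.
  over.
rewrite integral_nneseries//; last by move=> k x _; rewrite lee_fin.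
have <- : (\sum_(k <oo) (2 / (2 ^ (k + 1))%:R)%:E = 2%:E :> \bar R)%E.
  apply/cvg_lim => //; have := @cvg_geometric_eseries_half R 2 0.
  by rewrite expr0 divr1.
apply: lee_nneseries => k _.
  by move=> _; apply: integral_ge0 => x _; rewrite lee_fin.
have [->|k0] := posnP k.
  under eq_integral do rewrite expr0 fact0 invr1 mulr1.
  by rewrite integral_prob_cst add0n expn1 divff.
have E x : (((x ^+ 2 / L) ^+ k / k`!%:R)%:E =
    ((L ^+ k)^-1 / k`!%:R)%:E * (x ^+ k.*2)%:E :> \bar R)%E.
  rewrite -EFinM expr_div_n -exprM -mul2n; congr (_%:E).
  by rewrite -mulrA mulrC.
under eq_integral do rewrite E.
have c0 : 0 <= (L ^+ k)^-1 / k`!%:R by rewrite mulr_ge0// invr_ge0 exprn_ge0// ltW.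
have x0 (x : R) : setT x -> (0 <= (x ^+ k.*2)%:E :> \bar R)%E.
  by move=> _; rewrite lee_fin exprn_even_ge0 ?odd_double.
rewrite (ge0_integralZl _ measurableT (measurable_exprE _) x0)//.
apply: le_trans (lee_wpmul2l _ (subg_even_moment k0)) _; first by rewrite lee_fin.
rewrite -EFinM lee_fin.
have kp : 0 < kappa ^+ 2 by rewrite exprn_gt0// subg_norm_gt0.
have -> : (L ^+ k)^-1 / k`!%:R * (kappa ^+ k.*2 * k.*2%:R ^+ k) =
    (k%:R ^+ k / k`!%:R / expR 1 ^+ k) * (2^-1) ^+ k.
  rewrite LE -mul2n exprM natrM !exprMn exprVn.
  have -> : (4 : R) ^+ k = 2 ^+ k * 2 ^+ k by rewrite -exprMn; congr (_ ^+ k); ring.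
  field.
  have kn0 := lt0r_neq0 subg_norm_gt0.
  by rewrite !expf_neq0 ?pnatr_eq0 -?lt0n ?fact_gt0// (lt0r_neq0 (expR_gt0 _)).
have -> : 2 / (2 ^ (k + 1))%:R = 1 * (2^-1) ^+ k :> R.
  by rewrite addn1 expnS natrM natrX exprVn; field; rewrite expf_neq0.
rewrite ler_wpM2r// ?exprn_ge0// ler_pdivrMr ?exprn_gt0 ?expR_gt0// mul1r.
by rewrite -expRM_natl mulr1 expR_ge_exprn_fact.
Qed.

Lemma integral_symmetric (f : R -> \bar R) :
  measurable_fun setT f -> (forall x, 0 <= f x)%E ->
  (\int[mu]_t f (- t)%R = \int[mu]_t f t)%E.
Proof.
move=> mf f0.
have mN : measurable_fun setT (fun t : R => - t) by exact: measurable_funN.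
rewrite -[LHS](ge0_integral_pushforward mN mu (D := setT) (f := f))//.
apply: eq_measure_integral => B mB _.
rewrite /pushforward -[RHS]symmu//; congr (mu _).
apply/seteqP; split => [t /= Bt|_ [t Bt <-]/=]; last by rewrite opprK.
by exists (- t) => //; rewrite opprK.
Qed.

End subgaussian.

Definition convexR {R : realType} (f : R -> R) : Prop :=
  forall t x y, 0 <= t -> t <= 1 ->
    f (t * x + (1 - t) * y) <= t * f x + (1 - t) * f y.

Section even_convex.
Context {R : realType}.
Variable h : R -> R.
Hypothesis ch : convexR h.
Hypothesis evenh : forall x, h (- x) = h x.
Hypothesis h00 : h 0 = 0.
Hypothesis h0 : forall x, 0 <= h x.

Let h_norm x : h `|x| = h x.
Proof. by have [_|_] := ger0P x; rewrite ?evenh. Qed.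

Lemma even_convex_le (s r : R) : `|s| <= `|r| -> h s <= h r.
Proof.
move=> sr; rewrite -(h_norm s) -(h_norm r).
have [r0|r0] := eqVneq `|r| 0.
  have -> : `|s| = 0 by apply/eqP; rewrite eq_le -{1}r0 sr normr_ge0.
  by rewrite h00.
have rp : 0 < `|r| by rewrite lt_neqAle eq_sym r0 normr_ge0.
have t0 : 0 <= `|s| / `|r| by rewrite mulr_ge0 ?invr_ge0.
have t1 : `|s| / `|r| <= 1 by rewrite ler_pdivrMr// mul1r.
have := ch `|r| 0 t0 t1.
rewrite mulr0 addr0 h00 mulr0 addr0 divfK// => H.
by apply: le_trans H _; rewrite ler_piMl.
Qed.

Lemma even_convex_scale (K x : R) : 1 <= K -> K * h x <= h (K * x).
Proof.
move=> K1; have K0 : 0 < K by exact: lt_le_trans K1.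
have t0 : 0 <= K^-1 by rewrite invr_ge0 ltW.
have t1 : K^-1 <= 1 by rewrite invf_le1.
have := ch (K * x) 0 t0 t1.
rewrite mulr0 addr0 h00 mulr0 addr0 mulKf ?gt_eqF// => H.
by rewrite mulrC -ler_pdivlMr// mulrC.
Qed.

End even_convex.

Lemma measurable_scale {R : realType} (f : R -> \bar R) (c : R) :
  measurable_fun setT f -> measurable_fun setT (fun t : R => f (c * t)).
Proof. by move=> mf; apply: (measurableT_comp mf); exact: measurable_funM. Qed.

(* [P (|g| >= s) >= c e^{-s^2}] gives [h r <= e^{r^2 / L^2} E h(L g) / c] for
   every even convex [h] vanishing at [0]; now integrate in [r]. *)
Lemma subg_convex_domination {R : realType} : exists2 C : R, 0 < C &
  forall (mu : probability R R) (kappa : R),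
  (forall B : set R, measurable B -> mu [set - t | t in B] = mu B) ->
  (\int[mu]_t (t ^+ 2)%:E = 1%:E)%E ->
  subg_norm mu = kappa%:E ->
  forall f : R -> R, measurable_fun setT f -> convexR f -> (forall x, 0 <= f x) ->
  (\int[mu]_t (f t)%:E <= \int[gauss]_t (f (C * kappa * t))%:E)%E.
Proof.
have [c c0 tail] := @gauss_tail R.
pose e4 : R := Num.sqrt (4 * expR 1).
have e40 : 0 < e4 by rewrite sqrtr_gt0 mulr_gt0// expR_gt0.
(* Integrating exp (r^2 / L^2) / c costs the factor 2 / c. Convexity with [h 0 = 0] turns a factor
   [K] into a dilation, [K * h x <= h (K * x)], provided [K] is at least 1. *)
pose K : R := 1 + 2 / c.
have K1 : 1 <= K by rewrite lerDl mulr_ge0// invr_ge0 ltW.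
have K0 : 0 < K by exact: lt_le_trans K1.
exists (K * e4); first by rewrite mulr_gt0.
move=> mu kappa symmu varmu subgmu f mf cf f0.
have kappa0 := subg_norm_gt0 varmu subgmu.
pose L := e4 * kappa.
have L0 : 0 < L by rewrite mulr_gt0.
have L2 : L ^+ 2 = 4 * expR 1 * kappa ^+ 2.
  by rewrite exprMn sqr_sqrtr// mulr_ge0// expR_ge0.
(* A symmetric law sees only the even part of [f]. Subtracting [f 0] makes it vanish at 0, hence
   nonnegative by convexity, and the same constant is added back on both sides. *)
pose h x := (f x + f (- x)) / 2 - f 0.
have ch : convexR h.
  move=> t x y t0 t1; rewrite /h.
  have := cf t x y t0 t1; have := cf t (- x) (- y) t0 t1.
  rewrite (_ : t * - x + (1 - t) * - y = - (t * x + (1 - t) * y)); last by ring.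
  by nra.
have evenh x : h (- x) = h x by rewrite /h opprK (addrC (f (- x))).
have h00 : h 0 = 0 by rewrite /h oppr0; field.
have h0 x : 0 <= h x.
  have := cf (2^-1) x (- x); rewrite invr_ge0 ler0n invf_le1// ler1n => /(_ isT isT).
  rewrite (_ : 2^-1 * x + (1 - 2^-1) * - x = 0); last by field.
  by rewrite /h; lra.
have mfN : measurable_fun setT (fun x : R => f (- x)).
  by apply: (measurableT_comp mf); exact: measurable_funN.
have mh : measurable_fun setT h.
  apply: measurable_funB => //; apply: measurable_funM => //.
  exact: measurable_funD.
have mhE : measurable_fun setT (fun x => (h x)%:E) by exact/measurable_EFinP.
have mfE : measurable_fun setT (fun x => (f x)%:E) by exact/measurable_EFinP.
have mfNE : measurable_fun setT (fun x : R => (f (- x))%:E) by exact/measurable_EFinP.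
have hE0 x : (0 <= (h x)%:E)%E by rewrite lee_fin.
have fE0 x : (0 <= (f x)%:E)%E by rewrite lee_fin.
have fNE0 x : (0 <= (f (- x))%:E)%E by rewrite lee_fin.
have half0 : (0 <= (2^-1)%:E :> \bar R)%E by rewrite lee_fin invr_ge0.
have mZ (k : R) (F : R -> \bar R) :
    measurable_fun setT F -> measurable_fun setT (fun x : R => F (k * x)).
  exact: measurable_scale.
have sym (nu : probability R R) (k : R) :
    (\int[nu]_x (f (- (k * x)))%:E = \int[nu]_x (f (k * x))%:E ->
     \int[nu]_x (f (k * x))%:E = \int[nu]_x (h (k * x))%:E + (f 0)%:E)%E.
  move=> H; rewrite -integralD_cst//; last exact: (mZ k _ mhE).
  transitivity (\int[nu]_x ((2^-1)%:E * (f (k * x))%:E + (2^-1)%:E * (f (- (k * x)))%:E))%E.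
    rewrite ge0_integralD; first last.
    - exact: (measurable_funeM _ (mZ k _ mfNE)).
    - by move=> x _; rewrite mule_ge0.
    - exact: (measurable_funeM _ (mZ k _ mfE)).
    - by move=> x _; rewrite mule_ge0.
    - exact: measurableT.
    rewrite (ge0_integralZl _ measurableT (mZ k _ mfE) (fun x _ => fE0 _) half0).
    rewrite (ge0_integralZl _ measurableT (mZ k _ mfNE) (fun x _ => fNE0 _) half0) H.
    rewrite -ge0_muleDl// -EFinD (_ : 2^-1 + 2^-1 = 1) ?mul1e//; by field.
  by apply: eq_integral => x _; rewrite -!EFinM -!EFinD /h; congr (_%:E); field.
have -> : (\int[mu]_t (f t)%:E = \int[mu]_t (f (1 * t))%:E)%E.
  by apply: eq_integral => t _; rewrite mul1r.
rewrite (sym mu 1); last first.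
  under eq_integral do rewrite mul1r; under [RHS]eq_integral do rewrite mul1r.
  exact: (@integral_symmetric _ mu symmu (fun x => (f x)%:E)).
rewrite (sym [the probability R R of gauss]); last first.
  have := @ge0_integral_gaussN R (fun x => (f (K * e4 * kappa * x))%:E) (mZ _ _ mfE) (fun x => fE0 _).
  by move=> <-; apply: eq_integral => x _; rewrite mulrN.
rewrite leeD2r//; under eq_integral do rewrite mul1r.
set J := (\int[gauss]_t (h (L * t))%:E)%E.
have J0 : (0 <= J)%E by apply: integral_ge0 => t _.
have hJ r : ((h r)%:E <= (c^-1 * expR (r ^+ 2 / L ^+ 2))%:E * J)%E.
  have rL0 : 0 <= `|r| / L by rewrite mulr_ge0// invr_ge0 ltW.
  have := tail _ rL0; set A := [set t | _] => tA.
  have mA : measurable A.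
    rewrite (_ : A = Num.norm @^-1` `[`|r| / L, +oo[).
      by rewrite -[X in measurable X]setTI; exact: normr_measurable.
    by apply/seteqP; split => x /=; rewrite /A /= in_itv/= andbT.
  have H : ((h r)%:E * gauss A <= J)%E.
    have mI : measurable_fun setT (fun t : R => (\1_A t)%:E : \bar R).
      by apply/measurable_EFinP; exact: measurable_indic.
    have I0 t : setT t -> (0 <= (\1_A t)%:E :> \bar R)%E by rewrite lee_fin.
    have -> : gauss A = (\int[gauss]_t (\1_A t)%:E)%E by rewrite integral_indic// setIT.
    rewrite -(ge0_integralZl _ measurableT mI I0 (hE0 r)).
    apply: ge0_le_integral; first exact: measurableT.
    - by move=> t _; rewrite mule_ge0// lee_fin.
    - exact: measurable_funeM.
    - exact: (mZ L _ mhE).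
    - move=> t _; rewrite -EFinM lee_fin indicE.
      have [tinA|] := boolP (t \in A); last by rewrite mulr0.
      rewrite mulr1; apply: even_convex_le => //.
      move: tinA; rewrite inE /A /= ler_pdivrMr// => rt.
      by rewrite normrM (gtr0_norm L0) mulrC.
  have {}H := le_trans (lee_wpmul2l (hE0 r) tA) H.
  have k0 : (0 <= (c^-1 * expR (r ^+ 2 / L ^+ 2))%:E :> \bar R)%E.
    by rewrite lee_fin mulr_ge0 ?expR_ge0// invr_ge0 ltW.
  apply: le_trans (lee_wpmul2l k0 H).
  rewrite -!EFinM lee_fin expr_div_n real_normK ?num_real//.
  set E := expR _; set E' := expR _.
  have EE : E * E' = 1 by rewrite /E /E' -expRD subrr expR0.
  have -> : c^-1 * E * (h r * (c * E')) = h r * (c^-1 * c) * (E * E') by ring.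
  by rewrite EE mulVf ?gt_eqF// !mulr1.
have mE : measurable_fun setT (fun r : R => (expR (r ^+ 2 / L ^+ 2))%:E).
  apply/measurable_EFinP; apply: (measurableT_comp (@measurable_expR R)).
  by apply: measurable_funM => //; exact: exprn_measurable.
have E0 (r : R) : setT r -> (0 <= (expR (r ^+ 2 / L ^+ 2))%:E)%E.
  by rewrite lee_fin expR_ge0.
have c'0 : (0 <= (c^-1)%:E)%E by rewrite lee_fin invr_ge0 ltW.
have mE' : measurable_fun setT (fun r : R => (c^-1 * expR (r ^+ 2 / L ^+ 2))%:E).
  by apply: eq_measurable_fun (measurable_funeM c^-1%:E mE) => r _; rewrite EFinM.
have E'0 (r : R) : setT r -> (0 <= (c^-1 * expR (r ^+ 2 / L ^+ 2))%:E)%E.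
  by move=> rT; rewrite EFinM mule_ge0// E0.
apply: (@le_trans _ _ (\int[mu]_r ((c^-1 * expR (r ^+ 2 / L ^+ 2))%:E * J))%E).
  apply: ge0_le_integral; first exact: measurableT.
  - by move=> r _.
  - exact: mhE.
  - exact: emeasurable_funM.
  - by move=> r _; exact: hJ.
rewrite (ge0_integralZr _ measurableT mE' E'0 J0).
apply: (@le_trans _ _ (K%:E * J)%E).
  apply: lee_wpmul2r => //.
  under eq_integral do rewrite EFinM.
  rewrite (ge0_integralZl _ measurableT mE E0 c'0).
  have := subg_exp_sqr varmu subgmu; rewrite -L2 => H.
  apply: le_trans (lee_wpmul2l c'0 H) _.
  by rewrite -EFinM lee_fin /K mulrC lerDr.
have hL0 (t : R) : setT t -> (0 <= (h (L * t))%:E)%E by move=> _.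
have K0E : (0 <= K%:E)%E by rewrite lee_fin ltW.
rewrite /J -(ge0_integralZl _ measurableT (mZ L _ mhE) hL0 K0E).
apply: ge0_le_integral; first exact: measurableT.
- by move=> t _; rewrite mule_ge0.
- exact: (measurable_funeM _ (mZ L _ mhE)).
- exact: (mZ _ _ mhE).
- move=> t _; rewrite -EFinM lee_fin.
  have -> : K * e4 * kappa * t = K * (L * t) by rewrite /L; ring.
  exact: even_convex_scale.
Qed.

Lemma eq2_le {R : realType} (a b a' b' : \bar R) :
  a = a' -> b = b' -> (a' <= b')%E -> (a <= b)%E.
Proof. by move=> -> ->. Qed.

Lemma psum_le0 {R : realType} d d' (B : measurableType d) (B' : measurableType d')
    (I : Type) (Psi : (I -> R) -> R) n (nu : nat -> probability B R)
    (nu' : nat -> probability B' R) (X : nat -> I -> B -> R)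
    (Y : nat -> I -> B' -> R) (c : I -> R) :
  measurable_functional Psi -> (forall c, 0 <= Psi c) ->
  (forall j i, measurable_fun setT (X j i)) ->
  (forall j i, measurable_fun setT (Y j i)) ->
  (forall j c, \int[nu j]_b (Psi (fun i => c i + X j i b))%:E <=
    \int[nu' j]_b (Psi (fun i => c i + Y j i b))%:E)%E ->
  (\int[pprod nu n]_v (Psi (fun i => c i + psum X v i))%:E <=
   \int[pprod nu' n]_v (Psi (fun i => c i + psum Y v i))%:E)%E.
Proof.
move=> mPsi Psi0 mX mY H.
have H' j e : (\int[nu j]_b (Psi (fun i => e i + X j i b))%:E <=
    \int[nu' j]_b (Psi (fun i => e i + Y j i b))%:E + 0%:E)%E by rewrite adde0.
have := @psum_le R _ _ B B' I Psi mPsi Psi0 n nu nu' X Y (fun=> 0) c mX mY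
  (fun=> lexx 0) H'.
by rewrite big1// adde0.
Qed.

Section lin_algebra.
Context {R : realType}.

Lemma linS n (u : nat -> R) (v : pow R n.+1) :
  lin u v = u 0%N * v.1 + lin (fun j => u j.+1) (v.2 : pow R n).
Proof. by []. Qed.

Lemma lin_scale n (k : R) (u : nat -> R) (v : pow R n) :
  lin (fun j => k * u j) v = k * lin u v.
Proof.
elim: n u v => [|n IH] u v; first by rewrite /lin /= mulr0.
rewrite !linS mulrDr mulrA; congr (_ + _).
exact: (IH (fun j => u j.+1)).
Qed.

Lemma lin_add n (u w : nat -> R) (v : pow R n) :
  lin (fun j => u j + w j) v = lin u v + lin w v.
Proof.
elim: n u w v => [|n IH] u w v; first by rewrite /lin /= addr0.
rewrite !linS mulrDl addrACA; congr (_ + _).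
exact: (IH (fun j => u j.+1) (fun j => w j.+1)).
Qed.

Lemma lin0 n (v : pow R n) : lin (fun=> 0) v = 0.
Proof.
by elim: n v => [//|n IH] v; rewrite linS mul0r add0r; exact: IH.
Qed.

Lemma lin_sum n (k : nat) (u : 'I_k -> nat -> R) (v : pow R n) :
  lin (fun j => \sum_(i < k) u i j) v = \sum_(i < k) lin (u i) v.
Proof.
elim: k u => [|k IH] u.
  rewrite big_ord0 -[RHS](lin0 v); congr lin.
  by apply/funext => j; rewrite big_ord0.
rewrite big_ord_recl -IH -lin_add; congr lin.
by apply/funext => j; rewrite big_ord_recl.
Qed.

Lemma eq_lin n (u w : nat -> R) (v : pow R n) :
  (forall j, (j < n)%N -> u j = w j) -> lin u v = lin w v.
Proof.
elim: n u w v => [//|n IH] u w v uw; rewrite !linS uw//.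
by congr (_ + _); apply: (IH (fun j => u j.+1) (fun j => w j.+1)) => j jn; exact: uw.
Qed.

End lin_algebra.

Section exp_convex.
Context {R : realType}.

Lemma expR_tangent (m z : R) : expR m * (1 + (z - m)) <= expR z.
Proof.
by rewrite -[X in _ <= expR X](subrKC m) expRD ler_pM2l ?expR_gt0// expR_ge1Dx.
Qed.

Lemma convexR_expR : convexR (@expR R).
Proof.
move=> t a b t0 t1; set m := t * a + (1 - t) * b.
have := ler_wpM2l t0 (expR_tangent m a); have : 0 <= 1 - t by rewrite subr_ge0.
move=> /ler_wpM2l /(_ _ _ (expR_tangent m b)).
have -> : t * (expR m * (1 + (a - m))) = expR m * t * (1 + (a - m)) by ring.
have -> : (1 - t) * (expR m * (1 + (b - m))) =
   expR m - expR m * t * (1 + (a - m)).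
  by rewrite /m; ring.
by lra.
Qed.

Lemma vmax_convex (I : finType) (i0 : I) (t : R) (a b : I -> R) :
  0 <= t -> t <= 1 ->
  vmax i0 (fun i => t * a i + (1 - t) * b i) <= t * vmax i0 a + (1 - t) * vmax i0 b.
Proof.
move=> t0 t1; apply: vmax_le => i.
by rewrite lerD// ler_wpM2l ?subr_ge0// le_vmax.
Qed.

Lemma expR_vmax_convex (I : finType) (i0 : I) (s t : R) (a b : I -> R) :
  0 <= s -> 0 <= t -> t <= 1 ->
  expR (s * vmax i0 (fun i => t * a i + (1 - t) * b i)) <=
  t * expR (s * vmax i0 a) + (1 - t) * expR (s * vmax i0 b).
Proof.
move=> s0 t0 t1; apply: le_trans (convexR_expR _ _ t0 t1).
rewrite ler_expR mulrCA [(1 - t) * _]mulrCA -mulrDr.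
by apply: ler_wpM2l => //; exact: vmax_convex.
Qed.

Lemma Jensen_expR d (D : measurableType d) (P : probability D R) (X : D -> R) :
  P.-integrable setT (EFin \o X) ->
  ((expR (fine (\int[P]_x (X x)%:E)))%:E <= \int[P]_x (expR (X x))%:E)%E.
Proof.
move=> iX; have mX := measurable_int _ iX.
set m := fine _.
have mE : (\int[P]_x (X x)%:E)%E = m%:E by rewrite fineK//; exact: integrable_fin_num.
have mexp : measurable_fun setT (fun x => (expR (X x))%:E).
  apply/measurable_EFinP; apply: (measurableT_comp (@measurable_expR R)).
  exact/measurable_EFinP.
have [|ninf] := eqVneq (\int[P]_x (expR (X x))%:E)%E +oo%E; first by move=> ->; rewrite leey.
have iexp : P.-integrable setT (fun x => (expR (X x))%:E).
  apply/integrableP; split => //.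
  under eq_integral => x _ do rewrite gee0_abs ?lee_fin ?expR_ge0//.
  by rewrite ltey.
have iT : P.-integrable setT (fun x => (expR m)%:E * ((1 - m)%:E + (X x)%:E))%E.
  apply: integrableZl => //; apply: integrableD => //.
  exact: finite_measure_integrable_cst.
apply: (@le_trans _ _ (\int[P]_x ((expR m)%:E * ((1 - m)%:E + (X x)%:E)))%E).
  rewrite integralZl//; last first.
    by apply: integrableD => //; exact: finite_measure_integrable_cst.
  rewrite integralD//; last exact: finite_measure_integrable_cst.
  by rewrite integral_prob_cst mE -EFinD -EFinM subrK mulr1.
apply: le_integral => // x _.
rewrite -EFinD -EFinM lee_fin.
by apply: le_trans (expR_tangent m (X x)); rewrite (_ : 1 - m + X x = 1 + (X x - m))//; ring.
Qed.

End exp_convex.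

Section first_moment.
Context {R : realType}.
Variable mu : probability R R.
Hypothesis varmu : (\int[mu]_t (t ^+ 2)%:E = 1%:E)%E.

Definition iidn n : probability (pow R n) R := pprod (fun=> mu) n.

Lemma integral_norm_le1 : (\int[mu]_t `|t|%:E <= 1)%E.
Proof.
have mn : measurable_fun setT (fun t : R => `|t|%:E).
  by apply/measurable_EFinP; exact: normr_measurable.
have m2 := @measurable_exprE R 2.
apply: (@le_trans _ _ ((2^-1)%:E * \int[mu]_t (t ^+ 2)%:E + (2^-1)%:E * \int[mu]_t 1)%E).
  apply: le_integral_half => //.
  - by move=> t; rewrite lee_fin sqr_ge0.
  - move=> t; rewrite mule1 -EFinM -EFinD lee_fin -(real_normK (num_real t)).
    by have := sqr_ge0 (`|t| - 1); nra.
by rewrite varmu integral_prob_cst mule1 -EFinD lee_fin; lra.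
Qed.

(** Replacement of every coordinate by 0 costs [|u j|] times E|a| <= 1. The bound serves to make
    linear forms integrable. *)
Lemma integral_norm_lin n (u : nat -> R) :
  (\int[iidn n]_v `|lin u v|%:E <= (\sum_(j < n) `|u j|)%:E)%E.
Proof.
pose Psi (c : unit -> R) := `|c tt|.
have mPsi : measurable_functional Psi.
  by move=> d D Z mZ; apply: measurableT_comp.
have := @psum_le R _ _ R R unit Psi mPsi (fun=> normr_ge0 _) n
  (fun=> mu) (fun=> mu) (fun j _ t => u j * t) (fun _ _ _ => 0)
  (fun j => `|u j|) (fun=> 0).
have H0 : (\int[iidn n]_v (Psi (fun i : unit => 0 + psum (fun _ _ (_ : R) => 0) v i))%:E = 0 :> \bar R)%E.
  rewrite integral0_eq// => v _; rewrite /Psi add0r.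
  suff -> : psum (fun _ _ _ => 0) v tt = 0 :> R by rewrite normr0.
  by elim: n v => [//|n' IH] v /=; rewrite add0r.
rewrite H0 add0e => H.
have {H} := H _ _ _ _.
under eq_integral do rewrite /Psi add0r; apply => //.
- by move=> j i; exact: measurable_funM.
move=> j c; rewrite /Psi addr0 integral_prob_cst.
have mn : measurable_fun setT (fun t : R => `|t|%:E).
  by apply/measurable_EFinP; exact: normr_measurable.
apply: (@le_trans _ _ (\int[mu]_t (`|u j|%:E * `|t|%:E + `|c tt|%:E))%E).
  apply: ge0_le_integral; first exact: measurableT.
  - by move=> t _; rewrite lee_fin.
  - apply/measurable_EFinP; apply: measurableT_comp => //.
    by apply: measurable_funD => //; exact: measurable_funM.
  - by apply: emeasurable_funD => //; exact: measurable_funeM.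
  - by move=> t _; rewrite -EFinM -EFinD lee_fin -normrM [X in _ <= X]addrC ler_normD.
have u0 : (0 <= `|u j|%:E)%E by rewrite lee_fin.
have n0 (t : R) : (0 <= `|t|%:E)%E by rewrite lee_fin.
rewrite (integralD_cst _ (measurable_funeM _ mn) (fun t => mule_ge0 u0 (n0 t)))//.
rewrite (ge0_integralZl _ measurableT mn (fun t _ => n0 t) u0).
rewrite addeC leeD2l//.
by rewrite -[leRHS]mule1 lee_wpmul2l// integral_norm_le1.
Qed.

End first_moment.

(** * Domination of one signed measurement by a Gaussian vector *)

Section block_domination.
Context {R : realType}.
Variables (mu rE : probability R R).
Hypothesis symmu : forall B : set R, measurable B -> mu [set - t | t in B] = mu B.
Hypothesis varmu : (\int[mu]_t (t ^+ 2)%:E = 1%:E)%E.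
Variables (I : finType) (i0 : I) (n : nat) (x : nat -> R) (U : I -> nat -> R).

Definition blockP : probability (R * pow R n)%type R := (rE \x iidn mu n)%E.

(** [b.1] is the noise and [b.2] the measurement. The noise enters through [sgn], which is 1 or -1
    at every point and agrees with [b.1] when the noise takes one of these values; identities on
    absolute values thus hold everywhere, not only almost surely. *)
Definition signed_lin (x u : nat -> R) (b : R * pow R n) : R :=
  sgn b.1 * sgn (lin x b.2) * lin u b.2.

Definition mean_signed (x u : nat -> R) : R :=
  fine (\int[blockP]_b (signed_lin x u b)%:E).

Lemma sgnE (t : R) : sgn t = 1 \/ sgn t = -1.
Proof. by rewrite /sgn; case: ifP; [left|right]. Qed.

Lemma normr_sgn (t : R) : `|sgn t| = 1.
Proof. by case: (sgnE t) => ->; rewrite ?normrN normr1. Qed.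

Lemma measurable_sgn : measurable_fun setT (@sgn R).
Proof.
apply: measurable_fun_if => //.
apply: (@measurable_fun_bool _ _ _ _ true).
rewrite setTI (_ : _ @^-1` _ = `[0, +oo[%classic) //.
by apply/seteqP; split => t /=; rewrite in_itv/= andbT.
Qed.

Lemma measurable_signed_lin u : measurable_fun setT (signed_lin x u).
Proof.
apply: measurable_funM; last exact: (measurableT_comp (measurable_lin u)).
apply: measurable_funM; apply: (measurableT_comp measurable_sgn) => //.
exact: (measurableT_comp (measurable_lin x)).
Qed.

Lemma norm_signed_lin u b : `|signed_lin x u b| = `|lin u b.2|.
Proof. by rewrite !normrM !normr_sgn !mul1r. Qed.

Lemma ge0_integral_block_snd (F : pow R n -> \bar R) :
  measurable_fun setT F -> (forall v, 0 <= F v)%E ->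
  (\int[blockP]_b F b.2 = \int[iidn mu n]_v F v)%E.
Proof.
move=> mF F0.
have mF2 : measurable_fun setT (fun b : R * pow R n => F b.2).
  exact: (measurableT_comp mF measurable_snd).
rewrite /blockP fubini_tonelli2; [|exact: mF2|by move=> b].
by apply: eq_integral => v _; rewrite /fubini_G /= integral_prob_cst.
Qed.

Lemma integrable_signed_lin u : blockP.-integrable setT (EFin \o signed_lin x u).
Proof.
apply/integrableP; split.
  by apply/measurable_EFinP; exact: measurable_signed_lin.
under eq_integral => b _ do rewrite /= norm_signed_lin.
rewrite (ge0_integral_block_snd (F := fun v => `|lin u v|%:E)); last 2 first.
- apply/measurable_EFinP; apply: measurableT_comp => //; exact: measurable_lin.
- by move=> v; rewrite lee_fin.
exact: le_lt_trans (integral_norm_lin varmu n u) (ltry _).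
Qed.

Lemma iidn_symmetric (Psi : (I -> R) -> R) (k : R) (c : I -> R) :
  measurable_functional Psi -> (forall c, 0 <= Psi c) ->
  (\int[iidn mu n]_v (Psi (fun i => c i - k * lin (U i) v))%:E <=
   \int[iidn mu n]_v (Psi (fun i => c i + k * lin (U i) v))%:E)%E.
Proof.
move=> mPsi Psi0.
have m1 (l : R) (j : nat) (i : I) : measurable_fun setT (fun t : R => l * U i j * t).
  exact: measurable_funM.
have H1 (j : nat) (e : I -> R) :
   (\int[mu]_t (Psi (fun i => e i + - k * U i j * t))%:E <=
    \int[mu]_t (Psi (fun i => e i + k * U i j * t))%:E)%E.
  rewrite -(@integral_symmetric _ mu symmu).
  - rewrite le_eqVlt; apply/orP; left; apply/eqP; apply: eq_integral => t _.
    by congr (Psi _)%:E; apply/funext => i; ring.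
  - apply/measurable_EFinP; apply: mPsi => i; apply: measurable_funD => //.
  - by move=> t; rewrite lee_fin.
have := @psum_le0 R _ _ R R I Psi n (fun=> mu) (fun=> mu)
  (fun j i t => - k * U i j * t) (fun j i t => k * U i j * t) c mPsi Psi0
  (fun j i => m1 (- k) j i) (fun j i => m1 k j i) H1.
congr (_ <= _)%E; apply: eq_integral => v _.
  congr (Psi _)%:E; apply/funext => i.
  by rewrite (psum_lin (fun i j => - k * U i j)) lin_scale mulNr.
congr (Psi _)%:E; apply/funext => i.
by rewrite (psum_lin (fun i j => k * U i j)) lin_scale.
Qed.

Lemma iidn_domination (C : R) (s : R) (c : I -> R) : 0 <= s ->
  (forall f : R -> R, measurable_fun setT f -> convexR f -> (forall x, 0 <= f x) ->
    (\int[mu]_t (f t)%:E <= \int[gauss]_t (f (C * t))%:E)%E) ->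
  (\int[iidn mu n]_v (expR (s * vmax i0 (fun i => c i + 2 * lin (U i) v)))%:E <=
   \int[gaussn n]_v (expR (s * vmax i0 (fun i => c i + 2 * C * lin (U i) v)))%:E)%E.
Proof.
move=> s0 dom.
pose Psi (c : I -> R) := expR (s * vmax i0 c).
have mPsi : measurable_functional Psi := measurable_expR_vmax i0 s.
have Psi0 e : 0 <= Psi e by exact: expR_ge0.
have m1 (l : R) (j : nat) (i : I) : measurable_fun setT (fun t : R => l * U i j * t).
  exact: measurable_funM.
have H1 (j : nat) (e : I -> R) :
   (\int[mu]_t (Psi (fun i => e i + 2 * U i j * t))%:E <=
    \int[gauss]_t (Psi (fun i => e i + 2 * C * U i j * t))%:E)%E.
  have mf : measurable_fun setT (fun t : R => Psi (fun i => e i + 2 * U i j * t)).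
    by apply: mPsi => i; apply: measurable_funD => //; exact: m1.
  apply: le_trans (dom _ mf _ (fun=> Psi0 _)) _; last first.
    rewrite le_eqVlt; apply/orP; left; apply/eqP; apply: eq_integral => t _.
    by congr (Psi _)%:E; apply/funext => i; ring.
  move=> t a b t0 t1.
  apply: le_trans (expR_vmax_convex _ _ _ s0 t0 t1).
  rewrite le_eqVlt; apply/orP; left; apply/eqP; congr (Psi _).
  by apply/funext => i; ring.
have := @psum_le0 R _ _ R R I Psi n (fun=> mu)
  (fun=> [the probability R R of gauss])
  (fun j i t => 2 * U i j * t) (fun j i t => 2 * C * U i j * t) c mPsi Psi0
  (fun j i => m1 2 j i) (fun j i => m1 (2 * C) j i) H1.
apply: eq2_le; apply: eq_integral => v _.
  congr (Psi _)%:E; apply/funext => i.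
  by rewrite (psum_lin (fun i j => 2 * U i j)) lin_scale.
congr (Psi _)%:E; apply/funext => i.
by rewrite (psum_lin (fun i j => 2 * C * U i j)) lin_scale.
Qed.

(* Centering costs a factor [2]: by convexity the deviation from the mean is
   dominated by twice the symmetric variable itself. *)
Lemma block_domination (C : R) (s : R) (c : I -> R) : 0 <= s ->
  (forall f : R -> R, measurable_fun setT f -> convexR f -> (forall x, 0 <= f x) ->
    (\int[mu]_t (f t)%:E <= \int[gauss]_t (f (C * t))%:E)%E) ->
  (\int[blockP]_b (expR (s * vmax i0 (fun i =>
       (c i + (signed_lin x (U i) b - mean_signed x (U i)))%R)))%:E <=
   \int[gaussn n]_v (expR (s * vmax i0 (fun i => c i + 2 * C * lin (U i) v)))%:E)%E.
Proof.
move=> s0 dom; apply: le_trans (iidn_domination _ s0 dom).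
pose Psi (c : I -> R) := expR (s * vmax i0 c).
have mPsi : measurable_functional Psi := measurable_expR_vmax i0 s.
have Psi0 e : 0 <= Psi e by exact: expR_ge0.
have half0 : (0 <= (2^-1)%:E :> \bar R)%E by rewrite lee_fin invr_ge0.
have mz (k : R) : measurable_fun setT
    (fun b => (Psi (fun i => c i + k * signed_lin x (U i) b))%:E).
  apply/measurable_EFinP; apply: mPsi => i; apply: measurable_funD => //.
  by apply: measurable_funM => //; exact: measurable_signed_lin.
have ml (k : R) : measurable_fun setT
    (fun v : pow R n => (Psi (fun i => c i + k * lin (U i) v))%:E).
  apply/measurable_EFinP; apply: mPsi => i; apply: measurable_funD => //.
  by apply: measurable_funM => //; exact: measurable_lin.
have P0 e : (0 <= (Psi e)%:E)%E by rewrite lee_fin.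
(* At the means the maximum is attained at one fixed index, so the scalar Jensen inequality for that
   index suffices. *)
have jensen : ((Psi (fun i => c i + -2 * mean_signed x (U i)))%:E <=
    \int[blockP]_b (Psi (fun i => c i + -2 * signed_lin x (U i) b))%:E)%E.
  rewrite {1}/Psi; have [i ->] := vmax_attained i0 (fun i => c i + -2 * mean_signed x (U i)).
  have iz := integrable_signed_lin (U i).
  have iz2 := integrableZl measurableT (-2) iz.
  have ic := finite_measure_integrable_cst blockP (c i) measurableT.
  have izc := integrableD measurableT ic iz2.
  have XE : EFin \o (fun b => s * (c i + -2 * signed_lin x (U i) b)) =
      (fun b => s%:E * ((EFin \o cst (c i)) b + (-2)%:E * (EFin \o signed_lin x (U i)) b))%E.
    by apply/funext => b /=; rewrite EFinM EFinD EFinM.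
  have iX : blockP.-integrable setT
      (EFin \o (fun b => s * (c i + -2 * signed_lin x (U i) b))).
    by rewrite XE; exact: integrableZl.
  have -> : s * (c i + -2 * mean_signed x (U i)) =
      fine (\int[blockP]_b (s * (c i + -2 * signed_lin x (U i) b))%:E).
    rewrite -[X in fine (integral _ _ X)]/(EFin \o _) XE.
    rewrite (integralZl measurableT izc) (integralD measurableT ic iz2).
    have ci : (\int[blockP]_b (EFin \o cst (c i)) b = (c i)%:E)%E.
      exact: (integral_prob_cst blockP (c i)%:E).
    rewrite (integralZl measurableT iz) ci.
    have zE := fineK (integrable_fin_num measurableT iz).
    by rewrite -[X in fine (_ * (_ + _ * X))%E]zE.
  apply: le_trans (Jensen_expR iX) _.
  apply: ge0_le_integral; first exact: measurableT.
  - by move=> b _; rewrite lee_fin expR_ge0.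
  - apply/measurable_EFinP; apply: (measurableT_comp (@measurable_expR R)).
    apply: measurable_funM => //; apply: measurable_funD => //.
    by apply: measurable_funM => //; exact: measurable_signed_lin.
  - exact: mz.
  - move=> b _; rewrite lee_fin ler_expR ler_wpM2l//.
    exact: (le_vmax i0 (fun i => c i + -2 * signed_lin x (U i) b)).
(* With z the signed form, c + (z - E z) is the midpoint of c + 2 z and c - 2 E z. Convexity
   separates the two, and [jensen] restores z in the second. *)
apply: (@le_trans _ _ ((2^-1)%:E * (\int[blockP]_b (Psi (fun i => c i + 2 * signed_lin x (U i) b))%:E)
   + (2^-1)%:E * (\int[blockP]_b (Psi (fun i => c i + -2 * signed_lin x (U i) b))%:E))%E).
  apply: (@le_trans _ _ ((2^-1)%:E * (\int[blockP]_b (Psi (fun i => c i + 2 * signed_lin x (U i) b))%:E)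
   + (2^-1)%:E * (\int[blockP]_b (Psi (fun i => c i + -2 * mean_signed x (U i)))%:E))%E).
    apply: le_integral_half.
    - apply/measurable_EFinP; apply: (mPsi _ _ (fun i b =>
        c i + (signed_lin x (U i) b - mean_signed x (U i)))) => i.
      apply: measurable_funD => //.
      by apply: measurable_funB => //; exact: measurable_signed_lin.
    - exact: mz.
    - exact: measurable_cst.
    - by move=> b; exact: P0.
    - by move=> b; exact: P0.
    - by move=> b; exact: P0.
    - move=> b; rewrite -!EFinM -EFinD lee_fin.
      have h1 : 2^-1 <= 1 :> R by lra.
      have h2 : 0 <= 2^-1 :> R by rewrite invr_ge0.
      have := @expR_vmax_convex R I i0 s _ (fun i => c i + 2 * signed_lin x (U i) b)
        (fun i => c i + -2 * mean_signed x (U i)) s0 h2 h1.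
      rewrite (_ : 1 - 2^-1 = 2^-1); last by field.
      apply: le_trans; rewrite le_eqVlt; apply/orP; left; apply/eqP; congr (Psi _).
      by apply/funext => i; field.
  by rewrite integral_prob_cst leeD2l// lee_wpmul2l.
(* The label disappears here: a sign, whatever its dependence on the measurement, can only swap the
   two terms of the average. *)
have -> : ((2^-1)%:E * (\int[blockP]_b (Psi (fun i => c i + 2 * signed_lin x (U i) b))%:E)
   + (2^-1)%:E * (\int[blockP]_b (Psi (fun i => c i + -2 * signed_lin x (U i) b))%:E) =
   (2^-1)%:E * (\int[iidn mu n]_v (Psi (fun i => c i + 2 * lin (U i) v))%:E)
   + (2^-1)%:E * (\int[iidn mu n]_v (Psi (fun i => c i + -2 * lin (U i) v))%:E))%E.
  rewrite -!ge0_muleDr; try by apply: integral_ge0 => ? _.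
  congr (_ * _)%E.
  rewrite -(ge0_integralD _ measurableT (fun b _ => P0 _) (mz 2) (fun b _ => P0 _) (mz (-2))).
  rewrite -(ge0_integralD _ measurableT (fun v _ => P0 _) (ml 2) (fun v _ => P0 _) (ml (-2))).
  rewrite -ge0_integral_block_snd; first last.
  - by move=> v; exact: adde_ge0.
  - exact: emeasurable_funD.
  apply: eq_integral => b _ /=; rewrite /signed_lin.
  have [->|->] : sgn b.1 * sgn (lin x b.2) = 1 \/ sgn b.1 * sgn (lin x b.2) = -1.
  - by case: (sgnE b.1) => ->; case: (sgnE (lin x b.2)) => ->; rewrite ?mulrNN ?mulr1 ?mul1r; auto.
  - by congr (_ + _)%E; congr (Psi _)%:E; apply/funext => i; rewrite mul1r.
  - rewrite addeC; congr (_ + _)%E; congr (Psi _)%:E; apply/funext => i; ring.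
have H := iidn_symmetric 2 c mPsi Psi0.
have {}H : (\int[iidn mu n]_v (Psi (fun i => c i + -2 * lin (U i) v))%:E <=
   \int[iidn mu n]_v (Psi (fun i => c i + 2 * lin (U i) v))%:E)%E.
  move: H; apply: eq2_le; last by [].
  apply: eq_integral => v _; congr (Psi _)%:E.
  by apply/funext => i; rewrite mulNr.
apply: le_trans (leeD2l _ (lee_wpmul2l half0 H)) _.
rewrite -(ge0_muleDl _ half0 half0) -EFinD.
have -> : 2^-1 + 2^-1 = 1 :> R by field.
by rewrite mul1e.
Qed.

End block_domination.

(** * Bias of the sign-weighted mean *)

Section bounded_test_functions.
Context {R : realType}.
Variables (mu nu : probability R R) (eps : R).
Hypothesis mu_le_nu : forall A : set R, measurable A -> (mu A <= nu A + eps%:E)%E.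

(** Binary digits of [h]: h = (1_A + h') / 2 with A = {h >= 1/2} and h' again valued in [0, 1]. The
    digits cost eps / 2, eps / 4, and so on, so the total stays at [eps] without a loss of
    constant. *)
Let tv_bounded_dyadic (N : nat) (h : R -> R) : measurable_fun setT h ->
  (forall t, 0 <= h t) -> (forall t, h t <= 1) ->
  (\int[mu]_t (h t)%:E <= \int[nu]_t (h t)%:E + (eps + 2^-1 ^+ N)%:E)%E.
Proof.
have eps0 : 0 <= eps.
  have := mu_le_nu measurableT.
  by rewrite !probability_setT -EFinD lee_fin; lra.
elim: N h => [|N IH] h mh h0 h1.
  rewrite expr0; apply: (@le_trans _ _ 1%E).
    rewrite -[leRHS](integral_prob_cst mu).
    apply: ge0_le_integral; first exact: measurableT.
    - by move=> t _; rewrite lee_fin.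
    - exact/measurable_EFinP.
    - exact: measurable_cst.
    - by move=> t _; rewrite lee_fin.
  apply: (@le_trans _ _ (0 + (eps + 1)%:E)%E).
    by rewrite add0e lee_fin; lra.
  by rewrite leeD2r//; apply: integral_ge0 => t _; rewrite lee_fin.
pose A : set R := h @^-1` `[2^-1, +oo[.
have mA : measurable A by exact: (measurable_preimage mh).
pose h' t := 2 * h t - \1_A t.
have mh' : measurable_fun setT h'.
  by apply: measurable_funB; [exact: measurable_funM|exact: measurable_indic].
have h'01 t : 0 <= h' t <= 1.
  rewrite /h' indicE; have [tA|tA] := boolP (t \in A).
    move: tA; rewrite inE /A /= in_itv/= andbT => tA.
    by have := h1 t; lra.
  move: tA; rewrite notin_setE /A /= in_itv/= andbT => /negP; rewrite -ltNge => tA.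
  by have := h0 t; lra.
have half0 : (0 <= (2^-1)%:E :> \bar R)%E by rewrite lee_fin invr_ge0.
have m1 : measurable_fun setT (fun t : R => (\1_A t)%:E : \bar R).
  by apply/measurable_EFinP; exact: measurable_indic.
have i1 (t : R) : setT t -> (0 <= (\1_A t)%:E :> \bar R)%E by rewrite lee_fin.
have m2 : measurable_fun setT (fun t => (h' t)%:E) by exact/measurable_EFinP.
have i2 (t : R) : setT t -> (0 <= (h' t)%:E)%E.
  by move=> _; rewrite lee_fin; have /andP[] := h'01 t.
have dec (P : probability R R) : (\int[P]_t (h t)%:E =
    (2^-1)%:E * P A + (2^-1)%:E * \int[P]_t (h' t)%:E)%E.
  have -> : (P A = \int[P]_t (\1_A t)%:E)%E by rewrite integral_indic// setIT.
  rewrite -(ge0_integralZl _ measurableT m1 i1 half0).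
  rewrite -(ge0_integralZl _ measurableT m2 i2 half0).
  rewrite -ge0_integralD; first last.
  - exact: measurable_funeM.
  - by move=> t tT; rewrite mule_ge0// i2.
  - exact: measurable_funeM.
  - by move=> t tT; rewrite mule_ge0// i1.
  - exact: measurableT.
  apply: eq_integral => t _; rewrite -!EFinM -EFinD /h'; congr (_%:E).
  by field.
rewrite (dec mu) (dec nu).
have h'0 t : 0 <= h' t by have /andP[] := h'01 t.
have h'1 t : h' t <= 1 by have /andP[] := h'01 t.
have H := IH h' mh' h'0 h'1.
apply: le_trans (leeD (lee_wpmul2l half0 (mu_le_nu mA)) (lee_wpmul2l half0 H)) _.
have J0 : (0 <= \int[nu]_t (h' t)%:E)%E by apply: integral_ge0 => t tT; exact: i2.
have e1 : (0 <= eps%:E)%E by rewrite lee_fin.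
have e2 : (0 <= (eps + 2^-1 ^+ N)%:E)%E.
  by rewrite lee_fin addr_ge0// exprn_ge0// invr_ge0.
rewrite (ge0_muleDr _ (measure_ge0 nu A) e1) (ge0_muleDr _ J0 e2).
rewrite addeACA; apply: leeD; first exact: lexx.
rewrite -!EFinM -EFinD lee_fin exprS.
by lra.
Qed.

Lemma tv_bounded (h : R -> R) : measurable_fun setT h ->
  (forall t, 0 <= h t) -> (forall t, h t <= 1) ->
  (\int[mu]_t (h t)%:E <= \int[nu]_t (h t)%:E + eps%:E)%E.
Proof.
move=> mh h0 h1; apply/lee_addgt0Pr => e e0.
have [N HN] : exists N : nat, (2^-1 : R) ^+ N <= e.
  have [N _ HN] := near_infty_natSinv_expn_lt (PosNum e0).
  exists N; have := HN N (leqnn N) => /= /ltW.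
  by rewrite div1r exprVn.
apply: le_trans (tv_bounded_dyadic N mh h0 h1) _.
by rewrite EFinD addeA leeD2l// lee_fin.
Qed.

(** [D] is cut at level B T, where total variation applies. Where [D] exceeds this level, t^2 >= T,
    so that D <= B t^2 <= (B / T) t^4 is paid by the fourth moment. *)
Lemma tv_quadratic (B M4 T : R) (D : R -> R) : 0 <= B -> 0 < T -> 0 <= eps ->
  (\int[mu]_t (t ^+ 4)%:E <= M4%:E)%E ->
  measurable_fun setT D -> (forall t, 0 <= D t) -> (forall t, D t <= B * t ^+ 2) ->
  (\int[mu]_t (D t)%:E <= \int[nu]_t (D t)%:E + (B * (T * eps + M4 / T))%:E)%E.
Proof.
move=> B0 T0 eps0 HM mD D0 DB.
have [B00|Bn0] := eqVneq B 0.
  have DE t : D t = 0.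
    by apply/eqP; rewrite eq_le D0 andbT (le_trans (DB t))// B00 mul0r.
  rewrite B00 mul0r adde0.
  by rewrite !integral0_eq// => t _; rewrite DE.
have Bp : 0 < B by rewrite lt_neqAle eq_sym Bn0.
have BT : 0 < B * T by rewrite mulr_gt0.
pose h t := Num.min (D t / (B * T)) 1.
have mh : measurable_fun setT h.
  by apply: measurable_minr => //; exact: measurable_funM.
have h0 t : 0 <= h t.
  by rewrite /h le_min ler01 andbT mulr_ge0// invr_ge0 ltW.
have h1 t : h t <= 1 by rewrite /h ge_min lexx orbT.
have hD t : B * T * h t <= D t.
  by rewrite mulrC -ler_pdivlMr// /h ge_min lexx.
have Dh t : D t <= B * T * h t + B / T * t ^+ 4.
  rewrite /h; case: (leP (D t / (B * T)) 1) => H.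
    rewrite [B * T * _]mulrC divfK ?gt_eqF// lerDl mulr_ge0//.
      by rewrite mulr_ge0// invr_ge0 ltW.
    by rewrite exprn_even_ge0.
  apply: (@le_trans _ _ (B / T * t ^+ 4)); last by rewrite lerDr mulr1 ltW.
  have t2 : T <= t ^+ 2.
    rewrite -(ler_pM2l Bp); apply: le_trans (DB t).
    by move: H; rewrite ltr_pdivlMr// mul1r => /ltW.
  apply: (le_trans (DB t)).
  rewrite -mulrA ler_pM2l// mulrC ler_pdivlMr// (_ : t ^+ 4 = t ^+ 2 * t ^+ 2); last by ring.
  by rewrite ler_wpM2l// sqr_ge0.
have mhE : measurable_fun setT (fun t => (h t)%:E) by exact/measurable_EFinP.
have hE0 (t : R) : setT t -> (0 <= (h t)%:E)%E by rewrite lee_fin.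
have m4 := @measurable_exprE R 4.
have p4 (t : R) : setT t -> (0 <= (t ^+ 4)%:E :> \bar R)%E.
  by move=> _; rewrite lee_fin exprn_even_ge0.
have BT0 : (0 <= (B * T)%:E)%E by rewrite lee_fin ltW.
have BT0' : (0 <= (B / T)%:E)%E by rewrite lee_fin mulr_ge0// invr_ge0 ltW.
apply: (@le_trans _ _ (\int[mu]_t ((B * T)%:E * (h t)%:E + (B / T)%:E * (t ^+ 4)%:E))%E).
  apply: ge0_le_integral; first exact: measurableT.
  - by move=> t _; rewrite lee_fin.
  - exact/measurable_EFinP.
  - by apply: emeasurable_funD; exact: measurable_funeM.
  - by move=> t _; rewrite -!EFinM -EFinD lee_fin.
rewrite ge0_integralD; first last.
- exact: measurable_funeM.
- by move=> t tT; rewrite mule_ge0// p4.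
- exact: measurable_funeM.
- by move=> t tT; rewrite mule_ge0// hE0.
- exact: measurableT.
rewrite (ge0_integralZl _ measurableT mhE hE0 BT0).
rewrite (ge0_integralZl _ measurableT m4 p4 BT0').
apply: le_trans (leeD (lee_wpmul2l BT0 (tv_bounded mh h0 h1)) (lee_wpmul2l BT0' HM)) _.
rewrite ge0_muleDr ?lee_fin//; last by apply: integral_ge0 => t tT; exact: hE0.
rewrite -(ge0_integralZl _ measurableT mhE hE0 BT0) -addeA; apply: leeD.
  apply: ge0_le_integral; first exact: measurableT.
  - by move=> t tT; rewrite mule_ge0// hE0.
  - exact: measurable_funeM.
  - exact/measurable_EFinP.
  - by move=> t _; rewrite -EFinM lee_fin.
rewrite -!EFinM -EFinD lee_fin.
have -> : B * (T * eps + M4 / T) = B * T * eps + B / T * M4 by ring.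
exact: lexx.
Qed.

End bounded_test_functions.

Section smooth_abs.
Context {R : realType}.
Variable delta : R.
Hypothesis delta0 : 0 < delta.

Definition sabs (s : R) : R := Num.sqrt (s ^+ 2 + delta ^+ 2).

Let arg_ge0 s : 0 <= s ^+ 2 + delta ^+ 2.
Proof. by rewrite addr_ge0// sqr_ge0. Qed.

Lemma sabs_sqr s : sabs s ^+ 2 = s ^+ 2 + delta ^+ 2.
Proof. by rewrite sqr_sqrtr. Qed.

Lemma sabs_ge0 s : 0 <= sabs s. Proof. exact: sqrtr_ge0. Qed.

Lemma sabs_ge_delta s : delta <= sabs s.
Proof.
rewrite -ler_sqr ?nnegrE ?sabs_ge0 ?(ltW delta0)// sabs_sqr.
by rewrite lerDr sqr_ge0.
Qed.

Lemma sabs_ge_norm s : `|s| <= sabs s.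
Proof.
rewrite -ler_sqr ?nnegrE ?sabs_ge0// sabs_sqr real_normK ?num_real//.
by rewrite lerDl sqr_ge0.
Qed.

Lemma sabs_le_norm s : sabs s <= `|s| + delta.
Proof.
have d0 := ltW delta0.
rewrite -ler_sqr ?nnegrE ?sabs_ge0 ?addr_ge0// sabs_sqr.
rewrite -(real_normK (num_real s)).
by have := normr_ge0 s; nra.
Qed.

(** Concavity of the square root at [s ^+ 2 + delta ^+ 2]. *)
Let sabs_tangent s h : sabs (s + h) <= sabs s + (2 * s * h + h ^+ 2) / (2 * sabs s).
Proof.
have p0 : 0 < sabs s by exact: lt_le_trans (sabs_ge_delta s).
set p := sabs s in p0 *.
rewrite -(ler_pM2r p0) mulrDl.
have -> : (2 * s * h + h ^+ 2) / (2 * p) * p = (2 * s * h + h ^+ 2) / 2.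
  by field; rewrite gt_eqF.
have p2 : p * p = s ^+ 2 + delta ^+ 2 by rewrite -expr2 sabs_sqr.
have q2 : sabs (s + h) * sabs (s + h) = (s + h) ^+ 2 + delta ^+ 2.
  by rewrite -expr2 sabs_sqr.
have := sqr_ge0 (sabs (s + h) - p).
by nra.
Qed.

Lemma sabs_diff2_le s h : sabs (s + h) + sabs (s - h) - 2 * sabs s <= h ^+ 2 / delta.
Proof.
have p0 : 0 < sabs s by exact: lt_le_trans (sabs_ge_delta s).
have := sabs_tangent s h; have := sabs_tangent s (- h).
have H : h ^+ 2 / sabs s <= h ^+ 2 / delta.
  by rewrite ler_wpM2l ?sqr_ge0// lef_pV2 ?posrE// sabs_ge_delta.
have -> : (2 * s * - h + (- h) ^+ 2) / (2 * sabs s) =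
    h ^+ 2 / sabs s - (2 * s * h + h ^+ 2) / (2 * sabs s).
  by field; rewrite gt_eqF.
by lra.
Qed.

Lemma sabs_diff2_ge0 s h : 0 <= sabs (s + h) + sabs (s - h) - 2 * sabs s.
Proof.
rewrite subr_ge0 -ler_sqr ?nnegrE ?addr_ge0 ?mulr_ge0 ?sabs_ge0//.
(* Cauchy-Schwarz for the planar vectors (s + h, delta) and (s - h, delta). *)
have H : s ^+ 2 - h ^+ 2 + delta ^+ 2 <= sabs (s + h) * sabs (s - h).
  apply: le_trans (ler_norm _) _.
  rewrite -ler_sqr ?nnegrE ?mulr_ge0 ?sabs_ge0// exprMn !sabs_sqr.
  rewrite real_normK ?num_real//.
  by have := sqr_ge0 (delta * h); nra.
have q1 := sabs_sqr (s + h); have q2 := sabs_sqr (s - h); have q3 := sabs_sqr s.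
by nra.
Qed.

Lemma measurable_sabs : measurable_fun setT sabs.
Proof.
apply: (measurableT_comp (continuous_measurable_fun (@sqrt_continuous R))) => //.
by apply: measurable_funD => //; exact: exprn_measurable.
Qed.

End smooth_abs.

Lemma gauss_symmetric {R : realType} (B : set R) :
  measurable B -> (@gauss R) [set - t | t in B] = gauss B.
Proof.
move=> mB.
have mI (A : set R) : measurable A -> measurable_fun setT (fun t : R => (\1_A t)%:E : \bar R).
  by move=> mA; apply/measurable_EFinP; exact: measurable_indic.
have E (A : set R) : measurable A -> gauss A = (\int[gauss]_t (\1_A t)%:E)%E.
  by move=> mA; rewrite integral_indic// setIT.
have NE : [set - t | t in B] = -%R @^-1` B.
  apply/seteqP; split => [_ [t Bt <-]|t /= Bt] /=; first by rewrite opprK.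
  by exists (- t) => //; rewrite opprK.
have mNB : measurable [set - t | t in B].
  by rewrite NE; apply: measurable_preimage => //; exact: measurable_funN.
rewrite (E _ mB) (E _ mNB).
rewrite -(@ge0_integral_gaussN R (fun t => (\1_B t)%:E) (mI _ mB)) => [|t]; last by rewrite lee_fin.
apply: eq_integral => t _; congr (_%:E); rewrite !indicE NE; congr (_%:R).
Qed.

Lemma gauss_moment4 {R : realType} :
  exists2 M : R, 0 < M & (\int[@gauss R]_t (t ^+ 4)%:E <= M%:E)%E.
Proof.
exists (24 * (expR (2^-1) + expR (2^-1))).
  by rewrite mulr_gt0// addr_gt0// expR_gt0.
have me (s : R) : measurable_fun setT (fun t : R => (expR (s * t))%:E).
  apply/measurable_EFinP; apply: (measurableT_comp (@measurable_expR R)).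
  exact: measurable_funM.
have e0 (s t : R) : setT t -> (0 <= (expR (s * t))%:E)%E by rewrite lee_fin expR_ge0.
have E24 : (0 <= (24 : R)%:E)%E by rewrite lee_fin.
apply: (@le_trans _ _ (\int[gauss]_t (24%:E * ((expR (1 * t))%:E + (expR (-1 * t))%:E)))%E).
  apply: ge0_le_integral; first exact: measurableT.
  - by move=> t _; rewrite lee_fin exprn_even_ge0.
  - exact: measurable_exprE.
  - by apply: measurable_funeM; exact: emeasurable_funD.
  move=> t _; rewrite -EFinD -EFinM lee_fin mul1r mulN1r.
  have H (s : R) : 0 <= s -> s ^+ 4 <= 24 * (expR s + expR (- s)).
    move=> s0; have := expR_ge_exprn_fact 4 s0; have := expR_gt0 (- s).
    rewrite ler_pdivrMr; last by rewrite ltr0n fact_gt0.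
    have -> : 4`!%:R = 24 :> R by [].
    by lra.
  have [t0|t0] := leP 0 t; first exact: H.
  have := H (- t); rewrite opprK (_ : (- t) ^+ 4 = t ^+ 4); last by ring.
  by rewrite [expR (- t) + _]addrC; apply; rewrite oppr_ge0 ltW.
rewrite (ge0_integralZl _ measurableT _ _ E24); last 2 first.
- by apply: emeasurable_funD; exact: me.
- by move=> t tT; apply: adde_ge0; exact: e0.
rewrite (ge0_integralD _ measurableT (e0 1) (me 1) (e0 (-1)) (me (-1))).
rewrite !gauss_mgf -EFinD -EFinM lee_fin.
by rewrite sqrrN expr1n div1r.
Qed.

Definition gauss_abs {R : realType} : R := fine (\int[@gauss R]_t `|t|%:E)%E.

Lemma measurable_abse {R : realType} : measurable_fun setT (fun t : R => `|t|%:E).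
Proof. by apply/measurable_EFinP; exact: normr_measurable. Qed.

Lemma gauss_absE {R : realType} : (\int[@gauss R]_t `|t|%:E = gauss_abs%:E)%E.
Proof.
rewrite /gauss_abs fineK// ge0_fin_numE; last by apply: integral_ge0 => t _; rewrite lee_fin.
have [M M0 HM] := @gauss_moment4 R.
apply: (@le_lt_trans _ _ (\int[gauss]_t (t ^+ 4 + 1)%:E)%E).
  apply: ge0_le_integral; first exact: measurableT.
  - by move=> t _; rewrite lee_fin.
  - exact: measurable_abse.
  - apply/measurable_EFinP; apply: measurable_funD => //; exact: exprn_measurable.
  move=> t _; rewrite lee_fin (_ : t ^+ 4 = `|t| ^+ 4); last first.
    by rewrite -normrX ger0_norm// exprn_even_ge0.
  have n0 := normr_ge0 t; have [t1|t1] := leP `|t| 1.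
    by rewrite ler_wpDl// exprn_ge0.
  by rewrite ler_wpDr// ler_eXnr// ltW.
under eq_integral do rewrite EFinD.
rewrite integralD_cst//; last 2 first.
- exact: measurable_exprE.
- by move=> t; rewrite lee_fin exprn_even_ge0.
by apply: le_lt_trans (leeD2r _ HM) _; rewrite -EFinD ltry.
Qed.

Lemma gauss_abs_gt0 {R : realType} : 0 < @gauss_abs R.
Proof.
rewrite -lte_fin -gauss_absE.
have [c c0 tail] := @gauss_tail R.
have := tail 1 ler01; set A := [set t | _] => tA.
apply: (@lt_le_trans _ _ (gauss A)).
  by apply: lt_le_trans tA; rewrite lte_fin mulr_gt0// expR_gt0.
have mA : measurable A.
  rewrite (_ : A = Num.norm @^-1` `[1, +oo[).
    by apply: measurable_preimage => //; exact: normr_measurable.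
  by apply/seteqP; split => x /=; rewrite /A /= in_itv/= andbT.
have -> : gauss A = (\int[gauss]_t (\1_A t)%:E)%E by rewrite integral_indic// setIT.
apply: ge0_le_integral; first exact: measurableT.
- by move=> t _; rewrite lee_fin.
- by apply/measurable_EFinP; exact: measurable_indic.
- exact: measurable_abse.
- move=> t _; rewrite lee_fin indicE.
  have [tinA|_] := boolP (t \in A); last exact: normr_ge0.
  by move: tinA; rewrite inE.
Qed.

(** * Lindeberg replacement for the smoothed absolute value *)

Section lindeberg.
Context {R : realType}.
Variables (mu nu : probability R R) (eps M4 T delta : R).
Hypothesis symmu : forall B : set R, measurable B -> mu [set - t | t in B] = mu B.
Hypothesis symnu : forall B : set R, measurable B -> nu [set - t | t in B] = nu B.
Hypothesis mu_le_nu : forall A : set R, measurable A -> (mu A <= nu A + eps%:E)%E.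
Hypothesis eps0 : 0 <= eps.
Hypothesis T0 : 0 < T.
Hypothesis delta0 : 0 < delta.
Hypothesis moment4 : (\int[mu]_t (t ^+ 4)%:E <= M4%:E)%E.

Let M40 : 0 <= M4.
Proof.
rewrite -lee_fin; apply: le_trans moment4; apply: integral_ge0 => t _.
by rewrite lee_fin exprn_even_ge0.
Qed.

Let cost := (T * eps + M4 / T) / (2 * delta).

Let second_diff (e u t : R) : R :=
  sabs delta (e + u * t) + sabs delta (e - u * t) - 2 * sabs delta e.

(** Symmetry of the law cancels the first-order term and leaves a second difference, which is
    quadratic in [u * t]. This is why the cost of a coordinate is proportional to [u ^+ 2]. *)
Let sym_split (P : probability R R) :
  (forall B : set R, measurable B -> P [set - t | t in B] = P B) ->
  forall e u, (\int[P]_t (sabs delta (e + u * t))%:E =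
    (2^-1)%:E * \int[P]_t (second_diff e u t)%:E + (sabs delta e)%:E)%E.
Proof.
move=> symP e u.
have half0 : (0 <= (2^-1)%:E :> \bar R)%E by rewrite lee_fin invr_ge0.
have ms (k : R) : measurable_fun setT (fun t : R => (sabs delta (e + k * t))%:E).
  apply/measurable_EFinP; apply: (measurableT_comp (measurable_sabs delta)).
  by apply: measurable_funD => //; exact: measurable_funM.
have s0 (k t : R) : setT t -> (0 <= (sabs delta (e + k * t))%:E)%E.
  by rewrite lee_fin sabs_ge0.
have md : measurable_fun setT (fun t : R => (second_diff e u t)%:E).
  apply/measurable_EFinP; apply: measurable_funB => //; apply: measurable_funD.
    by apply/measurable_EFinP; exact: (ms u).
  by apply/measurable_EFinP; apply: eq_measurable_fun (ms (- u)) => t _ /=; rewrite mulNr.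
have d0 (t : R) : setT t -> (0 <= (second_diff e u t)%:E)%E.
  by move=> _; rewrite lee_fin; exact: sabs_diff2_ge0.
rewrite -(ge0_integralZl _ measurableT md d0 half0) -integralD_cst; last 3 first.
- exact: measurable_funeM.
- by move=> t; rewrite mule_ge0// d0.
- exact: sabs_ge0.
have H : (\int[P]_t (sabs delta (e + - u * t))%:E = \int[P]_t (sabs delta (e + u * t))%:E)%E.
  rewrite -(@integral_symmetric _ P symP (fun t => (sabs delta (e + u * t))%:E) (ms u) (fun t => s0 u t I)).
  by apply: eq_integral => t _; rewrite mulrN mulNr.
transitivity (\int[P]_t ((2^-1)%:E * (sabs delta (e + u * t))%:E +
    (2^-1)%:E * (sabs delta (e + - u * t))%:E))%E.
  rewrite ge0_integralD; first last.
  - exact: measurable_funeM.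
  - by move=> t tT; rewrite mule_ge0// s0.
  - exact: measurable_funeM.
  - by move=> t tT; rewrite mule_ge0// s0.
  - exact: measurableT.
  rewrite (ge0_integralZl _ measurableT (ms u) (s0 u) half0).
  rewrite (ge0_integralZl _ measurableT (ms (- u)) (s0 (- u)) half0) H.
  rewrite -(ge0_muleDl _ half0 half0) -EFinD.
  have -> : 2^-1 + 2^-1 = 1 :> R by field.
  by rewrite mul1e.
apply: eq_integral => t _; rewrite -!EFinM -!EFinD /second_diff mulNr; congr (_%:E).
by field.
Qed.

Lemma lindeberg_step (e u : R) :
  (\int[mu]_t (sabs delta (e + u * t))%:E <=
   \int[nu]_t (sabs delta (e + u * t))%:E + (cost * u ^+ 2)%:E)%E.
Proof.
rewrite (sym_split symmu) (sym_split symnu).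
have half0 : (0 <= (2^-1)%:E :> \bar R)%E by rewrite lee_fin invr_ge0.
have mD : measurable_fun setT (second_diff e u).
  apply: measurable_funB => //; apply: measurable_funD;
    apply: (measurableT_comp (measurable_sabs delta)).
    by apply: measurable_funD => //; exact: measurable_funM.
  by apply: measurable_funB => //; exact: measurable_funM.
have D0 t : 0 <= second_diff e u t by exact: sabs_diff2_ge0.
have DB t : second_diff e u t <= u ^+ 2 / delta * t ^+ 2.
  apply: le_trans (sabs_diff2_le delta0 e (u * t)) _.
  by rewrite exprMn mulrAC.
have B0 : 0 <= u ^+ 2 / delta by rewrite mulr_ge0 ?sqr_ge0// invr_ge0 ltW.
have J0 : (0 <= \int[nu]_t (second_diff e u t)%:E)%E.
  by apply: integral_ge0 => t _; rewrite lee_fin.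
have C0 : (0 <= (u ^+ 2 / delta * (T * eps + M4 / T))%:E)%E.
  by rewrite lee_fin mulr_ge0// addr_ge0// mulr_ge0// ?invr_ge0 ltW.
have := tv_quadratic mu_le_nu B0 T0 eps0 moment4 mD D0 DB.
move=> /(lee_wpmul2l half0); rewrite (ge0_muleDr _ J0 C0).
rewrite -EFinM => H; rewrite addeAC; apply: leeD => //.
apply: le_trans H _; apply: leeD => //.
rewrite lee_fin /cost.
have -> : 2^-1 * (u ^+ 2 / delta * (T * eps + M4 / T)) =
   (T * eps + M4 / T) / (2 * delta) * u ^+ 2.
  by field; rewrite !gt_eqF.
exact: lexx.
Qed.

(** Smoothing is paid only once, on the [nu] side, because [sabs] lies above the absolute value and
    within [delta] of it. *)
Lemma lindeberg n (u : nat -> R) :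
  (\int[iidn mu n]_v `|lin u v|%:E <=
   \int[iidn nu n]_v `|lin u v|%:E + (delta + cost * \sum_(j < n) u j ^+ 2)%:E)%E.
Proof.
pose Psi (c : unit -> R) := sabs delta (c tt).
have mPsi : measurable_functional Psi.
  by move=> d D Z mZ; exact: (measurableT_comp (measurable_sabs delta)).
have Psi0 c : 0 <= Psi c by exact: sabs_ge0.
have mlE : measurable_fun setT (fun v : pow R n => `|lin u v|%:E).
  by apply/measurable_EFinP; apply: measurableT_comp => //; exact: measurable_lin.
have mP : measurable_fun setT (fun v : pow R n => (Psi (fun i => 0 + psum (fun j _ t => u j * t) v i))%:E).
  apply/measurable_EFinP; apply: mPsi => i; apply: measurable_funD => //.
  by apply: measurable_psum => j; exact: measurable_funM.
have cost0 : 0 <= cost.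
  by rewrite mulr_ge0 ?invr_ge0 ?mulr_ge0 ?(ltW delta0)// addr_ge0// mulr_ge0// ?invr_ge0 ltW.
have := @psum_le R _ _ R R unit Psi mPsi Psi0 n (fun=> mu) (fun=> nu)
  (fun j _ t => u j * t) (fun j _ t => u j * t) (fun j => cost * u j ^+ 2) (fun=> 0)
  (fun j i => measurable_funM (measurable_cst (u j)) (@measurable_id _ _ setT))
  (fun j i => measurable_funM (measurable_cst (u j)) (@measurable_id _ _ setT))
  (fun j => mulr_ge0 cost0 (sqr_ge0 _)) (fun j e => lindeberg_step (e tt) (u j)).
rewrite -mulr_sumr => H.
apply: (@le_trans _ _ (\int[iidn mu n]_v (Psi (fun i => 0 + psum (fun j _ t => u j * t) v i))%:E)%E).
  apply: ge0_le_integral; first exact: measurableT.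
  - by move=> v _; rewrite lee_fin.
  - exact: mlE.
  - exact: mP.
  - by move=> v _; rewrite lee_fin /Psi add0r; exact: sabs_ge_norm.
apply: (le_trans H); rewrite EFinD addeA; apply: leeD; last exact: lexx.
rewrite -integralD_cst//; last exact: ltW.
apply: ge0_le_integral; first exact: measurableT.
- by move=> v _; rewrite lee_fin.
- exact: mP.
- exact: emeasurable_funD.
- by move=> v _; rewrite -EFinD lee_fin /Psi add0r; exact: sabs_le_norm.
Qed.

End lindeberg.

Lemma gaussn_norm_lin {R : realType} n (u : nat -> R) :
  (\int[gaussn n]_v `|lin u v|%:E = (nrm n u * gauss_abs)%:E)%E.
Proof.
have a0 (x : R) : (0 <= `|x|%:E)%E by rewrite lee_fin.
have n0 : (0 <= (nrm n u)%:E)%E by rewrite lee_fin sqrtr_ge0.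
transitivity (\int[gaussn n]_v `|0 + lin u v|%:E)%E.
  by apply: eq_integral => v _; rewrite add0r.
rewrite (@gauss_lin R n u 0 _ measurable_abse a0).
transitivity (\int[gauss]_t ((nrm n u)%:E * `|t|%:E))%E.
  by apply: eq_integral => t _; rewrite add0r normrM ger0_norm ?sqrtr_ge0// EFinM.
by rewrite (ge0_integralZl _ measurableT measurable_abse (fun x _ => a0 x) n0) gauss_absE.
Qed.

(** * From an approximate norm to its subgradient *)

Section bias.
Context {R : realType}.

Definition mean_lin (mu : probability R R) n (x u : nat -> R) : R :=
  fine (\int[iidn mu n]_v (sgn (lin x v) * lin u v)%:E).

Section mean_lin.
Variable mu : probability R R.
Hypothesis varmu : (\int[mu]_t (t ^+ 2)%:E = 1%:E)%E.

Lemma integrable_lin n (u : nat -> R) :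
  (iidn mu n).-integrable setT (EFin \o lin u).
Proof.
apply/integrableP; split.
  by apply/measurable_EFinP; exact: measurable_lin.
exact: le_lt_trans (integral_norm_lin varmu n u) (ltry _).
Qed.

Lemma integrable_sgn_lin n (x u : nat -> R) :
  (iidn mu n).-integrable setT (EFin \o (fun v => sgn (lin x v) * lin u v)).
Proof.
have ms : measurable_fun setT (fun v : pow R n => sgn (lin x v) * lin u v).
  apply: measurable_funM; last exact: measurable_lin.
  exact: (measurableT_comp measurable_sgn (measurable_lin x)).
apply/integrableP; split; first exact/measurable_EFinP.
under eq_integral => v _ do rewrite /= normrM normr_sgn mul1r.
exact: le_lt_trans (integral_norm_lin varmu n u) (ltry _).
Qed.

Lemma sgn_mulr (t : R) : sgn t * t = `|t|.
Proof. by rewrite /sgn; case: ger0P => _; rewrite ?mul1r ?mulN1r. Qed.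

(* [mean_lin mu n x] is a subgradient at [x] of [u |-> E|<a, u>|]. *)
Lemma mean_lin_subgradient n (x u : nat -> R) (t : R) :
  ((mean_lin mu n x (fun j => x j + t * u j)%R)%:E <=
   \int[iidn mu n]_v `|lin (fun j => x j + t * u j)%R v|%:E)%E.
Proof.
rewrite /mean_lin fineK; last first.
  exact: (integrable_fin_num measurableT (integrable_sgn_lin _ _ _)).
apply: le_integral => //.
- exact: integrable_sgn_lin.
- have := integrable_abse (integrable_lin n (fun j => x j + t * u j)).
  by apply: eq_integrable => // v _.
- move=> v _; rewrite lee_fin; apply: le_trans (ler_norm _) _.
  by rewrite normrM normr_sgn mul1r.
Qed.

Lemma mean_lin_diag n (x : nat -> R) :
  ((mean_lin mu n x x)%:E = \int[iidn mu n]_v `|lin x v|%:E)%E.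
Proof.
rewrite /mean_lin fineK; last first.
  exact: (integrable_fin_num measurableT (integrable_sgn_lin _ _ _)).
by apply: eq_integral => v _; rewrite sgn_mulr.
Qed.

Lemma mean_lin_affine n (x y u : nat -> R) (t : R) :
  mean_lin mu n x (fun j => y j + t * u j) = mean_lin mu n x y + t * mean_lin mu n x u.
Proof.
have iy := integrable_sgn_lin n x y; have iu := integrable_sgn_lin n x u.
have itu := integrableZl measurableT t iu.
have E : (\int[iidn mu n]_v (sgn (lin x v) * lin (fun j => y j + t * u j)%R v)%:E =
   \int[iidn mu n]_v (sgn (lin x v) * lin y v)%:E +
   t%:E * \int[iidn mu n]_v (sgn (lin x v) * lin u v)%:E)%E.
  rewrite -(integralZl measurableT iu) -(integralD measurableT iy itu).
  apply: eq_integral => v _ /=; rewrite -EFinM -EFinD.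
  by rewrite lin_add lin_scale mulrDr [_ * (t * _)]mulrCA.
have yE := fineK (integrable_fin_num measurableT iy).
have uE := fineK (integrable_fin_num measurableT iu).
rewrite /mean_lin E -[X in fine (X + _)%E]yE -[X in fine (_ + _ * X)%E]uE.
by [].
Qed.

End mean_lin.

Lemma nrm_sqr n (u : nat -> R) : nrm n u ^+ 2 = \sum_(j < n) u j ^+ 2.
Proof. by rewrite sqr_sqrtr//; apply: sumr_ge0 => j _; exact: sqr_ge0. Qed.

(* With [N u = E|<a, u>|], the subgradient inequality at [x] reads
   [t * mean_lin x u <= N (x + t u) - N x], and [N] is within the Lindeberg
   error of [gauss_abs] times the Euclidean norm; the smoothing, truncation and
   step parameters are then chosen as powers of [r]. *)
Lemma mean_lin_bias : exists2 C : R, 0 < C &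
  forall (mu : probability R R) (kappa eps r : R) (n : nat) (x u : nat -> R),
  (forall B : set R, measurable B -> mu [set - t | t in B] = mu B) ->
  (\int[mu]_t (t ^+ 2)%:E = 1%:E)%E ->
  subg_norm mu = kappa%:E ->
  (tv_dist mu (normal_prob 0 1) <= eps%:E)%E ->
  0 < r -> eps <= r ^+ 8 -> Num.sqrt kappa * r <= 1 ->
  \sum_(j < n) x j ^+ 2 = 1 -> \sum_(j < n) u j ^+ 2 <= 4 ->
  mean_lin mu n x u <= gauss_abs * (\sum_(j < n) x j * u j) + C * (Num.sqrt kappa * r).
Proof.
have [Mg Mg0 HMg] := @gauss_moment4 R.
(* In [Cm], 16 is the factor of the sub-gaussian fourth moment, and 4 turns [Mg] into a multiple of
   [kappa ^+ 4]. In [Ce] below, 1 accounts for [delta] and 5 for half the bound 10 on the squared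
   norms involved. *)
pose Cm : R := 16 + 4 * Mg.
have Cm0 : 0 < Cm by rewrite addr_gt0// mulr_gt0.
pose Ce : R := 1 + 5 * (1 + Cm).
have Ce0 : 0 < Ce by rewrite addr_gt0// mulr_gt0// addr_gt0.
pose lam : R := gauss_abs.
have lam0 : 0 < lam by exact: gauss_abs_gt0.
exists (2 * lam + 2 * Ce); first by rewrite addr_gt0// mulr_gt0.
move=> mu kappa eps r n x u symmu varmu subgmu tv r0 epsr kr1 x1 u4.
have kappa0 := subg_norm_gt0 varmu subgmu.
have kappa2 := subg_norm_sqr_ge varmu subgmu.
have tvA (A : set R) : measurable A -> (`|mu A - gauss A| <= eps%:E)%E.
  by move=> mA; apply: le_trans tv; apply: ereal_sup_ubound; exists A.
have fmu (A : set R) : measurable A -> mu A \is a fin_num.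
  by move=> mA; apply: fin_num_measure.
have fga (A : set R) : measurable A -> (gauss A : \bar R) \is a fin_num.
  by move=> mA; apply: (fin_num_measure (@gauss R)).
have eps0 : 0 <= eps.
  by rewrite -lee_fin; apply: le_trans (tvA _ measurableT); exact: abse_ge0.
have H1 (A : set R) : measurable A -> (mu A <= gauss A + eps%:E)%E.
  move=> mA; rewrite -leeBlDl ?fga//.
  exact: le_trans (lee_abs _) (tvA _ mA).
have H2 (A : set R) : measurable A -> (gauss A <= mu A + eps%:E)%E.
  move=> mA; have := tvA A mA.
  rewrite -(fineK (fmu _ mA)) -(fineK (fga _ mA)) -EFinB -EFinD !lee_fin distrC.
  by move=> /(le_trans (ler_norm _)); rewrite lerBlDl.
(* These choices make [T * eps] and [M4 / T] both of order kappa^2 r^4, hence [cost] and [delta]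
   both of order kappa r^2. *)
pose T := kappa ^+ 2 / r ^+ 4.
pose delta := kappa * r ^+ 2.
pose M4 := Cm * kappa ^+ 4.
have T0 : 0 < T by rewrite divr_gt0// exprn_gt0.
have delta0 : 0 < delta by rewrite mulr_gt0// exprn_gt0.
have k4 : 1 <= 4 * kappa ^+ 4.
  have -> : 4 * kappa ^+ 4 = (2 * kappa ^+ 2) * (2 * kappa ^+ 2) by ring.
  by rewrite -[X in X <= _](mulr1 1) ler_pM.
have mom1 : (\int[mu]_t (t ^+ 4)%:E <= M4%:E)%E.
  have := @subg_even_moment _ mu kappa subgmu 2 isT.
  rewrite -[2.*2]/4%N => /le_trans; apply.
  rewrite lee_fin /M4 /Cm /=.
  have : 0 <= Mg * kappa ^+ 4 by rewrite mulr_ge0 ?exprn_ge0// ltW.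
  by nra.
have mom2 : (\int[gauss]_t (t ^+ 4)%:E <= M4%:E)%E.
  apply: le_trans HMg _; rewrite lee_fin /M4 /Cm.
  have : 0 <= kappa ^+ 4 by rewrite exprn_ge0// ltW.
  by nra.
pose cost := (T * eps + M4 / T) / (2 * delta).
have costE : cost <= kappa * r ^+ 2 * (1 + Cm) / 2.
  have Te : T * eps <= kappa ^+ 2 * r ^+ 4.
    apply: le_trans (ler_wpM2l (ltW T0) epsr) _.
    rewrite /T (_ : kappa ^+ 2 / r ^+ 4 * r ^+ 8 = kappa ^+ 2 * r ^+ 4)//.
    by field; rewrite gt_eqF.
  have MT : M4 / T = Cm * (kappa ^+ 2 * r ^+ 4).
    by rewrite /M4 /T; field; rewrite !gt_eqF.
  rewrite /cost MT ler_pdivrMr; last by rewrite mulr_gt0.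
  have -> : kappa * r ^+ 2 * (1 + Cm) / 2 * (2 * delta) =
      (1 + Cm) * (kappa ^+ 2 * r ^+ 4) by rewrite /delta; field.
  by lra.
have L1 (w : nat -> R) := lindeberg symmu (@gauss_symmetric R) H1 eps0 T0 delta0 mom1 n w.
have L2 (w : nat -> R) := lindeberg (@gauss_symmetric R) symmu H2 eps0 T0 delta0 mom2 n w.
have gE (w : nat -> R) : (\int[iidn [the probability R R of gauss] n]_v `|lin w v|%:E =
   (nrm n w * lam)%:E)%E by exact: gaussn_norm_lin.
pose eta := kappa * r ^+ 2 * Ce.
have etaE (w : nat -> R) : \sum_(j < n) w j ^+ 2 <= 10 ->
    delta + cost * (\sum_(j < n) w j ^+ 2) <= eta.
  move=> w10; have w0 : 0 <= \sum_(j < n) w j ^+ 2.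
    by apply: sumr_ge0 => j _; exact: sqr_ge0.
  have c0 : 0 <= kappa * r ^+ 2 * (1 + Cm) / 2.
    by rewrite !mulr_ge0 ?exprn_ge0 ?ltW// addr_gt0.
  have cost0 : 0 <= cost.
    have M40 : 0 <= M4 by rewrite /M4 mulr_ge0 ?exprn_ge0// ltW.
    apply: divr_ge0; last by rewrite mulr_ge0// ltW.
    by apply: addr_ge0; [exact: mulr_ge0 (ltW T0) eps0|exact: divr_ge0 M40 (ltW T0)].
  have := ler_pM cost0 w0 costE w10; rewrite /eta /Ce /delta; lra.
(* The step whose square has the order of the norm error [eta]: dividing [eta] by [s] and the
   second-order term by [s] both leave order [s]. *)
set s := Num.sqrt kappa * r in kr1 *.
have s0 : 0 < s by rewrite mulr_gt0// sqrtr_gt0.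
have s2 : s ^+ 2 = kappa * r ^+ 2 by rewrite exprMn sqr_sqrtr// ltW.
pose w := fun j => x j + s * u j.
have w2 : \sum_(j < n) w j ^+ 2 =
   1 + 2 * s * (\sum_(j < n) x j * u j) + s ^+ 2 * (\sum_(j < n) u j ^+ 2).
  transitivity (\sum_(j < n) x j ^+ 2 + 2 * s * (\sum_(j < n) x j * u j) +
      s ^+ 2 * (\sum_(j < n) u j ^+ 2)); last by rewrite x1.
  rewrite !mulr_sumr -!big_split /=; apply: eq_bigr => j _.
  by rewrite /w; ring.
set ip := \sum_(j < n) x j * u j in w2 *.
have s21 : s ^+ 2 <= 1 by rewrite expr_le1// ltW.
have u0 : 0 <= \sum_(j < n) u j ^+ 2 by apply: sumr_ge0 => j _; exact: sqr_ge0.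
have w10 : \sum_(j < n) w j ^+ 2 <= 10.
  apply: (@le_trans _ _ (\sum_(j < n) (2 * x j ^+ 2 + 2 * s ^+ 2 * u j ^+ 2))).
    apply: ler_sum => j _; rewrite /w.
    by have := sqr_ge0 (x j - s * u j); nra.
  rewrite big_split /= -!mulr_sumr x1.
  by have := sqr_ge0 s; nra.
have w0 : 0 <= \sum_(j < n) w j ^+ 2 by apply: sumr_ge0 => j _; exact: sqr_ge0.
(* sqrt (1 + v) <= 1 + v / 2 with v = 2 s ip + 4 s^2; the bound is nonnegative because 1 + v
   dominates a squared norm. *)
have nw : nrm n w <= 1 + s * ip + 2 * s ^+ 2.
  have y0 : 0 <= 1 + s * ip + 2 * s ^+ 2 by have := sqr_ge0 s; nra.
  rewrite -ler_sqr ?nnegrE ?sqrtr_ge0// nrm_sqr w2.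
  by have := sqr_ge0 (s * ip + 2 * s ^+ 2); have := sqr_ge0 s; nra.
have N1 : mean_lin mu n x w <= nrm n w * lam + eta.
  rewrite -lee_fin; apply: le_trans (mean_lin_subgradient varmu _ _ _ _) _.
  apply: le_trans (L1 w) _; rewrite gE -EFinD lee_fin lerD2l.
  exact: etaE.
have N2 : lam <= mean_lin mu n x x + eta.
  rewrite -lee_fin EFinD mean_lin_diag//.
  have := L2 x; rewrite gE {1}/nrm x1 sqrtr1 mul1r => H.
  have hx := etaE x; rewrite x1 in hx.
  apply: le_trans H _; rewrite leeD2l// lee_fin; apply: hx.
  by lra.
move: N1; rewrite mean_lin_affine// => N1.
have main : s * mean_lin mu n x u <= s * (lam * ip + (2 * lam + 2 * Ce) * s).
  have -> : s * (lam * ip + (2 * lam + 2 * Ce) * s) =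
     (1 + s * ip + 2 * s ^+ 2) * lam - lam + 2 * (s ^+ 2 * Ce) by ring.
  have := ler_wpM2r (ltW lam0) nw.
  rewrite s2 -/eta; lra.
by rewrite -(ler_pM2l s0).
Qed.

End bias.

(** * Recovery *)

Section basis.
Context {R : realType}.

Definition unit_vec (j k : nat) : R := (k == j)%:R.

Lemma sum_unit_vec n (u : nat -> R) (k : nat) : (k < n)%N ->
  u k = \sum_(j < n) u j * unit_vec j k.
Proof.
move=> kn; rewrite (bigD1 (Ordinal kn))//= /unit_vec eqxx mulr1 big1 ?addr0//.
move=> j /negbTE jk; rewrite (_ : (k == j) = false) ?mulr0//.
by apply/negbTE; apply: contraFN jk => /eqP kj; apply/eqP/val_inj.
Qed.

Lemma lin_coord n (u : nat -> R) (v : pow R n) :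
  lin u v = \sum_(j < n) u j * lin (unit_vec j) v.
Proof.
rewrite (@eq_lin R n u (fun k => \sum_(j < n) u j * unit_vec j k)); last first.
  by move=> k kn; exact: sum_unit_vec.
rewrite (lin_sum (fun (j : 'I_n) k => u j * unit_vec j k)).
by apply: eq_bigr => j _; rewrite lin_scale.
Qed.

Lemma lin_tup d (T : measurableType d) n (u : nat -> R) (X : nat -> T -> R) (w : T) :
  lin u (tup X n w) = \sum_(j < n) u j * X j w.
Proof.
elim: n u X => [|n IH] u X; first by rewrite big_ord0.
rewrite linS big_ord_recl /=; congr (_ + _).
exact: (IH (fun j => u j.+1) (fun j => X j.+1)).
Qed.

Lemma psum_tup d d' (T : measurableType d) (B : measurableType d') (I : Type) m
    (X : nat -> I -> B -> R) (Y : nat -> T -> B) (w : T) (i : I) :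
  psum X (tup Y m w) i = \sum_(l < m) X l i (Y l w).
Proof.
elim: m X Y => [|m IH] X Y; first by rewrite big_ord0.
rewrite big_ord_recl /=; congr (_ + _).
exact: (IH (fun j => X j.+1) (fun j => Y j.+1)).
Qed.

Variable mu : probability R R.
Hypothesis varmu : (\int[mu]_t (t ^+ 2)%:E = 1%:E)%E.

Lemma mean_lin_coord n (x u : nat -> R) :
  mean_lin mu n x u = \sum_(j < n) u j * mean_lin mu n x (unit_vec j).
Proof.
have E : mean_lin mu n x u = mean_lin mu n x (fun k => \sum_(j < n) u j * unit_vec j k).
  rewrite /mean_lin; congr fine; apply: eq_integral => v _.
  by rewrite (@eq_lin R n u (fun k => \sum_(j < n) u j * unit_vec j k))// => k; exact: sum_unit_vec.
rewrite E.
suff H k (c : nat -> R) (e : nat -> nat -> R) :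
    mean_lin mu n x (fun i => \sum_(j < k) c j * e j i) =
    \sum_(j < k) c j * mean_lin mu n x (e j) by rewrite (H n u unit_vec).
elim: k => [|k IH].
  have -> : (fun i => \sum_(j < 0) c j * e j i) = (fun=> 0 : R).
    by apply/funext => i; rewrite big_ord0.
  by rewrite big_ord0 /mean_lin integral0_eq// => v _; rewrite lin0 mulr0.
rewrite big_ord_recr /= -IH -mean_lin_affine//; congr mean_lin.
by apply/funext => i; rewrite big_ord_recr.
Qed.

Variable rE : probability R R.

Lemma mean_signedE n (x u : nat -> R) :
  mean_signed mu rE n x u = fine (\int[rE]_e (sgn e)%:E) * mean_lin mu n x u.
Proof.
have is_ := @integrable_signed_lin R mu rE varmu n x u.
have ie : rE.-integrable setT (fun e => (sgn e)%:E).
  apply/integrableP; split; first by apply/measurable_EFinP; exact: measurable_sgn.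
  under eq_integral => e _ do rewrite /= normr_sgn.
  by rewrite integral_prob_cst ltry.
have eE := fineK (integrable_fin_num measurableT ie).
have il := integrable_sgn_lin varmu n x u.
have lE := fineK (integrable_fin_num measurableT il).
rewrite /mean_signed /blockP -integral21_prod_meas1//.
rewrite /fubini_G /signed_lin /=.
under eq_integral => v _.
  under eq_integral do rewrite -mulrA EFinM muleC.
  rewrite (integralZl measurableT ie) -eE.
  over.
rewrite /=.
have -> : (\int[iidn mu n]_v ((sgn (lin x v) * lin u v)%:E * (fine (\int[rE]_e (sgn e)%:E))%:E) =
   (fine (\int[rE]_e (sgn e)%:E))%:E * \int[iidn mu n]_v (sgn (lin x v) * lin u v)%:E)%E.
  rewrite -(integralZl measurableT il).
  by apply: eq_integral => v _; rewrite muleC.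
by rewrite -[X in fine (_ * X)%E]lE.
Qed.

End basis.

Section two_point.
Context {R : realType}.
Variables (p : R) (r : probability R R).
Hypothesis r1 : r [set 1] = (1 - p)%:E.
Hypothesis rN1 : r [set -1] = p%:E.

Let S : set R := [set 1] `|` [set -1].

Let rS : r S = 1%E.
Proof.
have -> : r S = (r [set 1%R] + r [set (-1)%R])%E.
  apply: measureU => //; apply/seteqP; split => // t [/= -> /eqP].
  by rewrite -subr_eq0 opprK -[1 + 1]/(2%:R) pnatr_eq0.
by rewrite r1 rN1 -EFinD subrK.
Qed.

(** The two atoms exhaust the mass, so they determine the law; all noise variables therefore share
    one law. *)
Lemma two_point_law (B : set R) : measurable B ->
  (r B = ((1 - p) * \1_B (1 : R) + p * \1_B (-1 : R))%:E)%E.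
Proof.
move=> mB.
have mS : measurable S by apply: measurableU.
have rSC : r (B `\` S) = 0%E.
  apply/eqP; rewrite eq_le measure_ge0 andbT.
  apply: (@le_trans _ _ (r (~` S))).
    apply: le_measure; rewrite ?inE; [exact: measurableD|exact: measurableC|].
    by move=> t [].
  by rewrite probability_setC// rS subee.
have -> : r B = (r (B `&` [set 1%R]) + r (B `&` [set (-1)%R]))%E.
  have -> : r B = (r (B `&` S) + r (B `\` S))%E.
    rewrite -[in LHS](setUIDK B S); apply: measureU.
    - exact: measurableI.
    - exact: measurableD.
    - by apply/seteqP; split => // t [[_ ?] [_ ?]].
  rewrite rSC adde0 /S setIUr; apply: measureU.
  - by apply: measurableI.
  - by apply: measurableI.
  - apply/seteqP; split => // t [[_ /= ->] [_ /eqP]]; rewrite -subr_eq0 opprK.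
    by rewrite -[1 + 1]/(2%:R) pnatr_eq0.
have H (a q : R) : r [set a] = q%:E -> r (B `&` [set a]) = (q * \1_B a)%:E.
  move=> ra; rewrite indicE; have [aB|aB] := boolP (a \in B).
    rewrite mulr1 -ra; congr (r _); apply/seteqP; split => [t []//|t /= ->].
    by split => //; rewrite inE in aB.
  rewrite mulr0 (_ : B `&` [set a] = set0) ?measure0//.
  apply/seteqP; split => // t [Bt /= ta]; move: aB; rewrite notin_setE; apply.
  by rewrite -ta.
by rewrite (H _ _ r1) (H _ _ rN1) EFinD.
Qed.

Lemma two_point_mean : fine (\int[r]_e (sgn e)%:E) = 1 - 2 * p.
Proof.
pose A : set R := `[0, +oo[%classic.
have mA : measurable A by exact: measurable_itv.
have rA : r A = (1 - p)%:E.
  rewrite two_point_law// !indicE.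
  have -> : (1 : R) \in A by rewrite inE /A /= in_itv/= ler01.
  have -> : ((-1 : R) \in A) = false.
    by apply/negbTE; rewrite notin_setE /A /= in_itv/= andbT lerNr oppr0 ler10.
  by rewrite mulr1 mulr0 addr0.
have E : (\int[r]_e (sgn e)%:E = \int[r]_e (2%:E * (\1_A e)%:E - (cst 1 e)%:E))%E.
  apply: eq_integral => e _; rewrite indicE /sgn -EFinM -EFinB; congr (_%:E).
  have -> : (e \in A) = (0 <= e) by apply/idP/idP; rewrite inE /A /= in_itv/= andbT.
 
  by case: (0 <= e); rewrite /= ?mulr1 ?mulr0; lra.
have iA : r.-integrable setT (EFin \o \1_A) by exact: integrable_indic.
have iA2 := integrableZl measurableT 2 iA.
have i1 := finite_measure_integrable_cst r 1 measurableT.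
rewrite E (integralB measurableT iA2 i1) (integralZl measurableT iA).
have -> : (\int[r]_e (\1_A e)%:E = (1 - p)%:E)%E.
  by rewrite -rA; rewrite integral_indic// setIT.
rewrite (integral_prob_cst r 1%:E) /=; lra.
Qed.

End two_point.

Section draws.
Variable I : finType.

Lemma mem_undrawn (ks : nat -> I) n (J : {set I}) k :
  (forall j, (j < n)%N -> k != ks j) -> k \in J -> k \in undrawn ks n J.
Proof.
elim: n ks J => [//|n IH] ks J kn kJ /=.
apply: IH => [j jn|]; first exact: (kn j.+1).
by rewrite in_setD1 kJ andbT; exact: (kn 0%N).
Qed.

Lemma drawsP (ks : nat -> I) n (J : {set I}) :
  (forall j, (j < n)%N -> ks j \in J) ->
  (forall i j, (i < n)%N -> (j < n)%N -> i != j -> ks i != ks j) -> draws ks n J.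
Proof.
elim: n ks J => [//|n IH] ks J kJ inj /=; split; first exact: kJ.
apply: IH => [j jn|i j i_n j_n ij]; last exact: inj.
by rewrite in_setD1 kJ// andbT; exact: inj.
Qed.

Lemma draws_blocksP N (KS : nat -> nat -> I) m (J : {set I}) :
  (forall i j, (i < m)%N -> (j < N)%N -> KS i j \in J) ->
  (forall i j i' j', (i < m)%N -> (j < N)%N -> (i' < m)%N -> (j' < N)%N ->
    (i, j) != (i', j') -> KS i j != KS i' j') ->
  draws_blocks N KS m J.
Proof.
elim: m KS J => [//|m IH] KS J kJ inj /=; split.
  apply: drawsP => [j jN|j j' jN j'N jj']; first exact: kJ.
  by apply: inj => //; rewrite xpair_eqE eqxx.
apply: IH => [i j im jN|i j i' j' im jN i'm j'N ne].
  apply: mem_undrawn; last exact: kJ.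
  by move=> j' j'N; apply: inj.
by apply: inj => //; rewrite xpair_eqE eqSS -xpair_eqE.
Qed.

End draws.

Section dense.
Context {R : realType} {n : nat}.
Variables (K : set 'rV[R]_n) (x : 'rV[R]_n).
Hypothesis Kx : K x.

Let box (N : nat) (q : 'rV[rat]_n) : set 'rV[R]_n :=
  [set u | K u /\ forall j, `|u ord0 j - ratr (q ord0 j)| <= N.+1%:R^-1].

Let point_of (N : nat) (q : 'rV[rat]_n) : 'rV[R]_n := xget x (box N q).

(* [xget] picks a point of [K] in each rational box meeting [K] (and [x] in the
   other boxes), so no topological separability result is needed. *)
Definition dense_seq (k : nat) : 'rV[R]_n :=
  match @unpickle (nat * 'rV[rat]_n)%type k with
  | Some Nq => point_of Nq.1 Nq.2
  | None => x
  end.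

Lemma dense_seq_in k : K (dense_seq k).
Proof.
rewrite /dense_seq; case: unpickle => [[N q]|//]; rewrite /point_of /=.
by case: xgetP => [y -> []|].
Qed.

Lemma dense_seqP (u : 'rV[R]_n) (e : R) : K u -> 0 < e ->
  exists k, forall j, `|u ord0 j - dense_seq k ord0 j| <= e.
Proof.
move=> Ku e0.
have [N HN] : exists N : nat, 2 * N.+1%:R^-1 <= e.
  have e20 : 0 < e / 2 by rewrite divr_gt0.
  have [N _ HN] := near_infty_natSinv_lt (PosNum e20).
  have h : (N.+1%:R : R)^-1 < e / 2 by exact: (HN N (leqnn N)).
  by exists N; rewrite mulrC -ler_pdivlMr// ltW.
have N0 : 0 < (N.+1%:R : R)^-1 by rewrite invr_gt0.
have qP j : {q : rat | `|u ord0 j - ratr q| <= N.+1%:R^-1}.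
  apply: cid.
  have [|q] := @rat_in_itvoo R (u ord0 j - N.+1%:R^-1) (u ord0 j + N.+1%:R^-1).
    by rewrite ltrD2l gt0_cp.
  rewrite in_itv/= => /andP[q1 q2]; exists q.
  by rewrite ler_distlC; apply/andP; split; exact: ltW.
pose q : 'rV[rat]_n := \row_j sval (qP j).
exists (pickle (N, q)) => j; rewrite /dense_seq pickleK /= /point_of.
case: xgetP => [y _ [Ky yq]|/(_ u)[]]; last first.
  by split => // i; rewrite mxE; exact: svalP (qP i).
have := yq j; have := svalP (qP j); rewrite mxE => h1 h2.
apply: le_trans HN.
have -> : u ord0 j - y ord0 j = (u ord0 j - ratr (sval (qP j))) - (y ord0 j - ratr (sval (qP j))) by ring.
by rewrite mulr_natl mulr2n; apply: le_trans (ler_normB _ _) (lerD h1 h2).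
Qed.

End dense.

(** * Tail bound for suprema of centered signed sums *)

Section tail.
Context {R : realType} d {T : measurableType d}.
Variables (P : probability T R) (mu rE : probability R R) (m n : nat).
Hypothesis symmu : forall B : set R, measurable B -> mu [set - t | t in B] = mu B.
Hypothesis varmu : (\int[mu]_t (t ^+ 2)%:E = 1%:E)%E.
Hypothesis m0 : (0 < m)%N.
Variable Y : nat -> T -> (R * pow R n)%type.
Hypothesis mY : forall i, measurable_fun setT (Y i).
Hypothesis lawY : forall F : pow (R * pow R n)%type m -> \bar R,
  measurable_fun setT F -> (forall v, 0 <= F v)%E ->
  (\int[P]_w F (tup Y m w) = \int[pprod (fun=> blockP mu rE n) m]_v F v)%E.
Variable x : nat -> R.

Definition centered_sum (u : nat -> R) (w : T) : R :=
  \sum_(l < m) (signed_lin x u (Y l w) - mean_signed mu rE n x u).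

Lemma measurable_centered_sum u : measurable_fun setT (centered_sum u).
Proof.
rewrite /centered_sum.
apply: measurable_sum => l; apply: measurable_funB => //.
exact: (measurableT_comp (measurable_signed_lin x u)).
Qed.

Variables (C beta w : R).
Hypothesis C0 : 0 < C.
Hypothesis dom : forall f : R -> R, measurable_fun setT f -> convexR f -> (forall x, 0 <= f x) ->
  (\int[mu]_t (f t)%:E <= \int[gauss]_t (f (C * t))%:E)%E.
Hypothesis beta0 : 0 < beta.

Let t := 4 * C * Num.sqrt m%:R * (w + 5 * beta).

Lemma vmax_scale (I : finType) (i0 : I) (k : R) (c : I -> R) : 0 <= k ->
  vmax i0 (fun i => k * c i) = k * vmax i0 c.
Proof.
move=> k0; apply/le_anti/andP; split.
  by apply: vmax_le => i; rewrite ler_wpM2l// le_vmax.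
by have [i ->] := vmax_attained i0 c; exact: (le_vmax i0 (fun i => k * c i)).
Qed.

Lemma finite_tail (I : finType) (i0 : I) (U : I -> nat -> R) :
  (forall i, nrm n (U i) <= 2) -> (forall j, U i0 j = 0) ->
  (\int[gaussn n]_g (vmax i0 (fun i => lin (U i) g))%:E <= w%:E)%E ->
  (P [set z | (t < vmax i0 (fun i => centered_sum (U i) z))%R] <= (expR (- beta ^+ 2))%:E)%E.
Proof.
move=> U2 U0 Uw.
(* After the Gaussian replacement the exponent is s times 2 C sqrt m M, which is beta M / 2 for this
   [s]. [gauss_sup_mgf] with sigma = 2 bounds the mean by exp (beta w + 4 beta^2), while s t = beta
   w + 5 beta^2; Markov's inequality leaves - beta^2. *)
set s := beta / (4 * C * Num.sqrt m%:R).
have sm0 : 0 < Num.sqrt m%:R :> R by rewrite sqrtr_gt0 ltr0n.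
have k0 : 0 < 4 * C * Num.sqrt m%:R by rewrite !mulr_gt0.
have s0 : 0 < s by rewrite divr_gt0.
pose W z := vmax i0 (fun i => centered_sum (U i) z).
have mW : measurable_fun setT W.
  by apply: measurable_vmax => i; exact: measurable_centered_sum.
pose Z (l : nat) (i : I) (b : R * pow R n) := signed_lin x (U i) b - mean_signed mu rE n x (U i).
have mZ l i : measurable_fun setT (Z l i).
  by apply: measurable_funB => //; exact: measurable_signed_lin.
pose Psi (c : I -> R) := expR (s * vmax i0 c).
have mPsi : measurable_functional Psi := measurable_expR_vmax i0 s.
have Psi0 c : 0 <= Psi c by exact: expR_ge0.
pose F (v : pow (R * pow R n)%type m) := (Psi (fun i => 0 + psum Z v i))%:E.
have mF : measurable_fun setT F.
  apply/measurable_EFinP; apply: mPsi => i; apply: measurable_funD => //.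
  by apply: measurable_psum => l; exact: (mZ l i).
have F0 v : (0 <= F v)%E by rewrite lee_fin.
have E1 : (\int[P]_z (expR (s * W z))%:E = \int[pprod (fun=> blockP mu rE n) m]_v F v)%E.
  rewrite -(lawY mF F0); apply: eq_integral => z _.
  rewrite /F /Psi /W; congr (expR (s * vmax i0 _))%:E; apply/funext => i.
  by rewrite add0r psum_tup.
have mG (l : nat) i : measurable_fun setT (fun g : pow R n => 2 * C * lin (U i) g).
  by apply: measurable_funM => //; exact: measurable_lin.
have E2 : (\int[P]_z (expR (s * W z))%:E <= (expR (beta * w + 4 * beta ^+ 2))%:E)%E.
  rewrite E1.
  have H (l : nat) c := @block_domination R mu rE symmu varmu I i0 n x U C s c (ltW s0) dom.
  have H2 := @psum_le0 R _ _ _ _ I Psi m (fun=> blockP mu rE n) (fun=> gaussn n)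
    Z (fun _ i g => 2 * C * lin (U i) g) (fun=> 0) mPsi Psi0 mZ mG H.
  apply: (le_trans H2).
  rewrite (gauss_msum mPsi Psi0); last by rewrite mulr_gt0.
  have -> : 4 * beta ^+ 2 = beta ^+ 2 * 2 ^+ 2 by ring.
  have := gauss_sup_mgf U2 U0 (ltW beta0) Uw.
  apply: eq2_le; last exact: erefl.
  apply: eq_integral => g _; congr (_%:E).
  rewrite /Psi.
  have -> : (fun i => 0 + 2 * C * Num.sqrt m%:R * lin (U i) g) =
      (fun i => 2 * C * Num.sqrt m%:R * lin (U i) g).
    by apply/funext => i; rewrite add0r.
  rewrite vmax_scale; last by rewrite !mulr_ge0// ltW.
  congr expR; rewrite /s; field => //.
  by rewrite !gt_eqF.
set A := [set z | _].
have mA : measurable A.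
  rewrite (_ : A = W @^-1` `]t, +oo[%classic); last first.
    by apply/seteqP; split => z /=; rewrite in_itv/= andbT.
  by rewrite -[X in measurable X]setTI; apply: mW.
have E3 : ((expR (s * t))%:E * P A <= \int[P]_z (expR (s * W z))%:E)%E.
  have mI : measurable_fun setT (fun z => (\1_A z)%:E : \bar R).
    by apply/measurable_EFinP; exact: measurable_indic.
  have I0 z : setT z -> (0 <= (\1_A z)%:E :> \bar R)%E by rewrite lee_fin.
  have e0 : (0 <= (expR (s * t))%:E :> \bar R)%E by rewrite lee_fin expR_ge0.
  rewrite -[in X in (X <= _)%E](setIT A) -(integral_indic P measurableT mA).
  rewrite -(ge0_integralZl P measurableT mI I0 e0).
  apply: ge0_le_integral; first exact: measurableT.
  - by move=> z _; rewrite -EFinM lee_fin mulr_ge0.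
  - by apply/measurable_EFinP; apply: measurable_funM.
  - apply/measurable_EFinP; apply: (measurableT_comp (@measurable_expR R)).
    exact: measurable_funM.
  move=> z _; rewrite -EFinM lee_fin indicE.
  have [|_] := boolP (z \in A); last by rewrite mulr0 expR_ge0.
  rewrite inE /A /= => zA; rewrite mulr1 ler_expR ler_pM2l//; exact: ltW.
have st : s * t = beta * w + 5 * beta ^+ 2.
  by rewrite /s /t; field; rewrite !gt_eqF.
have := le_trans E3 E2; rewrite st -lee_pdivlMl ?expR_gt0// -EFinM -expRN -expRD.
by congr (_ <= (expR _)%:E)%E; ring.
Qed.

(** The events for the first N + 1 points increase with N and their bound does not depend on N, so
    continuity from below gives the whole sequence. *)
Lemma sup_tail (U : nat -> nat -> R) :
  (forall k, nrm n (U k) <= 2) -> (forall j, U 0%N j = 0) ->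
  (forall N, \int[gaussn n]_g (vmax ord0 (fun i : 'I_N.+1 => lin (U i) g))%:E <= w%:E)%E ->
  measurable [set z | exists k, t < centered_sum (U k) z] /\
  (P [set z | exists k, (t < centered_sum (U k) z)%R] <= (expR (- beta ^+ 2))%:E)%E.
Proof.
move=> U2 U0 Uw.
pose A (N : nat) := [set z | t < vmax ord0 (fun i : 'I_N.+1 => centered_sum (U i) z)].
have mA N : measurable (A N).
  rewrite (_ : A N = (fun z => vmax ord0 (fun i : 'I_N.+1 => centered_sum (U i) z)) @^-1`
     `]t, +oo[%classic); last first.
    by apply/seteqP; split => z /=; rewrite in_itv/= andbT.
  rewrite -[X in measurable X]setTI; apply: measurable_vmax => // i.
  exact: measurable_centered_sum.
have -> : [set z | exists k, t < centered_sum (U k) z] = \bigcup_N A N.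
  apply/seteqP; split => z /=.
    move=> [k tk]; exists k => //; apply: lt_le_trans tk _.
    exact: (le_vmax ord0 (fun i : 'I_k.+1 => centered_sum (U i) z) ord_max).
  move=> [N _]; rewrite /A /= => tv.
  have [i E] := vmax_attained ord0 (fun i : 'I_N.+1 => centered_sum (U i) z).
  by exists i; rewrite -E.
have mbA : measurable (\bigcup_N A N) by exact: bigcupT_measurable.
split => //.
have ndA : nondecreasing_seq A.
  move=> N N' NN'; apply/subsetPset => z; rewrite /A /= => /lt_le_trans; apply.
  apply: vmax_le => i.
  exact: (le_vmax ord0 (fun i : 'I_N'.+1 => centered_sum (U i) z)
    (widen_ord (n := N.+1) (m := N'.+1) NN' i)).
have cvA := nondecreasing_cvg_mu (mu := P) mA mbA ndA.
rewrite -(cvg_lim (@ereal_hausdorff R) cvA).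
apply: lime_le; first by apply/cvg_ex; eexists; exact: cvA.
by apply: nearW => N; exact: finite_tail.
Qed.

End tail.

Section width.
Context {R : realType}.

(** The integrand of the Gaussian width is a supremum over an arbitrary set and may fail to be
    measurable. Integrals of nonnegative functions, being suprema over simple functions below, are
    monotone all the same. *)
Lemma le_integral_nonmeas d (T : measurableType d) (mu : {measure set T -> \bar R})
    (f g : T -> \bar R) :
  (forall z, 0 <= f z)%E -> (forall z, f z <= g z)%E ->
  (\int[mu]_z f z <= \int[mu]_z g z)%E.
Proof.
move=> f0 fg.
have g0 z : (0 <= g z)%E := le_trans (f0 z) (fg z).
rewrite (ge0_integralTE _ f0) (ge0_integralTE _ g0).
apply: ge_ereal_sup => _ [h /= hf <-]; apply: ereal_sup_ubound.
by exists h => // z; exact: le_trans (hf z) (fg z).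
Qed.

Lemma indep_given_full d (T : measurableType d) (P : probability T R) (I : finType)
    (X : I -> T -> R) (nu : I -> probability R R) :
  mutually_independent P X ->
  (forall i (B : set R), measurable B -> P (X i @^-1` B) = nu i B) ->
  indep_given P X nu setT [set: I]%SET 1.
Proof.
move=> indX lawX B mB; rewrite setTI mul1e indX//.
by apply: eq_bigr => i _; exact: lawX.
Qed.

(** Linear forms take coefficients indexed by [nat]; beyond the dimension [inord] returns a default
    index, which forms on [pow R n.+1] never read. *)
Definition crd n (u : 'rV[R]_n.+1) (j : nat) : R := u ord0 (inord j).

Lemma crdE n (u : 'rV[R]_n.+1) (j : 'I_n.+1) : crd u j = u ord0 j.
Proof. by rewrite /crd inord_val. Qed.

Lemma dotp_lin d (T : measurableType d) n (X : 'I_n.+1 -> T -> R) (u : 'rV[R]_n.+1) (z : T) :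
  dotp (\row_j X j z) u = lin (crd u) (tup (fun j => X (inord j)) n.+1 z).
Proof.
rewrite lin_tup; apply: eq_bigr => j _.
by rewrite mxE inord_val crdE mulrC.
Qed.

Lemma width_bound d (W : measurableType d) (Q : probability W R) n
    (G : 'I_n.+1 -> {RV Q >-> R}) (K : set 'rV[R]_n.+1)
    (I : finType) (i0 : I) (v : I -> 'rV[R]_n.+1) :
  mutually_independent Q (fun j => (G j : W -> R)) ->
  (forall j (B : set R), measurable B -> distribution Q (G j) B = normal_prob 0 1 B) ->
  (forall i, diffset K (v i)) -> v i0 = 0 ->
  (\int[gaussn n.+1]_g (vmax i0 (fun i => lin (crd (v i)) g))%:E <=
   gaussian_width_wrt Q (fun j => (G j : W -> R)) K)%E.
Proof.
move=> indG lawG vK v0.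
pose X j : W -> R := G j.
have mX j : measurable_fun setT (X j) by exact: measurable_funPT.
have ind := indep_given_full (nu := fun=> [the probability R R of gauss]) indG lawG.
pose F (g : pow R n.+1) := (vmax i0 (fun i => lin (crd (v i)) g))%:E.
have mF : measurable_fun setT F.
  by apply/measurable_EFinP; apply: measurable_vmax => i; exact: measurable_lin.
have F0 g : (0 <= F g)%E.
  rewrite lee_fin; apply: le_trans (le_vmax i0 _ i0).
  rewrite (@eq_lin R n.+1 _ (fun=> 0)) ?lin0// => j _.
  by rewrite v0 /crd mxE.
have dr : draws (fun j => inord j : 'I_n.+1) n.+1 [set: 'I_n.+1]%SET.
  apply: drawsP => [j _|i j i_n j_n ij]; first by rewrite finset.in_setT.
  by apply: contra ij => /eqP/(congr1 val) /=; rewrite !inordK// => ->.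
rewrite -[leLHS](ge0_integral_tup mX ind dr mF F0).
apply: le_integral_nonmeas => // z.
have [i E] := vmax_attained i0 (fun i => lin (crd (v i)) (tup (fun j => X (inord j)) n.+1 z)).
rewrite /F E -dotp_lin; apply: ereal_sup_ubound.
by exists (v i).
Qed.

Lemma width_ge0 d (W : measurableType d) (Q : probability W R) n
    (G : 'I_n -> W -> R) (K : set 'rV[R]_n) (x : 'rV[R]_n) :
  K x -> (0 <= gaussian_width_wrt Q G K)%E.
Proof.
move=> Kx; apply: integral_ge0 => z _; apply: ereal_sup_ubound.
exists 0; first by exists x => //; exists x => //; rewrite subrr.
by rewrite /dotp big1// => j _; rewrite !mxE mulr0.
Qed.

End width.

Section centered_sum.
Context {R : realType} d {T : measurableType d}.
Variables (mu rE : probability R R) (m n : nat).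
Hypothesis varmu : (\int[mu]_t (t ^+ 2)%:E = 1%:E)%E.
Variables (Y : nat -> T -> (R * pow R n.+1)%type) (x : nat -> R) (z : T).
Notation cs u := (centered_sum mu rE m Y x u z).

Lemma centered_sum_coord (u : nat -> R) :
  cs u = \sum_(j < n.+1) u j * cs (unit_vec j).
Proof.
rewrite /centered_sum.
under [RHS]eq_bigr do rewrite mulr_sumr.
rewrite exchange_big /=; apply: eq_bigr => l _.
rewrite (mean_signedE varmu) (mean_lin_coord varmu) /signed_lin (lin_coord u) !mulr_sumr -sumrB.
apply: eq_bigr => j _; rewrite (mean_signedE varmu); ring.
Qed.

(** At a fixed outcome the centered sum is linear in [u], so it is Lipschitz in the coordinates with
    the finite constant given by the sum of the [|c j|]. *)
Lemma centered_sum_dense (K : set 'rV[R]_n.+1) (y : 'rV[R]_n.+1) (t : R) :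
  (forall k, cs (crd (dense_seq K y k - y)) <= t) ->
  forall u, K u -> cs (crd (u - y)) <= t.
Proof.
move=> H u Ku; apply/ler_addgt0Pr => e e0.
pose c j := cs (unit_vec j).
have S0 : 0 <= \sum_(j < n.+1) `|c j| by apply: sumr_ge0.
have S1 : 0 < 1 + \sum_(j < n.+1) `|c j| by rewrite ltr_pwDl.
have [k kP] := dense_seqP y Ku (divr_gt0 e0 S1).
apply: le_trans (lerD (H k) (lexx e)); rewrite -lerBlDl.
rewrite (centered_sum_coord (crd (u - y))) (centered_sum_coord (crd (dense_seq K y k - y))).
rewrite -sumrB.
apply: (@le_trans _ _ (\sum_(j < n.+1) e / (1 + \sum_(j < n.+1) `|c j|) * `|c j|)).
  apply: ler_sum => j _; rewrite -mulrBl; apply: le_trans (ler_norm _) _.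
  rewrite normrM ler_wpM2r// !crdE !mxE.
  by rewrite (_ : _ - _ - _ = u ord0 j - dense_seq K y k ord0 j) ?kP//; ring.
rewrite -mulr_sumr -mulrA ger_pMr// mulrC ler_pdivrMr// mul1r lerDr//.
Qed.

End centered_sum.

Section euclid.
Context {R : realType} {n : nat}.
Implicit Types u v : 'rV[R]_n.+1.

Lemma norm2_sqr u : norm2 u ^+ 2 = \sum_(j < n.+1) crd u j ^+ 2.
Proof.
rewrite /norm2 sqr_sqrtr; last by apply: sumr_ge0 => j _; rewrite -expr2 sqr_ge0.
by apply: eq_bigr => j _; rewrite crdE expr2.
Qed.

Lemma norm2_sqr_le1 u : norm2 u <= 1 -> norm2 u ^+ 2 <= 1.
Proof. by move=> u1; rewrite exprn_ile1// sqrtr_ge0. Qed.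

Lemma norm2_sqrB u v : norm2 u <= 1 -> norm2 v <= 1 ->
  \sum_(j < n.+1) crd (u - v) j ^+ 2 <= 4.
Proof.
move=> /norm2_sqr_le1 u1 /norm2_sqr_le1 v1.
have H : \sum_(j < n.+1) crd (u - v) j ^+ 2 <=
    2 * norm2 u ^+ 2 + 2 * norm2 v ^+ 2.
  rewrite !norm2_sqr !mulr_sumr -big_split /=; apply: ler_sum => j _.
  rewrite !crdE !mxE -subr_ge0.
  have -> : 2 * u ord0 j ^+ 2 + 2 * v ord0 j ^+ 2 - (u ord0 j - v ord0 j) ^+ 2 =
     (u ord0 j + v ord0 j) ^+ 2 by ring.
  exact: sqr_ge0.
lra.
Qed.

Lemma nrm_crdB u v : norm2 u <= 1 -> norm2 v <= 1 -> nrm n.+1 (crd (u - v)) <= 2.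
Proof.
move=> u1 v1; have H := norm2_sqrB u1 v1.
have S0 : 0 <= \sum_(j < n.+1) crd (u - v) j ^+ 2 by apply: sumr_ge0 => j _; exact: sqr_ge0.
by rewrite /nrm -(@ler_pXn2r _ 2%N)// ?nnegrE ?sqrtr_ge0// sqr_sqrtr// -natrX.
Qed.

Lemma norm2_sqrB_le u v : norm2 u <= 1 -> norm2 v = 1 ->
  norm2 (v - u) ^+ 2 <= - (2 * \sum_(j < n.+1) crd v j * crd (u - v) j).
Proof.
move=> /norm2_sqr_le1 u1 v1.
have -> : norm2 (v - u) ^+ 2 = norm2 u ^+ 2 - norm2 v ^+ 2 -
    2 * \sum_(j < n.+1) crd v j * crd (u - v) j.
  rewrite !norm2_sqr mulr_sumr -!sumrB; apply: eq_bigr => j _.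
  by rewrite !crdE !mxE; ring.
by rewrite v1; lra.
Qed.

End euclid.

Section sample.
Context {R : realType} d {T : measurableType d}.
Variables (P : probability T R) (m n : nat).
Variables (A : 'I_m.+1 -> 'I_n.+1 -> {RV P >-> R}) (E : 'I_m.+1 -> {RV P >-> R}).

Definition sample (l : nat) (w : T) : R * pow R n.+1 :=
  (E (inord l) w, tup (fun j => (A (inord l) (inord j) : T -> R)) n.+1 w).

Lemma measurable_sample l : measurable_fun setT (sample l).
Proof.
apply: measurable_fun_pair; first exact: measurable_funPT.
by apply: measurable_tup => j; exact: measurable_funPT.
Qed.

Notation index := (('I_m.+1 * 'I_n.+1) + 'I_m.+1)%type.

Let X (k : index) : T -> R := match k with
  | inl ij => (A ij.1 ij.2 : T -> R) | inr i => (E i : T -> R) end.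

(** Block [l] lists its noise variable first and then the coordinates of the measurement, so a block
    of length [n.+2] is literally a pair as in [blockP]. *)
Let KS (l j : nat) : index :=
  match j with 0%N => inr (inord l) | j.+1 => inl (inord l, inord j) end.

Let drawsKS : draws_blocks n.+2 KS m.+1 [set: index]%SET.
Proof.
apply: draws_blocksP => [l j _ _|l j l' j' lm jn l'm j'n]; first by rewrite finset.in_setT.
apply: contra => /eqP; rewrite /KS.
case: j j' jn j'n => [|j] [|j'] //= jn j'n.
  by move=> [] /(congr1 val) /=; rewrite !inordK// => ->.
move=> [] /(congr1 val) /= + /(congr1 val) /=.
by rewrite !inordK// => -> ->.
Qed.

Variables (mu rE : probability R R).
Hypothesis lawA : forall i j (B : set R), measurable B -> distribution P (A i j) B = mu B.
Hypothesis lawE : forall i (B : set R), measurable B -> distribution P (E i) B = rE B.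
Hypothesis indAE : mutually_independent P X.

Lemma sample_law (F : pow (R * pow R n.+1)%type m.+1 -> \bar R) :
  measurable_fun setT F -> (forall v, 0 <= F v)%E ->
  (\int[P]_w F (tup sample m.+1 w) =
   \int[pprod (fun=> blockP mu rE n.+1) m.+1]_v F v)%E.
Proof.
move=> mF F0.
pose nu (k : index) := match k with inl _ => mu | inr _ => rE end.
have mX k : measurable_fun setT (X k) by case: k => ?; exact: measurable_funPT.
have lawX k (B : set R) : measurable B -> P (X k @^-1` B) = nu k B.
  by case: k => [[i j]|i] mB; [exact: lawA|exact: lawE].
exact: (ge0_integral_blocks mX (indep_given_full indAE lawX) drawsKS mF F0).
Qed.

End sample.

(** In the application D is the squared error, S = <x, u> and N the noiseless mean in the direction
    u = xhat - x, q = 1 - 2 p and sm = sqrt m. The deviation bound gives - N <= 20 Cd B, the bias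
    bound gives - lam S <= C1 s - N, and D <= - 2 S combines them. *)
Lemma error_bound {R : realType} (lam Cd C1 kappa s q sm w beta D S N : R) :
  0 < lam -> 0 < Cd -> 0 < C1 -> 0 < kappa -> 0 <= s -> 0 < q -> 0 < sm ->
  0 <= w -> 0 < beta ->
  D <= - (2 * S) -> N <= lam * S + C1 * s ->
  - (sm ^+ 2 * (q * N)) <= 4 * (Cd * kappa) * sm * (w + 5 * beta) ->
  D <= (2 / lam * (20 * Cd + C1) + 4) * s +
       (2 / lam * (20 * Cd + C1) + 4) * kappa / (q * sm) * (w + beta).
Proof.
move=> lam0 Cd0 C10 k0 s0 q0 sm0 w0 b0 DS NS H.
set B := kappa / (q * sm) * (w + beta).
have B0 : 0 <= B by rewrite mulr_ge0 ?divr_ge0 ?mulr_ge0 ?addr_ge0// ltW.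
have HN : - N <= 20 * Cd * B.
  have qs0 : 0 < q * sm ^+ 2 by rewrite mulr_gt0// exprn_gt0.
  rewrite -(ler_pM2l qs0).
  have -> : q * sm ^+ 2 * - N = - (sm ^+ 2 * (q * N)) by ring.
  apply: (le_trans H).
  have -> : q * sm ^+ 2 * (20 * Cd * B) = 4 * (Cd * kappa) * sm * (5 * (w + beta)).
    by rewrite /B; field; rewrite !gt_eqF.
  rewrite ler_pM2l ?mulr_gt0//; lra.
have HD : D <= 2 / lam * (C1 * s + 20 * Cd * B).
  rewrite mulrAC ler_pdivlMr//.
  have : D * lam <= - (2 * S) * lam by rewrite ler_pM2r.
  lra.
apply: (le_trans HD).
have l0 : 0 < 2 / lam by rewrite divr_gt0.
have -> : (2 / lam * (20 * Cd + C1) + 4) * kappa / (q * sm) * (w + beta) =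
  (2 / lam * (20 * Cd + C1) + 4) * B by rewrite /B; ring.
rewrite -subr_ge0.
have -> : (2 / lam * (20 * Cd + C1) + 4) * s + (2 / lam * (20 * Cd + C1) + 4) * B -
   2 / lam * (C1 * s + 20 * Cd * B) =
   2 / lam * (20 * Cd * s) + 4 * s + (2 / lam * (C1 * B) + 4 * B) by ring.
have Cd20 : 0 <= 20 * Cd by apply: mulr_ge0 => //; exact: ltW.
apply: addr_ge0; first apply: addr_ge0.
- by apply: mulr_ge0; [exact: ltW|exact: mulr_ge0].
- exact: mulr_ge0.
apply: addr_ge0; last exact: mulr_ge0.
by apply: mulr_ge0; [exact: ltW|apply: mulr_ge0 => //; exact: ltW].
Qed.

Section recovery.
Context {R : realType} d {T : measurableType d} d' {W : measurableType d'}.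
Variables (n m : nat) (mu : probability R R) (p beta w : R).
Variables (P : probability T R) (A : 'I_m.+1 -> 'I_n.+1 -> {RV P >-> R})
  (E : 'I_m.+1 -> {RV P >-> R}).
Variables (Q : probability W R) (G : 'I_n.+1 -> {RV Q >-> R}).
Variables (K : set 'rV[R]_n.+1) (x : 'rV[R]_n.+1).
Hypothesis symmu : forall B : set R, measurable B -> mu [set - t | t in B] = mu B.
Hypothesis varmu : (\int[mu]_t (t ^+ 2)%:E = 1%:E)%E.
Hypothesis lawA :
  forall i j (B : set R), measurable B -> distribution P (A i j) B = mu B.
Hypothesis E1 : forall i, P (E i @^-1` [set 1]) = (1 - p)%:E.
Hypothesis EN1 : forall i, P (E i @^-1` [set -1]) = p%:E.
Hypothesis indAE : mutually_independent P
  (fun k : ('I_m.+1 * 'I_n.+1) + 'I_m.+1 =>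
     match k with inl ij => (A ij.1 ij.2 : T -> R) | inr i => (E i : T -> R) end).
Hypothesis indG : mutually_independent Q (fun j => (G j : W -> R)).
Hypothesis lawG : forall j (B : set R), measurable B ->
  distribution Q (G j) B = normal_prob 0 1 B.
Hypothesis K1 : K `<=` [set u | norm2 u <= 1].
Hypothesis Kx : K x.
Hypothesis x1 : norm2 x = 1.
Hypothesis beta0 : 0 < beta.
Hypothesis widthw : gaussian_width_wrt Q (fun j => (G j : W -> R)) K = w%:E.

Let avec i z := \row_j (A i j z).
Let y i z := E i z * sgn (dotp (avec i z) x).
Let obj z (x' : 'rV[R]_n.+1) := \sum_(i < m.+1) y i z * dotp (avec i z) x'.

Let t (L : R) := 4 * L * Num.sqrt m.+1%:R * (w + 5 * beta).

Lemma maximizer_mean (L : R) : 0 < L ->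
  (forall f : R -> R, measurable_fun setT f -> convexR f -> (forall x, 0 <= f x) ->
    (\int[mu]_t (f t)%:E <= \int[gauss]_t (f (L * t))%:E)%E) ->
  exists Ev : set T, measurable Ev /\
    ((1 - expR (- beta ^+ 2))%:E <= P Ev)%E /\
    forall z, Ev z -> forall xhat, K xhat -> (forall x', K x' -> obj z x' <= obj z xhat) ->
      - (m.+1%:R * ((1 - 2 * p) * mean_lin mu n.+1 (crd x) (crd (xhat - x)))) <= t L.
Proof.
move=> L0 dom.
pose rE : probability R R := [the probability R R of distribution P (E ord0)].
have lawE i (B : set R) : measurable B -> distribution P (E i) B = rE B.
  move=> mB; rewrite (two_point_law (E1 ord0 : rE _ = _) (EN1 ord0 : rE _ = _) mB).
  exact: (two_point_law (r := [the probability R R of distribution P (E i)]) (E1 i) (EN1 i) mB).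
(* Placing [x] first puts the zero direction at index 0, as the nonnegativity of the maxima
   requires. *)
pose V k := match k with 0%N => x | k.+1 => dense_seq K x k end.
have VK k : K (V k) by case: k => [|k] //=; exact: dense_seq_in.
pose U k := crd (V k - x).
pose cs := centered_sum mu rE m.+1 (sample A E) (crd x).
have U0 j : U 0%N j = 0 by rewrite /U /V subrr /crd mxE.
have Uw N : (\int[gaussn n.+1]_g (vmax ord0 (fun i : 'I_N.+1 => lin (U i) g))%:E <= w%:E)%E.
  rewrite -widthw.
  apply: (width_bound (v := fun i : 'I_N.+1 => V i - x) indG lawG) => [i|].
    by exists (V i); [exact: VK|exists x].
  exact: subrr.
have U2 k : nrm n.+1 (U k) <= 2.
  by apply: nrm_crdB; [apply: K1; exact: VK|rewrite x1].
have [mB PB] := sup_tail symmu varmu (ltn0Sn m) (@measurable_sample R d T P m n A E)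
  (sample_law lawA lawE indAE) (crd x) L0 dom beta0 U2 U0 Uw.
set B := [set z | _] in mB PB.
(* The noise takes the values 1 and -1 only almost surely. Intersecting with the event [signs] of
   probability 1 makes [sgn (E l z) = E l z] hold at every outcome considered. *)
pose S : set R := [set 1] `|` [set -1].
have mS : measurable S by apply: measurableU.
have PS i : P (E i @^-1` S) = 1%E.
  have -> : P (E i @^-1` S) = (P (E i @^-1` [set 1%R]) + P (E i @^-1` [set (-1)%R]))%E.
    rewrite -[_ @^-1` S]/(E i @^-1` [set 1] `|` E i @^-1` [set -1]).
    apply: measureU; try by apply: measurable_preimage => //; exact: measurable_funPT.
    apply/seteqP; split => // z [/= -> /eqP].
    by rewrite -subr_eq0 opprK -[1 + 1]/(2%:R) pnatr_eq0.
  by rewrite E1 EN1 -EFinD subrK.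
pose X (k : ('I_m.+1 * 'I_n.+1) + 'I_m.+1) : T -> R :=
  match k with inl ij => (A ij.1 ij.2 : T -> R) | inr i => (E i : T -> R) end.
pose BS (k : ('I_m.+1 * 'I_n.+1) + 'I_m.+1) : set R := if k is inr _ then S else setT.
pose signs := \bigcap_(k in [set k | k \in [set: ('I_m.+1 * 'I_n.+1) + 'I_m.+1]%SET])
  (X k @^-1` BS k).
have mBS k : measurable (BS k) by case: k => ? /=; [exact: measurableT|exact: mS].
have msigns : measurable signs.
  apply: fin_bigcap_measurable; first exact: finite_finset.
  by move=> [ij|i] _; apply: measurable_preimage => //; exact: measurable_funPT.
have Psigns : P signs = 1%E.
  rewrite /signs (indAE _ mBS) big1// => -[ij|i] _; last exact: PS.
  by rewrite preimage_setT probability_setT.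
exists (~` B `&` signs); split; first by apply: measurableI => //; exact: measurableC.
split.
  have H : (P (~` (~` B `&` signs)) <= (expR (- beta ^+ 2))%:E)%E.
    rewrite setCI setCK; apply: le_trans (measureU2 P mB (measurableC msigns)) _.
    have PC : P (~` signs) = 0%E.
      by have := probability_setC P msigns; rewrite Psigns subee.
    by rewrite [X in (_ + X)%E]PC adde0.
  have mD : measurable (~` B `&` signs) by apply: measurableI => //; exact: measurableC.
  have := H; rewrite (probability_setC P mD) EFinB.
  have Df : P (~` B `&` signs) \is a fin_num by exact: fin_num_measure.
  by rewrite (leeBlDl _ _ Df) (leeBlDl _ _ (isT : (expR (- beta ^+ 2))%:E \is a fin_num)) addeC.
move=> z [nB zS] xhat Kxhat mx.
have sgnE l : sgn (E l z) = E l z.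
  have [/= ->|/= ->] := zS (inr l) (finset.in_setT _); rewrite /sgn ?ler01//.
  by rewrite lerNr oppr0 ler10.
have csU : cs (crd (xhat - x)) z <= t L.
  apply: (centered_sum_dense varmu (K := K)) => // k.
  rewrite leNgt; apply/negP => tk; apply: nB.
  by exists k.+1.
have -> : - (m.+1%:R * ((1 - 2 * p) * mean_lin mu n.+1 (crd x) (crd (xhat - x)))) =
    cs (crd (xhat - x)) z - (obj z xhat - obj z x).
  have -> : obj z xhat - obj z x =
      \sum_(l < m.+1) signed_lin (crd x) (crd (xhat - x)) (sample A E l z).
    rewrite -sumrB; apply: eq_bigr => l _.
    rewrite /signed_lin /sample /= inord_val sgnE.
    rewrite -!(dotp_lin (fun j => (A l j : T -> R))) /y /avec.
    rewrite /dotp -mulrBr -sumrB; congr (_ * _); apply: eq_bigr => j _.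
    by rewrite !mxE mulrBr.
  rewrite /cs /centered_sum sumrB sumr_const card_ord.
  rewrite (mean_signedE varmu) (two_point_mean (E1 ord0 : rE _ = _) (EN1 ord0 : rE _ = _)).
  by rewrite -mulr_natl; ring.
by have := mx x Kx; lra.
Qed.

End recovery.

Unset Implicit Arguments.

Theorem theorem5p1 (R : realType) :
  exists C : R, 0 < C /\
  forall (n m : nat)
    (* law mu of the random variable a *)
    (mu : probability R R) (kappa eps p beta : R)
    (* the probability space carrying the a_i and the eps_i *)
    (d : measure_display) (T : measurableType d) (P : probability T R)
    (A : 'I_m -> 'I_n -> {RV P >-> R}) (E : 'I_m -> {RV P >-> R})
    (* an auxiliary standard Gaussian vector g, used for w(K) *)
    (d' : measure_display) (W : measurableType d') (Q : probability W R)
    (G : 'I_n -> {RV Q >-> R})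
    (K : set 'rV[R]_n) (x : 'rV[R]_n),
    (0 < m)%N ->
    (* a symmetric *)
    (forall B : set R, measurable B -> mu [set - t | t in B] = mu B) ->
    (* E a^2 = 1 *)
    (\int[mu]_t (t ^+ 2)%:E = 1%:E)%E ->
    (* sub-gaussian with sub-gaussian norm kappa *)
    subg_norm mu = kappa%:E ->
    (* ||a - g||_TV <= eps, g ~ N(0,1) *)
    (tv_dist mu (normal_prob 0 1) <= eps%:E)%E ->
    (* coordinates of the a_i are copies of a *)
    (forall i j (B : set R), measurable B -> distribution P (A i j) B = mu B) ->
    (* noise: P(eps_i = 1) = 1 - p, P(eps_i = -1) = p *)
    0 <= p -> p < 1 / 2 ->
    (forall i, P (E i @^-1` [set 1]) = (1 - p)%:E) ->
    (forall i, P (E i @^-1` [set -1]) = p%:E) ->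
    (* all a_{ij} and eps_i are (mutually) independent *)
    mutually_independent P
      (fun k : ('I_m * 'I_n) + 'I_m =>
         match k with inl ij => (A ij.1 ij.2 : T -> R) | inr i => (E i : T -> R) end) ->
    (* g = (G_j) standard Gaussian vector in R^n *)
    mutually_independent Q (fun j => (G j : W -> R)) ->
    (forall j (B : set R), measurable B ->
       distribution Q (G j) B = normal_prob 0 1 B) ->
    (* K subset of the unit ball, x in K with ||x||_2 = 1 *)
    K `<=` [set u | norm2 u <= 1] ->
    K x -> norm2 x = 1 ->
    0 < beta ->
    let avec i w := \row_j (A i j w) in
    let y i w := E i w * sgn (dotp (avec i w) x) in
    let obj w (x' : 'rV[R]_n) := \sum_(i < m) y i w * dotp (avec i w) x' in
    exists Ev : set T, measurable Ev /\
      ((1 - 4 * expR (- beta ^+ 2))%:E <= P Ev)%E /\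
      forall w, Ev w ->
      forall xhat : 'rV[R]_n, K xhat -> (forall x', K x' -> obj w x' <= obj w xhat) ->
        (((norm2 (x - xhat)) ^+ 2)%:E <=
          (C * Num.sqrt kappa * eps `^ (1 / 8))%:E +
           (C * kappa / ((1 - 2 * p) * Num.sqrt m%:R))%:E *
             (gaussian_width_wrt Q (fun j => (G j : W -> R)) K + beta%:E))%E.
Proof.
have [Cd Cd0 dom] := @subg_convex_domination R.
have [C1 C10 bias] := @mean_lin_bias R.
have lam0 := @gauss_abs_gt0 R.
(* The summand 4 covers the case [sk * r > 1], where the squared diameter bound 4 is already below
   [C * (sk * r)]. *)
set C := 2 / gauss_abs * (20 * Cd + C1) + 4.
have C4 : 4 <= C.
  rewrite lerDr mulr_ge0 ?divr_ge0 ?addr_ge0 ?mulr_ge0 //; exact: ltW.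
have C0 : 0 < C by exact: lt_le_trans C4.
exists C; split => //.
move=> n m mu kappa eps p beta d T P A E d' W Q G K x m0 symmu varmu subgmu tvmu lawA p0 p12
  E1 EN1 indAE indG lawG K1 Kx x1 beta0.
have kappa0 := subg_norm_gt0 varmu subgmu.
have q0 : 0 < 1 - 2 * p by lra.
have sm0 : 0 < Num.sqrt m%:R :> R by rewrite sqrtr_gt0 ltr0n.
have k0 : 0 < C * kappa / ((1 - 2 * p) * Num.sqrt m%:R).
  by rewrite divr_gt0 ?mulr_gt0.
have e40 : 0 <= expR (- beta ^+ 2) by exact: expR_ge0.
have w0 := width_ge0 Q (fun j => (G j : W -> R)) Kx.
(* For infinite width the right-hand side is infinite, so the whole space serves as the event. *)
case E0 : (gaussian_width_wrt Q (fun j => (G j : W -> R)) K) => [w| |]; last 2 first.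
- move=> avec y obj; exists setT; split; first exact: measurableT.
  split; first by rewrite probability_setT lee_fin; lra.
  move=> z _ xhat _ _.
  by rewrite addye// gt0_muley ?lte_fin// addey// leey.
- by move: w0; rewrite E0.
rewrite E0 lee_fin in w0.
case: n m A E G K x m0 lawA E1 EN1 indAE indG lawG K1 Kx x1 sm0 k0 E0
    => [|n] [|m] A E G K x // m0 lawA E1 EN1 indAE indG lawG K1 Kx x1 sm0 k0 E0 avec y obj.
  by move: x1 => /eqP; rewrite /norm2 /dotp big_ord0 sqrtr0 eq_sym oner_eq0.
have L0 : 0 < Cd * kappa by rewrite mulr_gt0.
have [Ev [mEv [PEv HEv]]] := maximizer_mean symmu varmu lawA E1 EN1 indAE indG lawG K1 Kx x1
  beta0 E0 L0 (dom mu kappa symmu varmu subgmu).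
exists Ev; split => //; split.
  by apply: le_trans PEv; rewrite lee_fin; lra.
move=> z zEv xhat Kxhat mx.
have xhat1 := K1 _ Kxhat; rewrite /= in xhat1.
rewrite -(EFinD w beta) -(EFinM _ (w + beta)) -EFinD lee_fin.
have eps0 : 0 <= eps.
  rewrite -lee_fin; apply: le_trans tvmu; apply: ereal_sup_ubound.
  by exists set0; [exact: measurable0|rewrite !measure0 subee// abse0].
set D := norm2 (x - xhat) ^+ 2.
set B := _ / _ * _.
have B0 : 0 <= B.
  by apply: mulr_ge0; [exact: ltW|apply: addr_ge0 => //; exact: ltW].
set sk := Num.sqrt kappa.
have sk0 : 0 <= sk by exact: sqrtr_ge0.
(* [r] stands for the eighth root of [eps] but must be positive for the choices of [T] and [delta],
   whereas [eps] may be 0. *)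
have main r : 0 < r -> eps <= r ^+ 8 -> D <= C * (sk * r) + B.
  move=> r0 epsr.
  have s0 : 0 <= sk * r by rewrite mulr_ge0// ltW.
  have [skr|skr] := lerP (sk * r) 1; last first.
    have D4 : D <= 4.
      have := norm2_sqrB (K1 _ Kx) xhat1; rewrite -norm2_sqr.
      by [].
    apply: (le_trans D4); apply: ler_wpDr => //.
    have : 4 * 1 <= C * (sk * r) by apply: ler_pM => //; exact: ltW.
    by rewrite mulr1.
  have xx : \sum_(j < n.+1) crd x j ^+ 2 = 1 by rewrite -norm2_sqr x1 expr1n.
  have xU := norm2_sqrB xhat1 (K1 _ Kx).
  have := bias mu kappa eps r n.+1 (crd x) (crd (xhat - x)) symmu varmu subgmu tvmu r0 epsr
    skr xx xU.
  have := norm2_sqrB_le xhat1 x1; rewrite -/D.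
  move=> DS NS.
  have H := HEv z zEv xhat Kxhat mx.
  apply: (error_bound lam0 Cd0 C10 kappa0 s0 q0 sm0 w0 beta0 DS NS).
  by rewrite sqr_sqrtr.
(* An arbitrary slack [e] makes [r] positive: the root is enlarged by exactly what contributes [e]
   to the final bound. *)
apply/ler_addgt0Pr => e e0.
have sk1 : 0 < C * sk by rewrite mulr_gt0// sqrtr_gt0.
pose r := eps `^ (1 / 8) + e / (C * sk).
have h0 : 0 < e / (C * sk) by rewrite divr_gt0.
have r0 : 0 < r by rewrite ltr_wpDl// powR_ge0.
have epsr : eps <= r ^+ 8.
  have -> : eps = (eps `^ (1 / 8)) ^+ 8.
    rewrite -powR_mulrn ?powR_ge0// -powRrM (_ : 1 / 8 * 8%:R = 1) ?powRr1//.
    by rewrite mul1r mulVf// pnatr_eq0.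
  by rewrite lerXn2r ?nnegrE ?powR_ge0// ?lerDl ltW.
apply: (le_trans (main r r0 epsr)).
have -> : C * (sk * r) = C * sk * eps `^ (1 / 8) + e.
  by rewrite /r mulrA mulrDr [X in _ + X]mulrC divfK// gt_eqF.
by rewrite addrAC.
Qed.
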